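(* Let $(\mathfrak g,d_0,(\cdot,\cdot))$ be a dg Lie algebra with Lie bracket of degree $0$ and differential $d_0$ of degree $-1$. Suppose that $d_0+\hbar d_1+\hbar^2d_2+\cdots$ is an inhomogeneous deformation of $d_0$, where the degree of $d_n$ is $2n-1$ for each $n$. Define the higher derived brackets $$D_0:=(\cdot,\cdot),\quad D_1:=d_0,\quad D_2:=(d_1\,\cdot,\cdot),\quad D_3:=((d_2\,\cdot,\cdot),\cdot),\ \dots,$$ i.e. $D_n(x_1,\dots,x_n)=((\cdots((d_{n-1}x_1,x_2),x_3),\cdots),x_n)$ for $n\ge1$. Then $(\mathfrak g,D_0,D_1,D_2,\dots)$ is an invariant sh Leibniz algebra (with Lie bracket $D_0$ and sh Leibniz structure $D_1,D_2,\dots$).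
   Context: Field of characteristic zero; Koszul sign rule; $s$ is the degree $+1$ shift. A deformation $d_0+\hbar d_1+\hbar^2d_2+\cdots$ of $d_0$ ($\hbar$ a formal parameter) means that all $d_n$ are derivations of the Lie bracket and $\sum_{i+j=n}d_id_j=0$ for all $n\ge 0$. Odd sh Leibniz algebra: a graded space $\mathfrak g$ with maps $D_n:\mathfrak g^{\otimes n}\to\mathfrak g$, $n\ge1$, $|D_n|=2n-3$, such that the induced coderivations of the Zinbiel coalgebra $\bar T\mathfrak g=\bigoplus_{n\ge1}\mathfrak g^{\otimes n}$ (coproduct $\Delta_z(v_1\otimes\cdots\otimes v_n)=\sum_{i=1}^{n-1}\mathrm{unshuff}_i^{(\emptyset,n)}(v_1\otimes\cdots\otimes v_n)$, see below; $D_n$ extends by $v_1\otimes\cdots\otimes v_N\mapsto\sum_{n\le k\le N}\sum_\sigma\varepsilon(\sigma)(-1)^{|D_n|(|v_{\sigma(1)}|+\cdots+|v_{\sigma(k-n)}|)}v_{\sigma(1)}\otimes\cdots\otimes v_{\sigma(k-n)}\otimes D_n(v_{\sigma(k-n+1)},\dots,v_{\sigma(k-1)},v_k)\otimes v_{k+1}\otimes\cdots\otimes v_N$, $\sigma$ over $(k-n,n-1)$-unshuffles) have sum of square zero. Equivalently $\partial_{shLeib}:=\sum_{n\ge1}\tilde\partial_n$ has square zero, where $\tilde\partial_n$ is the coderivation of $\bar Ts\bar Ss\mathfrak g$ (see below) induced by $ssD_n(s^{-1})^{\otimes n}(s^{-1})^{\otimes n}:(ss\mathfrak g)^{\otimes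 n}\to ss\mathfrak g$. Invariant sh Leibniz algebra: an odd sh Leibniz algebra with a Lie bracket $(\cdot,\cdot)$ of degree $0$ such that $\partial_{Lie}+\partial_{shLeib}$ is a codifferential on $\bar Ts\bar Ss\mathfrak g$, where $\partial_{Lie}$ is induced by $ss(\cdot,\cdot)(s^{-1}\otimes s^{-1})s^{-1}:s\bar S^2s\mathfrak g\to ss\mathfrak g$. Bar coalgebra. $\bar SV=\bigoplus_{n\ge1}\bar S^nV$, $\bar TW=\bigoplus_{n\ge1}W^{\otimes n}$. Write $\mathrm{unshuff}_i(w_1\cdots w_n)=\sum_\sigma\varepsilon(\sigma)(w_{\sigma(1)}\cdots w_{\sigma(i)},w_{\sigma(i+1)}\cdots w_{\sigma(n)})$ over $(i,n-i)$-unshuffles ($\varepsilon$ the Koszul sign), and $\mathrm{unshuff}_i^{(a,b)}$ for the sub-sum with $w_a$ in the left and $w_b$ in the right word ($a=\emptyset$: no condition on the left). Let $\Delta_c^0=\sum_{i=1}^{n-1}\mathrm{unshuff}_i$ on $\bar S^nV$ and $\Delta_c=(s\otimes s)\Delta_c^0s^{-1}$ on $s\bar SV$. With $V=s\mathfrak g$, $\bar Ts\bar Ss\mathfrak g$ is the cofree (nilpotent) $\mathcal{Z}inb\odot\mathbf{s}\mathcal{C}om$-coalgebra cogenerated by $ss\mathfrak g$, with $\Delta_z(sc_1\otimes\cdots\otimes sc_n)=\sum_{i=1}^{n-1}\mathrm{unshuff}_i^{(\emptyset,n)}(sc_1\otimes\cdots\otimes sc_n)$ and $\Delta_c(sc_1\otimes\cdots\otimes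 sc_n)=A-\tau A+B$, where $\tau$ is the graded flip, $A=\sum_{k=1}^{n-1}\sum_{i=1}^{n-1}\mathrm{unshuff}_i^{(k,n)}(-1)^{|sc_1|+\cdots+|sc_{k-1}|}(sc_1\otimes\cdots\otimes\Delta_c(sc_k)\otimes\cdots\otimes sc_n)$ ($\Delta_c(sc_k)$ treated as one letter), $B=\big(\sum_{i=0}^{n-1}\mathrm{unshuff}_i(-1)^{|sc_1|+\cdots+|sc_{n-1}|}(sc_1\otimes\cdots\otimes sc_{n-1})\big)\otimes\Delta_c(sc_n)$ componentwise. A coderivation is an endomorphism $\partial$ with $(\partial\otimes1+1\otimes\partial)\Delta_z=\Delta_z\partial$ and $(-1)^{|\partial|}(\partial\otimes1+1\otimes\partial)\Delta_c=\Delta_c\partial$; coderivations correspond bijectively, by projection to $ss\mathfrak g$, to linear maps $\bar Ts\bar Ss\mathfrak g\to ss\mathfrak g$, and the coderivation induced by a map is the corresponding one. A codifferential is a coderivation of square zero (here of degree $-1$).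
   Formalization: The map inducing the n-th Leibniz coderivation is taken as ssx_1⊗…⊗ssx_n ↦ ssD_n(x_1,…,x_n) with no sign; the Koszul rule applied literally to (s^{-1})^{⊗n}(s^{-1})^{⊗n} would add (-1)^{n(n-1)/2}, contradicting the stated equivalence. *)

(* Defs.v *)
From HB Require Import structures.
From mathcomp Require Import all_boot all_order all_algebra.
From mathcomp Require Import boolp.
From mathcomp Require Import freeg.

Set Implicit Arguments.
Unset Strict Implicit.
Unset Printing Implicit Defensive.

Import GRing.Theory.
Local Open Scope ring_scope.
Local Open Scope quotient_scope.

Section Presented.
Variables (K : fieldType) (X : choiceType).
Local Notation F := {freeg X / K}.
Variable rel : F -> Prop.

Inductive rel_span : F -> Prop :=
| rel_span0 : rel_span 0
| rel_spanD a r u : rel r -> rel_span u -> rel_span (a *: r + u).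

Lemma rel_span_add u v : rel_span u -> rel_span v -> rel_span (u + v).
Proof.
move=> hu hv; elim: hu => [|a r u' hr _ ih]; first by rewrite add0r.
by rewrite -addrA; apply: rel_spanD.
Qed.

Lemma rel_spanZ a u : rel_span u -> rel_span (a *: u).
Proof.
elim=> [|b r u' hr _ ih]; first by rewrite scaler0; apply: rel_span0.
by rewrite scalerDr scalerA; apply: rel_spanD.
Qed.

Definition rel_ideal : {pred F} := fun u => `[< rel_span u >].

Lemma rel_idealP u : reflect (rel_span u) (u \in rel_ideal).
Proof. exact: asboolP. Qed.

Lemma rel_ideal_zmod : zmod_closed rel_ideal.
Proof.
split=> [|u v /rel_idealP hu /rel_idealP hv]; apply/rel_idealP.
  exact: rel_span0.
by apply: rel_span_add => //; rewrite -scaleN1r; apply: rel_spanZ.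
Qed.

HB.instance Definition _ := GRing.isZmodClosed.Build F rel_ideal rel_ideal_zmod.

Definition presented := Quotient.quot rel_ideal.

HB.instance Definition _ := GRing.Zmodule.on presented.
HB.instance Definition _ := EqQuotient.on presented.

Definition pscale (a : K) (q : presented) : presented :=
  \pi_presented (a *: repr q).

Lemma pscale_pi a (u : F) : pscale a (\pi_presented u) = \pi_presented (a *: u).
Proof.
apply/eqP; rewrite /pscale -Quotient.idealrBE -scalerBr.
apply/rel_idealP/rel_spanZ/rel_idealP.
by rewrite Quotient.idealrBE reprK.
Qed.

Lemma pi_addE (u v : F) :
  \pi_presented (u + v) = \pi_presented u + \pi_presented v.
Proof. exact: (Quotient.pi_add rel_ideal). Qed.

Lemma presentedW (P : presented -> Prop) :
  (forall u, P (\pi_presented u)) -> forall q, P q.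
Proof. by move=> h q; rewrite -[q]reprK. Qed.

Lemma pscaleA a b q : pscale a (pscale b q) = pscale (a * b) q.
Proof. by elim/presentedW: q => u; rewrite !pscale_pi scalerA. Qed.

Lemma pscale1 : left_id 1 pscale.
Proof. by elim/presentedW=> u; rewrite pscale_pi scale1r. Qed.

Lemma pscaleDr : right_distributive pscale +%R.
Proof.
move=> a; elim/presentedW=> u; elim/presentedW=> v.
by rewrite -pi_addE !pscale_pi -pi_addE scalerDr.
Qed.

Lemma pscaleDl q : {morph pscale^~ q : a b / a + b}.
Proof.
by elim/presentedW: q => u a b; rewrite !pscale_pi -pi_addE scalerDl.
Qed.

HB.instance Definition _ := GRing.Zmodule_isLmodule.Build K presented
  pscaleA pscale1 pscaleDr pscaleDl.

Lemma pi_scaleE a (u : F) : \pi_presented (a *: u) = a *: \pi_presented u.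
Proof. by rewrite -pscale_pi. Qed.

Definition gen (x : X) : presented := \pi_presented << x >>.

End Presented.

Section Lift.
Variables (K : fieldType) (X : choiceType) (E : lmodType K) (phi : X -> E).

Lemma fgliftB u v : fglift phi (u - v) = fglift phi u - fglift phi v.
Proof. exact: (lift_is_additive phi). Qed.

Lemma fglift0 : fglift phi 0 = 0.
Proof. by rewrite -[0](subrr 0) fgliftB subrr. Qed.

Lemma fgliftD u v : fglift phi (u + v) = fglift phi u + fglift phi v.
Proof.
rewrite -{1}[v]opprK fgliftB -[- v]sub0r fgliftB fglift0.
by rewrite sub0r opprK.
Qed.

Lemma fglift_sum (I : Type) (s : seq I) (G : I -> {freeg X / K}) :
  fglift phi (\sum_(x <- s) G x) = \sum_(x <- s) fglift phi (G x).
Proof. by elim/big_rec2: _ => [|x u v _ <-]; rewrite ?fglift0 ?fgliftD. Qed.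

Lemma fgliftZ a u : fglift phi (a *: u) = a *: fglift phi u.
Proof.
rewrite -[a *: u]/(fgscale a u) /fgscale fglift_sum -[in RHS](freeg_sumE u).
rewrite fglift_sum scaler_sumr; apply: eq_bigr => x _.
by rewrite !liftU scalerA.
Qed.

Lemma fglift1 x : fglift phi << x >> = phi x.
Proof. by rewrite liftU scale1r. Qed.

Lemma fgliftE u : fglift phi u = \sum_(x <- dom u) coeff x u *: phi x.
Proof.
rewrite -{1}(freeg_sumE u) fglift_sum; apply: eq_bigr => x _.
by rewrite liftU.
Qed.

Definition kills (rel : {freeg X / K} -> Prop) :=
  forall r, rel r -> fglift phi r = 0.

Variables (rel : {freeg X / K} -> Prop) (phiP : kills rel).

Definition plift_fun (q : presented rel) : E := fglift phi (repr q).

Lemma plift_pi u : plift_fun (\pi_(presented rel) u) = fglift phi u.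
Proof.
have /rel_idealP : repr (\pi_(presented rel) u) - u \in rel_ideal rel.
  by rewrite Quotient.idealrBE reprK.
rewrite /plift_fun => hs; apply/eqP; rewrite -subr_eq0 -fgliftB; apply/eqP.
elim: hs => [|a r w hr _ ih]; first exact: fglift0.
by rewrite fgliftD fgliftZ ih phiP // scaler0 addr0.
Qed.

Lemma plift_linear : linear plift_fun.
Proof.
move=> a; elim/presentedW=> u; elim/presentedW=> v.
by rewrite -pi_scaleE -pi_addE !plift_pi fgliftD fgliftZ.
Qed.

Definition plift of kills rel := plift_fun.

HB.instance Definition _ :=
  GRing.isLinear.Build K (presented rel) E *:%R (plift phiP) plift_linear.

Lemma plift_gen x : plift phiP (gen rel x) = phi x.
Proof. by rewrite /plift plift_pi fglift1. Qed.

End Lift.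

Section PresentedTheory.
Variables (K : fieldType) (X : choiceType) (rel : {freeg X / K} -> Prop).

Lemma pi_0E : \pi_(presented rel) 0 = 0.
Proof. by apply: (addIr (\pi 0)); rewrite -pi_addE !add0r. Qed.

Lemma pi_genE (u : {freeg X / K}) :
  \pi_(presented rel) u = fglift (gen rel) u.
Proof.
rewrite -(freeg_sumE u) fglift_sum.
elim: (dom u) => [|x s ih]; first by rewrite !big_nil pi_0E.
rewrite !big_cons pi_addE ih; congr (_ + _).
rewrite liftU /gen -pi_scaleE; congr (\pi _).
by apply/eqP/freeg_eqP => y; rewrite coeffZ !coeffU mul1r.
Qed.

Lemma gen_kills : kills (gen rel) rel.
Proof.
move=> r hr; rewrite -pi_genE -pi_0E; apply/eqP; rewrite -Quotient.idealrBE.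
by rewrite subr0 -[r]scale1r -[1 *: r]addr0; apply/rel_idealP/rel_spanD/rel_span0.
Qed.

End PresentedTheory.

Section Kills.
Variables (K : fieldType) (X : choiceType) (E : lmodType K).
Implicit Type rel : {freeg X / K} -> Prop.

Lemma fglift_comp (Y : choiceType) (psi : Y -> E) (f : X -> {freeg Y / K}) r :
  fglift psi (fglift f r) = fglift (fun x => fglift psi (f x)) r.
Proof.
rewrite (fgliftE f) fglift_sum [RHS]fgliftE; apply: eq_bigr => x _.
by rewrite fgliftZ.
Qed.

Lemma eq_kills rel (phi psi : X -> E) :
  phi =1 psi -> kills phi rel -> kills psi rel.
Proof.
move=> e h r /h <-; rewrite !fgliftE.
by apply: eq_bigr => x _; rewrite e.
Qed.

Lemma kills_cst0 rel : kills (fun _ => 0 : E) rel.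
Proof. by move=> r _; rewrite fgliftE big1 // => x _; rewrite scaler0. Qed.

Lemma kills_sum rel (I : Type) (s : seq I) (P : pred I) (phi : I -> X -> E) :
  (forall i, P i -> kills (phi i) rel) ->
  kills (fun x => \sum_(i <- s | P i) phi i x) rel.
Proof.
move=> h r hr; rewrite fgliftE.
under eq_bigr do rewrite scaler_sumr.
rewrite exchange_big big1 // => i Pi.
by rewrite -fgliftE h.
Qed.

Lemma kills_linear rel (E' : lmodType K) (f : {linear E -> E'}) phi :
  kills phi rel -> kills (fun x => f (phi x)) rel.
Proof.
move=> h r /h e; transitivity (f (fglift phi r)); last by rewrite e linear0.
rewrite !fgliftE linear_sum.
by apply: eq_bigr => x _; rewrite linearZ.
Qed.

Lemma kills_scale rel a (phi : X -> E) :
  kills phi rel -> kills (fun x => a *: phi x) rel.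
Proof.
move=> h r /h e; transitivity (a *: fglift phi r); last by rewrite e scaler0.
rewrite !fgliftE scaler_sumr.
by apply: eq_bigr => x _; rewrite !scalerA mulrC.
Qed.

End Kills.

Section Tensor.
Variables (K : fieldType) (V W : lmodType K).

Inductive tens_rel : {freeg (V * W)%type / K} -> Prop :=
| tens_linl a x x' y :
    tens_rel (<< (a *: x + x', y) >> - a *: << (x, y) >> - << (x', y) >>)
| tens_linr a x y y' :
    tens_rel (<< (x, a *: y + y') >> - a *: << (x, y) >> - << (x, y') >>).

Definition tensor := presented tens_rel.
HB.instance Definition _ := GRing.Lmodule.on tensor.

Definition tens (x : V) (y : W) : tensor := gen tens_rel (x, y).

Lemma tens_is_linearl y : linear (tens^~ y).
Proof.
move=> a x x'; apply/eqP; rewrite -subr_eq0 opprD addrA; apply/eqP.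
have := gen_kills (tens_linl a x x' y).
by rewrite !fgliftB fgliftZ !fglift1.
Qed.

Lemma tens_is_linearr x : linear (tens x).
Proof.
move=> a y y'; apply/eqP; rewrite -subr_eq0 opprD addrA; apply/eqP.
have := gen_kills (tens_linr a x y y').
by rewrite !fgliftB fgliftZ !fglift1.
Qed.

HB.instance Definition _ x :=
  GRing.isLinear.Build K W tensor *:%R (tens x) (tens_is_linearr x).

Definition tensr (y : W) (x : V) : tensor := tens x y.
HB.instance Definition _ y :=
  GRing.isLinear.Build K V tensor *:%R (tensr y) (tens_is_linearl y).

End Tensor.

Section TensorMap.
Variables (K : fieldType) (V W V' W' : lmodType K).
Variables (f : {linear V -> V'}) (h : {linear W -> W'}).

Definition tens_map_gen (p : V * W) : tensor V' W' := tens (f p.1) (h p.2).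

Lemma tens_map_kills : kills tens_map_gen (@tens_rel K V W).
Proof.
move=> _ [a x x' y|a x y y']; rewrite !fgliftB fgliftZ !fglift1 /tens_map_gen /=.
  by rewrite linearP tens_is_linearl -addrA -opprD subrr.
by rewrite !linearP -addrA -opprD subrr.
Qed.

(* f (x) h, without sign *)
Definition tens_map : {linear tensor V W -> tensor V' W'} :=
  plift tens_map_kills.

End TensorMap.

Record gradedSpace (K : fieldType) := GradedSpace {
  gspace :> lmodType K;
  ghom : int -> gspace -> Prop;
  ghom0 : forall i, ghom i 0;
  ghomP : forall i a x y, ghom i x -> ghom i y -> ghom i (a *: x + y);
  ghom_sum : forall x, exists2 s : seq (int * gspace),
    (forall p, p \in s -> ghom p.1 p.2) & x = \sum_(p <- s) p.2;
  ghom_direct : forall (s : seq int) (x : int -> gspace), uniq s ->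
    (forall i, ghom i (x i)) -> \sum_(i <- s) x i = 0 ->
    forall i, i \in s -> x i = 0
}.

Definition ksgn (K : fieldType) (n : int) : K := (-1) ^ n.
Arguments ksgn : simpl never.

Section GradedLie.
Variables (K : fieldType) (g : gradedSpace K).

Definition has_degree (p : int) (f : g -> g) :=
  forall i x, ghom i x -> ghom (i + p) (f x).

Definition lie_bracket (br : g -> g -> g) := [/\
  (forall y, linear (br^~ y)) /\ (forall x, linear (br x)),
  (forall i j x y, ghom i x -> ghom j y -> ghom (i + j) (br x y)),
  (forall i j x y, ghom i x -> ghom j y ->
     br x y = - (ksgn K (i * j) *: br y x)) &
  (forall i j x y z, ghom i x -> ghom j y ->
     br x (br y z) = br (br x y) z + ksgn K (i * j) *: br y (br x z))].

Definition derivation (br : g -> g -> g) (p : int) (f : g -> g) :=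
  forall i x y, ghom i x ->
    f (br x y) = br (f x) y + ksgn K (p * i) *: br x (f y).

Definition dg_lie (br : g -> g -> g) (d0 : g -> g) := [/\
  lie_bracket br, linear d0, has_degree (-1) d0, derivation br (-1) d0 &
  forall x, d0 (d0 x) = 0].

(* the formal series d 0 + hbar d 1 + hbar^2 d 2 + ..., with |d n| = e n *)
Definition deformation (br : g -> g -> g) (e : nat -> int)
    (d : nat -> g -> g) :=
  forall n, [/\ linear (d n), has_degree (e n) (d n),
    derivation br (e n) (d n) &
    forall x, \sum_(i < n.+1) d i (d (n - i)%N x) = 0].

End GradedLie.

Section Unshuffle.
Variable K : fieldType.

(* An unshuffle of a word is encoded by the bit mask of the letters which go
   to the left word. A letter sent to the right is exchanged with the later
   letters that are sent to the left. *)
Fixpoint koszul (m : bitseq) (ds : seq int) : K :=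
  match m, ds with
  | b :: m', d :: ds' =>
      (if b then 1 else ksgn K (d * \sum_(e <- mask m' ds') e)) * koszul m' ds'
  | _, _ => 1
  end.

Definition unshuff_cond (a b : option nat) (m : bitseq) :=
  (if a is Some k then nth false m k else true) &&
  (if b is Some k then ~~ nth true m k else true).

(* the image under F of unshuff_i^(a, b) of w; letters are numbered from 0 *)
Definition unshuff (L : Type) (deg : L -> int) (a b : option nat) (i : nat)
    (E : lmodType K) (F : seq L -> seq L -> E) (w : seq L) : E :=
  \sum_(m : (size w).-tuple bool | (count id m == i) && unshuff_cond a b m)
    koszul m (map deg w) *: F (mask m w) (mask (map negb m) w).

Lemma mask_mid (L : Type) (m : bitseq) (u v : seq L) y :
  size m = (size u + (size v).+1)%N ->
  mask m (u ++ y :: v) = mask (take (size u) m) u ++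
    (if nth false m (size u) then [:: y] else [::]) ++
    mask (drop (size u).+1 m) v.
Proof.
move=> sm; have lt : (size u < size m)%N by rewrite sm addnS ltnS leq_addr.
rewrite -{1}(cat_take_drop (size u) m) mask_cat; last first.
  by rewrite size_takel // ltnW.
by rewrite (drop_nth false lt) mask_cons; case: nth.
Qed.

Lemma mask_negb_mid (L : Type) (m : bitseq) (u v : seq L) y :
  size m = (size u + (size v).+1)%N ->
  mask (map negb m) (u ++ y :: v) = mask (map negb (take (size u) m)) u ++
    (if nth false m (size u) then [::] else [:: y]) ++
    mask (map negb (drop (size u).+1 m)) v.
Proof.
move=> sm; have lt : (size u < size m)%N by rewrite sm addnS ltnS leq_addr.
rewrite mask_mid ?size_map // -map_take -map_drop (nth_map false) //.
by case: nth.
Qed.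

Lemma unshuff_kills (L : Type) (deg : L -> int) a b i (E : lmodType K)
    (F : seq L -> seq L -> E) (u v : seq L) (X : choiceType)
    (rel : {freeg X / K} -> Prop) (e : X -> L) :
  (forall (phi : X -> E) (h : int -> K), kills phi rel ->
     kills (fun x => h (deg (e x)) *: phi x) rel) ->
  (forall l r y, kills (fun x => F (l ++ e x :: r) y) rel) ->
  (forall y l r, kills (fun x => F y (l ++ e x :: r)) rel) ->
  kills (fun x => unshuff deg a b i F (u ++ e x :: v)) rel.
Proof.
move=> hdeg hl hr.
pose n := (size u + (size v).+1)%N.
apply: (@eq_kills _ _ _ _ (fun x => \sum_(m : n.-tuple bool
    | (count id m == i) && unshuff_cond a b m)
  koszul m (map deg u ++ deg (e x) :: map deg v) *:
    F (mask m (u ++ e x :: v)) (mask (map negb m) (u ++ e x :: v)))).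
  move=> x; rewrite /unshuff map_cat /=.
  have -> : size (u ++ e x :: v) = n by rewrite size_cat.
  by [].
apply: kills_sum => m _.
apply: (hdeg (fun x => F (mask m (u ++ e x :: v)) (mask (map negb m) (u ++ e x :: v)))
  (fun d => koszul m (map deg u ++ d :: map deg v))).
have sm : size m = n by rewrite size_tuple.
apply: (@eq_kills _ _ _ _ (fun x => F
   (mask (take (size u) m) u ++
    (if nth false m (size u) then [:: e x] else [::]) ++
    mask (drop (size u).+1 m) v)
   (mask (map negb (take (size u) m)) u ++
    (if nth false m (size u) then [::] else [:: e x]) ++
    mask (map negb (drop (size u).+1 m)) v))).
  by move=> x; rewrite mask_mid // mask_negb_mid.
by case: nth => /=; [apply: hl | apply: hr].
Qed.

Fixpoint bsum (E : lmodType K) n (G : bitseq -> E) : E :=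
  if n is n'.+1 then
    bsum n' (fun m => G (true :: m)) + bsum n' (fun m => G (false :: m))
  else G [::].

Lemma eq_bsum (E : lmodType K) n (G H : bitseq -> E) :
  (forall m, size m = n -> G m = H m) -> bsum n G = bsum n H.
Proof.
elim: n G H => [|n ih] G H e /=; first exact: e.
by congr (_ + _); apply: ih => m sm; apply: e; rewrite /= sm.
Qed.

Lemma bsumD (E : lmodType K) n (G H : bitseq -> E) :
  bsum n (fun m => G m + H m) = bsum n G + bsum n H.
Proof. by elim: n G H => [|n ih] G H //=; rewrite !ih addrACA. Qed.

Lemma bsumZ (E : lmodType K) n a (G : bitseq -> E) :
  bsum n (fun m => a *: G m) = a *: bsum n G.
Proof. by elim: n G => [|n ih] G //=; rewrite !ih scalerDr. Qed.

Lemma bsum_cat (E : lmodType K) n1 n2 (G : bitseq -> E) :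
  bsum (n1 + n2) G = bsum n1 (fun m1 => bsum n2 (fun m2 => G (m1 ++ m2))).
Proof. by elim: n1 G => [|n1 ih] G //=; rewrite !ih. Qed.

Lemma tuple_bsum (E : lmodType K) n (G : bitseq -> E) :
  \sum_(m : n.-tuple bool) G m = bsum n G.
Proof.
elim: n G => [|n ih] G /=.
  rewrite (bigD1 [tuple]) //= big1 ?addr0 // => m /negP[].
  by apply/eqP/val_inj; case: m => -[].
rewrite -!ih (reindex (fun p : bool * n.-tuple bool => [tuple of p.1 :: p.2])) /=.
  rewrite -(pair_big xpredT xpredT (fun (b : bool) (m : n.-tuple bool) => G (b :: m))) /=.
  by rewrite big_bool.
exists (fun m : n.+1.-tuple bool => (thead m, [tuple of behead m])) => [[b m] _|m _].
  by congr pair; apply: val_inj.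
by rewrite [RHS]tuple_eta.
Qed.

Lemma koszul_cat_ratio k m1 ds1 m ds m' ds' : size m1 = size ds1 ->
  \sum_(e <- mask m ds) e = \sum_(e <- mask m' ds') e ->
  koszul m ds = k * koszul m' ds' ->
  koszul (m1 ++ m) (ds1 ++ ds) = k * koszul (m1 ++ m') (ds1 ++ ds').
Proof.
move=> + hs hk; elim: m1 ds1 => [|b m1 ih] [|d ds1] //= [sz].
by rewrite ih // !mask_cat // !big_cat /= hs mulrCA.
Qed.

End Unshuffle.

Section Spaces.
Variables (K : fieldType) (g : gradedSpace K).

(* An entry (i, x) stands for x taken in degree i; it is 0 if x is not
   homogeneous of degree i. A letter x_1, ..., x_p stands for
   s(s x_1 ... s x_p) and a word for the tensor product of its letters; empty
   letters and the empty word, which do not exist in the reduced spaces, are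
   killed. *)
Definition entry := (int * g)%type.
Definition letter := seq entry.
Definition word := seq letter.

Definition sdeg (p : entry) : int := p.1 + 1.
Definition cdeg (c : letter) : int := \sum_(p <- c) sdeg p.
Definition ldeg (c : letter) : int := cdeg c + 1.
Definition wdeg (w : word) : int := \sum_(c <- w) ldeg c.

Inductive entry_rel : {freeg entry / K} -> Prop :=
| entry_nonhom i x : ~ ghom i x -> entry_rel << (i, x) >>
| entry_lin i a x y : ghom i x -> ghom i y ->
    entry_rel (<< (i, a *: x + y) >> - a *: << (i, x) >> - << (i, y) >>).

Inductive tg_rel : {freeg (seq entry) / K} -> Prop :=
| tg_nil : tg_rel << [::] >>
| tg_entry u r v : entry_rel r ->
    tg_rel (fglift (fun p => << u ++ p :: v >>) r).

Definition Tg := presented tg_rel.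
HB.instance Definition _ := GRing.Lmodule.on Tg.
Definition tgword (v : seq entry) : Tg := gen tg_rel v.

Inductive letter_rel : {freeg letter / K} -> Prop :=
| letter_nil : letter_rel << [::] >>
| letter_entry c r c' : entry_rel r ->
    letter_rel (fglift (fun p => << c ++ p :: c' >>) r)
| letter_swap c p q c' :
    letter_rel (<< c ++ p :: q :: c' >> -
                ksgn K (sdeg p * sdeg q) *: << c ++ q :: p :: c' >>).

Inductive bar_rel : {freeg word / K} -> Prop :=
| bar_nil : bar_rel << [::] >>
| bar_letter u r v : letter_rel r ->
    bar_rel (fglift (fun c => << u ++ c :: v >>) r).

Definition bar := presented bar_rel.
HB.instance Definition _ := GRing.Lmodule.on bar.
Definition barword (w : word) : bar := gen bar_rel w.

Definition valid_word (w : word) := [/\ w != [::], [::] \notin w &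
  forall c p, c \in w -> p \in c -> ghom p.1 p.2].

Definition bar_hom (n : int) (u : bar) := exists2 s : seq (K * word),
  (forall p, p \in s -> wdeg p.2 = n) & u = \sum_(p <- s) p.1 *: barword p.2.

Section Compatibility.
Variable E : lmodType K.

Lemma entry_deg_kills (phi : entry -> E) (h : int -> K) :
  kills phi entry_rel -> kills (fun p => h (sdeg p) *: phi p) entry_rel.
Proof.
move=> hp r hr; transitivity (fglift phi r); last exact: hp.
have := hp _ hr; case: hr => [i x hx|i a x y hx hy].
  by rewrite !fglift1 => ->; rewrite scaler0.
rewrite !fgliftB !fgliftZ !fglift1 /sdeg /= => e.
by rewrite scalerA mulrC -scalerA -!scalerBr e scaler0.
Qed.

Lemma cdeg_cat c c' : cdeg (c ++ c') = cdeg c + cdeg c'.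
Proof. exact: big_cat. Qed.

Lemma cdeg_cons p c : cdeg (p :: c) = sdeg p + cdeg c.
Proof. exact: big_cons. Qed.

Lemma wdeg_cat u v : wdeg (u ++ v) = wdeg u + wdeg v.
Proof. exact: big_cat. Qed.

Lemma wdeg_cons c u : wdeg (c :: u) = ldeg c + wdeg u.
Proof. exact: big_cons. Qed.

(* a map of letters is compatible with the relations iff its restrictions to
   each entry are, and it has the Koszul symmetry *)
Lemma letter_killsP (phi : letter -> E) :
  kills phi letter_rel <-> [/\ phi [::] = 0,
    forall c c', kills (fun p => phi (c ++ p :: c')) entry_rel &
    forall c p q c', phi (c ++ p :: q :: c') =
      ksgn K (sdeg p * sdeg q) *: phi (c ++ q :: p :: c')].
Proof.
split=> [h|[h0 h1 h2] _ [|c r c' hr|c p q c']].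
- split=> [|c c' r hr|c p q c'].
  + by have := h _ letter_nil; rewrite fglift1.
  + have := h _ (letter_entry c c' hr); rewrite fglift_comp => <-.
    by rewrite !fgliftE; apply: eq_bigr => x _; rewrite fglift1.
  have := h _ (letter_swap c p q c').
  by rewrite fgliftB fgliftZ !fglift1 => /eqP; rewrite subr_eq0 => /eqP.
- by rewrite fglift1.
- rewrite fglift_comp; apply: (@eq_kills _ _ _ _ _ _ _ (h1 c c')) => // x.
  by rewrite fglift1.
by rewrite fgliftB fgliftZ !fglift1 h2 subrr.
Qed.

Lemma bar_killsP (phi : word -> E) :
  kills phi bar_rel <-> phi [::] = 0 /\
    forall u v, kills (fun c => phi (u ++ c :: v)) letter_rel.
Proof.
split=> [h|[h0 h1] _ [|u r v hr]].
- split=> [|u v r hr]; first by have := h _ bar_nil; rewrite fglift1.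
  have := h _ (bar_letter u v hr); rewrite fglift_comp => <-.
  by rewrite !fgliftE; apply: eq_bigr => x _; rewrite fglift1.
- by rewrite fglift1.
rewrite fglift_comp; apply: (@eq_kills _ _ _ _ _ _ _ (h1 u v)) => // x.
by rewrite fglift1.
Qed.

Lemma letter_deg_kills (phi : letter -> E) (h : int -> K) :
  kills phi letter_rel -> kills (fun c => h (cdeg c) *: phi c) letter_rel.
Proof.
move=> /letter_killsP[h0 h1 h2]; apply/letter_killsP; split=> [|c c'|c p q c'].
- by rewrite h0 scaler0.
- apply: eq_kills (entry_deg_kills (fun d => h (cdeg c + (d + cdeg c'))) (h1 c c')).
  by move=> p; rewrite cdeg_cat cdeg_cons.
rewrite h2 scalerA mulrC -scalerA; congr (_ *: (h _ *: _)).
by rewrite !cdeg_cat !cdeg_cons; congr (_ + _); rewrite addrCA.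
Qed.

End Compatibility.

Lemma barword_kills : kills barword bar_rel.
Proof. exact: gen_kills. Qed.

Lemma barword_letter u v : kills (fun c => barword (u ++ c :: v)) letter_rel.
Proof. by have [_] := (bar_killsP barword).1 barword_kills. Qed.

Definition dz_word (w : word) : tensor bar bar :=
  \sum_(1 <= i < size w)
    unshuff ldeg None (Some (size w).-1) i
      (fun u v => tens (barword u) (barword v)) w.

(* the image of (s (x) s) Delta_c^0 s^-1 under F, on one letter *)
Definition split_letter (E : lmodType K) (F : letter -> letter -> E)
    (c : letter) : E :=
  \sum_(1 <= i < size c)
    unshuff sdeg None None i (fun a b => ksgn K (cdeg a) *: F a b) c.

(* The image under G of the term A of Delta_c. The word is turned into a word
   of blocks, which are made of one letter except the k-th one, which is made
   of the two letters of Delta_c(s c_k). *)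
Definition dc_termA (E : lmodType K) (G : word -> word -> E) (w : word) : E :=
  \sum_(k < (size w).-1) \sum_(1 <= i < size w)
    ksgn K (wdeg (take k w)) *:
    split_letter (fun a b =>
      unshuff wdeg (Some (k : nat)) (Some (size w).-1) i
        (fun U V => G (flatten U) (flatten V))
        (set_nth [::] [seq [:: c] | c <- w] k [:: a; b]))
      (nth [::] w k).

(* (u (x) v) and (a (x) b) are multiplied componentwise into
   (-1)^(|v| |a|) ua (x) vb. *)
Definition dc_termB (w : word) : tensor bar bar :=
  let w' := take (size w).-1 w in
  \sum_(0 <= i < size w)
    ksgn K (wdeg w') *:
    unshuff ldeg None None i (fun u v =>
      split_letter (fun a b =>
        ksgn K (wdeg v * ldeg a) *:
          tens (barword (rcons u a)) (barword (rcons v b)))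
        (last [::] w)) w'.

Definition dc_word (w : word) : tensor bar bar :=
  dc_termA (fun u v => tens (barword u) (barword v)) w
  - dc_termA (fun u v =>
      ksgn K (wdeg u * wdeg v) *: tens (barword v) (barword u)) w
  + dc_termB w.

Lemma tensl_letter l r (y : bar) :
  kills (fun c => tens (barword (l ++ c :: r)) y) letter_rel.
Proof. exact: (kills_linear (tensr y) (barword_letter l r)). Qed.

Lemma tensr_letter (x : bar) l r :
  kills (fun c => tens x (barword (l ++ c :: r))) letter_rel.
Proof. exact: (kills_linear (tens x) (barword_letter l r)). Qed.

Lemma ldeg_kills (E : lmodType K) (phi : letter -> E) (f : letter -> int)
    (h : int -> K) : (forall c c', cdeg c = cdeg c' -> f c = f c') ->
  kills phi letter_rel -> kills (fun c => h (f c) *: phi c) letter_rel.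
Proof.
move=> hf hp.
apply: eq_kills (letter_deg_kills (fun d => h (f [:: (d - 1, 0)])) hp) => c.
by rewrite (hf [:: (cdeg c - 1, 0)] c) // /cdeg big_seq1 /sdeg /= subrK.
Qed.

Lemma dz_word_kills : kills dz_word bar_rel.
Proof.
apply/bar_killsP; split=> [|u v]; first by rewrite /dz_word big_geq.
pose n := (size u + (size v).+1)%N.
apply: (@eq_kills _ _ _ _ (fun c => \sum_(1 <= i < n)
    unshuff ldeg None (Some n.-1) i
      (fun u v => tens (barword u) (barword v)) (u ++ c :: v))).
  by move=> c; rewrite /dz_word size_cat.
apply: kills_sum => i _; apply: unshuff_kills => [phi h hp|l r y|y l r].
- by apply: ldeg_kills => // c c' e; rewrite /ldeg e.
- exact: tensl_letter.
- exact: tensr_letter.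
Qed.

Definition Delta_z : {linear bar -> tensor bar bar} := plift dz_word_kills.

Lemma unshuff_bsum (E : lmodType K) (L : Type) (deg : L -> int) i
    (F : seq L -> seq L -> E) w :
  unshuff deg None None i F w = bsum (size w) (fun m =>
    if count id m == i then
      koszul K m (map deg w) *: F (mask m w) (mask (map negb m) w)
    else 0).
Proof.
rewrite -tuple_bsum /unshuff big_mkcond; apply: eq_bigr => m _.
by rewrite andbT.
Qed.

Lemma ksgnD m n : ksgn K (m + n) = ksgn K m * ksgn K n.
Proof. by rewrite /ksgn expfzDr // oppr_eq0 oner_neq0. Qed.

Lemma ksgnK n : ksgn K n * ksgn K n = 1.
Proof. by rewrite /ksgn -expfzMl mulrNN mulr1 exp1rz. Qed.

Lemma unshuff_swap (E : lmodType K) i (F : letter -> letter -> E) c p q c' :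
  (forall b, kills (F^~ b) letter_rel) -> (forall a, kills (F a) letter_rel) ->
  unshuff sdeg None None i F (c ++ p :: q :: c') =
  ksgn K (sdeg p * sdeg q) *: unshuff sdeg None None i F (c ++ q :: p :: c').
Proof.
move=> hl hr; rewrite !unshuff_bsum !size_cat !bsum_cat -bsumZ.
apply: eq_bsum => m1 sm1 /=; rewrite !scalerDr -!bsumZ.
set s := ksgn K _.
pose T (x y : entry) (b b' : bool) m2 :=
  if count id (m1 ++ b :: b' :: m2) == i then
    koszul K (m1 ++ b :: b' :: m2) (map sdeg (c ++ x :: y :: c')) *:
    F (mask (m1 ++ b :: b' :: m2) (c ++ x :: y :: c'))
      (mask (map negb (m1 ++ b :: b' :: m2)) (c ++ x :: y :: c'))
  else 0.
have TE (b b' : bool) m2 : T p q b b' m2 = s *: T q p b' b m2.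
  rewrite /T !count_cat /= (addnCA b b'); case: eqP => _; last by rewrite scaler0.
  rewrite !map_cat /= !mask_cat ?size_map //= scalerA.
  have [hlz hle hls] := (letter_killsP _).1 (hl (mask (map negb m1) c ++ mask (map negb m2) c')).
  have [hrz hre hrs] := (letter_killsP _).1 (hr (mask m1 c ++ mask m2 c')).
  case: b b' => -[] /=.
  - have -> : koszul K (m1 ++ true :: true :: m2) (map sdeg c ++ sdeg p :: sdeg q :: map sdeg c')
      = 1 * koszul K (m1 ++ true :: true :: m2) (map sdeg c ++ sdeg q :: sdeg p :: map sdeg c').
      apply: koszul_cat_ratio; rewrite ?size_map //=; last by rewrite !mul1r.
      by rewrite !big_cons addrCA.
    by rewrite hls mul1r scalerA mulrC.
  - have -> : koszul K (m1 ++ true :: false :: m2) (map sdeg c ++ sdeg p :: sdeg q :: map sdeg c')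
      = s * koszul K (m1 ++ false :: true :: m2) (map sdeg c ++ sdeg q :: sdeg p :: map sdeg c').
      apply: koszul_cat_ratio; rewrite ?size_map //=.
      rewrite big_cons !mul1r mulrDr ksgnD [sdeg q * sdeg p]mulrC !mulrA.
      by rewrite ksgnK mul1r.
    by [].
  - have -> : koszul K (m1 ++ false :: true :: m2) (map sdeg c ++ sdeg p :: sdeg q :: map sdeg c')
      = s * koszul K (m1 ++ true :: false :: m2) (map sdeg c ++ sdeg q :: sdeg p :: map sdeg c').
      apply: koszul_cat_ratio; rewrite ?size_map //=.
      by rewrite big_cons !mul1r mulrDr ksgnD mulrA.
    by [].
  have -> : koszul K (m1 ++ false :: false :: m2) (map sdeg c ++ sdeg p :: sdeg q :: map sdeg c')
    = 1 * koszul K (m1 ++ false :: false :: m2) (map sdeg c ++ sdeg q :: sdeg p :: map sdeg c').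
    apply: koszul_cat_ratio; rewrite ?size_map //=.
    by rewrite mul1r mulrCA.
  by rewrite hrs mul1r scalerA mulrC.
have ET (x y : entry) b b' :
  bsum (size c') (fun m2 => T x y b b' m2) =
  bsum (size c') (T x y b b') by [].
transitivity (bsum (size c') (T p q true true) + bsum (size c') (T p q true false)
  + (bsum (size c') (T p q false true) + bsum (size c') (T p q false false))).
  by [].
rewrite !(eq_bsum (fun m2 _ => TE _ _ m2)) -addrA [X in _ + X]addrCA addrA.
by rewrite -!addrA.
Qed.

Lemma split_letter_kills (E : lmodType K) (F : letter -> letter -> E) :
  (forall b, kills (F^~ b) letter_rel) -> (forall a, kills (F a) letter_rel) ->
  kills (split_letter F) letter_rel.
Proof.
move=> hl hr; pose F' a b := ksgn K (cdeg a) *: F a b.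
have hl' b : kills (F'^~ b) letter_rel by exact: letter_deg_kills.
have hr' a : kills (F' a) letter_rel by exact: kills_scale.
apply/letter_killsP; split=> [|c c'|c p q c'].
- by rewrite /split_letter big_geq.
- apply: (@eq_kills _ _ _ _ (fun p =>
    \sum_(1 <= i < size c + (size c').+1)
      unshuff sdeg None None i F' (c ++ p :: c'))).
    by move=> p; rewrite /split_letter size_cat.
  apply: kills_sum => i _; apply: unshuff_kills => [phi h hp|l r b|a l r].
  + exact: entry_deg_kills.
  + by have [_] := (letter_killsP _).1 (hl' b).
  + by have [_] := (letter_killsP _).1 (hr' a).
rewrite /split_letter !size_cat /= scaler_sumr; apply: eq_bigr => i _.
exact: unshuff_swap.
Qed.

Lemma eq_split_letter (E : lmodType K) (F G : letter -> letter -> E) c :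
  (forall a b, F a b = G a b) -> split_letter F c = split_letter G c.
Proof.
move=> e; apply: eq_bigr => i _; apply: eq_bigr => m _.
by rewrite e.
Qed.

Lemma split_letter_kills_cst (E : lmodType K) (X : choiceType)
    (rel : {freeg X / K} -> Prop) (F : X -> letter -> letter -> E) c :
  (forall a b, kills (fun x => F x a b) rel) ->
  kills (fun x => split_letter (F x) c) rel.
Proof.
move=> h; apply: kills_sum => i _; apply: kills_sum => m _.
by do 2!apply: kills_scale; exact: h.
Qed.

Lemma dc_termA_kills (E : lmodType K) (G : word -> word -> E) :
  (forall l r y, kills (fun c => G (l ++ c :: r) y) letter_rel) ->
  (forall y l r, kills (fun c => G y (l ++ c :: r)) letter_rel) ->
  kills (dc_termA G) bar_rel.
Proof.
move=> hl hr; apply/bar_killsP; split=> [|u v].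
  by rewrite /dc_termA big_ord0.
pose G' (U V : seq word) := G (flatten U) (flatten V).
have blk A B i x y U V : kills (fun c =>
    unshuff wdeg A B i G' (U ++ (x ++ c :: y) :: V)) letter_rel.
  apply: (@unshuff_kills K word wdeg A B i E G' U V _ letter_rel
    (fun c => x ++ c :: y)) => [phi h hp|l r z|z l r].
  - by apply: ldeg_kills => // c c' e; rewrite !wdeg_cat !wdeg_cons /ldeg e.
  - apply: eq_kills (hl (flatten l ++ x) (y ++ flatten r) (flatten z)) => c.
    by rewrite /G' flatten_cat /= -!catA.
  apply: eq_kills (hr (flatten z) (flatten l ++ x) (y ++ flatten r)) => c.
  by rewrite /G' flatten_cat /= -!catA.
pose n := (size u + (size v).+1)%N.
apply: (@eq_kills _ _ _ _ (fun c => \sum_(k < n.-1) \sum_(1 <= i < n)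
    ksgn K (wdeg (take k (u ++ c :: v))) *:
    split_letter (fun a b => unshuff wdeg (Some (k : nat)) (Some n.-1) i G'
      (set_nth [::] [seq [:: d] | d <- u ++ c :: v] k [:: a; b]))
      (nth [::] (u ++ c :: v) k))).
  by move=> c; rewrite /dc_termA size_cat.
apply: kills_sum => k _; apply: kills_sum => i _.
pose S (s : seq letter) := [seq [:: d] | d <- s].
have set_cat U V j x : set_nth [::] (U ++ V) j x =
    if (j < size U)%N then set_nth [::] U j x ++ V
    else U ++ set_nth [::] V (j - size U) x :> seq word.
  elim: U j => [|y U ih] j /=; first by rewrite subn0.
  by case: j => [|j] //=; rewrite ih ltnS subSS; case: ifP.
case: (ltngtP k (size u)) => hk.
- apply: (@eq_kills _ _ _ _ (fun c => ksgn K (wdeg (take k u)) *: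
    split_letter (fun a b => unshuff wdeg (Some (k : nat)) (Some n.-1) i G'
      (set_nth [::] (S u) k [:: a; b] ++ [:: c] :: S v)) (nth [::] u k))).
    move=> c; rewrite take_cat nth_cat hk map_cat /=.
    by congr (_ *: _); apply: eq_split_letter => a b; rewrite set_cat size_map hk.
  apply: kills_scale; apply: split_letter_kills_cst => a b.
  exact: (blk _ _ _ [::] [::]).
- apply: (@eq_kills _ _ _ _ (fun c => ksgn K (wdeg (take k (u ++ c :: v))) *:
    split_letter (fun a b => unshuff wdeg (Some (k : nat)) (Some n.-1) i G'
      (S u ++ [:: c] :: set_nth [::] (S v) (k - size u).-1 [:: a; b]))
      (nth [::] v (k - size u).-1))).
    move=> c; rewrite nth_cat ltnNge ltnW //= map_cat /=.
    rewrite -[(k - size u)%N]prednK ?subn_gt0 //=.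
    congr (_ *: _); apply: eq_split_letter => a b.
    rewrite set_cat size_map ltnNge ltnW //=.
    by rewrite -[(k - size u)%N]prednK ?subn_gt0 //=.
  pose f c := wdeg (take k (u ++ c :: v)).
  apply: (ldeg_kills (f := f)) => [c c' e|].
    rewrite /f !take_cat ltnNge ltnW //= -[(k - size u)%N]prednK ?subn_gt0 //=.
    by rewrite !wdeg_cat !wdeg_cons /ldeg e.
  apply: split_letter_kills_cst => a b.
  exact: (blk _ _ _ [::] [::]).
apply: (@eq_kills _ _ _ _ (fun c => ksgn K (wdeg u) *:
  split_letter (fun a b => unshuff wdeg (Some (k : nat)) (Some n.-1) i G'
    (S u ++ [:: a; b] :: S v)) c)).
  move=> c; rewrite take_cat nth_cat hk ltnn subnn take0 cats0 map_cat /=.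
  congr (_ *: _); apply: eq_split_letter => a b.
  by rewrite set_cat size_map ltnn subnn.
apply: kills_scale; apply: split_letter_kills => [b|a].
  exact: (blk _ _ _ [::] [:: b]).
exact: (blk _ _ _ [:: a] [::]).
Qed.

Lemma dc_termB_kills : kills dc_termB bar_rel.
Proof.
apply/bar_killsP; split=> [|u v]; first by rewrite /dc_termB big_geq.
pose F c u v := split_letter (fun a b => ksgn K (wdeg v * ldeg a) *:
  tens (barword (rcons u a)) (barword (rcons v b))) c.
elim/last_ind: v => [|v l _].
  apply: (@eq_kills _ _ _ _ (fun c => \sum_(0 <= i < (size u).+1)
      ksgn K (wdeg u) *: unshuff ldeg None None i (F c) u)).
    move=> c; rewrite /dc_termB last_cat /= size_cat addn1 /= take_size_cat //.
  apply: kills_sum => i _; apply: kills_scale; apply: kills_sum => m _.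
  apply: kills_scale; apply: split_letter_kills => [b|a].
    apply: (ldeg_kills (f := fun a => wdeg _ * ldeg a)).
      by move=> c c' e; rewrite /ldeg e.
    apply: eq_kills (tensl_letter (mask m u) [::] _) => c.
    by rewrite cats1.
  apply: kills_scale; apply: eq_kills (tensr_letter _ (mask (map negb m) u) [::]) => c.
  by rewrite cats1.
pose n := (size u + (size v).+1)%N.
apply: (@eq_kills _ _ _ _ (fun c => \sum_(0 <= i < n.+1)
    ksgn K (wdeg (u ++ c :: v)) *: unshuff ldeg None None i (F l) (u ++ c :: v))).
  move=> c; rewrite /dc_termB -rcons_cons -rcons_cat size_rcons size_cat /=.
  by rewrite last_rcons -cats1 take_size_cat // size_cat.
apply: kills_sum => i _.
apply: (ldeg_kills (f := fun c => wdeg (u ++ c :: v))) => [c c' e|].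
  by rewrite !wdeg_cat !wdeg_cons /ldeg e.
apply: unshuff_kills => [phi h hp|x y z|z x y].
- by apply: ldeg_kills => // c c' e; rewrite /ldeg e.
- apply: split_letter_kills_cst => a b; apply: kills_scale.
  apply: eq_kills (tensl_letter x (rcons y a) _) => c.
  by rewrite rcons_cat.
apply: split_letter_kills_cst => a b.
apply: (ldeg_kills (f := fun c => wdeg (x ++ c :: y) * ldeg a)) => [c c' e|].
  by rewrite !wdeg_cat !wdeg_cons /ldeg e.
apply: eq_kills (tensr_letter _ x (rcons y b)) => c.
by rewrite rcons_cat.
Qed.

Lemma dc_word_kills : kills dc_word bar_rel.
Proof.
move=> r hr.
have hA : kills (dc_termA (fun u v => tens (barword u) (barword v))) bar_rel.
  by apply: dc_termA_kills => [l r' y|y l r'];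
    [apply: tensl_letter | apply: tensr_letter].
have hA' : kills (dc_termA (fun u v =>
    ksgn K (wdeg u * wdeg v) *: tens (barword v) (barword u))) bar_rel.
  apply: dc_termA_kills => [l r' y|y l r'].
    apply: (ldeg_kills (f := fun c => wdeg (l ++ c :: r') * wdeg y)) => [c c' e|].
      by rewrite !wdeg_cat !wdeg_cons /ldeg e.
    exact: tensr_letter.
  apply: (ldeg_kills (f := fun c => wdeg y * wdeg (l ++ c :: r'))) => [c c' e|].
    by rewrite !wdeg_cat !wdeg_cons /ldeg e.
  exact: tensl_letter.
have -> : fglift dc_word r =
    fglift (dc_termA (fun u v => tens (barword u) (barword v))) r
    - fglift (dc_termA (fun u v =>
        ksgn K (wdeg u * wdeg v) *: tens (barword v) (barword u))) r
    + fglift dc_termB r.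
  rewrite !fgliftE -sumrB -big_split /=; apply: eq_bigr => w _.
  by rewrite -scalerBr -scalerDr.
by rewrite hA // hA' // dc_termB_kills // subrr addr0.
Qed.

Definition Delta_c : {linear bar -> tensor bar bar} := plift dc_word_kills.

(* the operator x |-> (-1)^(p |x|) x *)
Definition koszul_word (p : int) (w : word) : bar :=
  ksgn K (p * wdeg w) *: barword w.

Lemma koszul_word_kills p : kills (koszul_word p) bar_rel.
Proof.
apply/bar_killsP; split=> [|u v].
  have [e _] := (bar_killsP _).1 barword_kills.
  by rewrite /koszul_word e scaler0.
apply: (ldeg_kills (f := fun c => p * wdeg (u ++ c :: v))) => [c c' e|].
  by rewrite !wdeg_cat !wdeg_cons /ldeg e.
exact: barword_letter.
Qed.

Definition koszul_op (p : int) : {linear bar -> bar} :=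
  plift (koszul_word_kills p).

(* the projection onto ss g, whose underlying vector space is g *)
Definition corestr_word (w : word) : g :=
  if w is [:: [:: p]] then (if `[< ghom p.1 p.2 >] then p.2 else 0) else 0.

Lemma corestr_word_kills : kills corestr_word bar_rel.
Proof.
apply/bar_killsP; split=> // u v.
have z0 (phi : letter -> g) : phi =1 (fun _ => 0) -> kills phi letter_rel.
  by move=> e; apply: eq_kills (@kills_cst0 _ _ g letter_rel) => c; rewrite e.
case: u => [|c0 [|c1 u]]; last 2 first.
- by apply: z0 => c; case: c0 => [|? []].
- by apply: z0 => c; case: c0 => [|? []].
case: v => [|c1 v] /=; last by apply: z0 => -[|? []].
apply/letter_killsP; split=> // [c c'|[|p0 [|p1 c]] p q c'] /=.
- case: c => [|p0 [|p1 c]].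
  + case: c' => [|p1 c'] /=; last first.
      by apply: eq_kills (@kills_cst0 _ _ g entry_rel).
    move=> _ [i x hx|i a x y hx hy]; rewrite ?fgliftB ?fgliftZ !fglift1 /=.
      by case: asboolP.
    rewrite !asboolT //; last exact: ghomP.
    by rewrite -addrA -opprD subrr.
  + by apply: eq_kills (@kills_cst0 _ _ g entry_rel).
  by apply: eq_kills (@kills_cst0 _ _ g entry_rel).
- by rewrite scaler0.
- by rewrite scaler0.
by rewrite scaler0.
Qed.

Definition corestr : {linear bar -> g} := plift corestr_word_kills.

(* f (x) 1 + 1 (x) f for f of degree p *)
Definition tens_coder (p : int) (f : {linear bar -> bar})
    (t : tensor bar bar) : tensor bar bar :=
  tens_map f idfun t + tens_map (koszul_op p) f t.

Definition coderivation (p : int) (f : {linear bar -> bar}) := [/\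
  (forall w, bar_hom (wdeg w + p) (f (barword w))),
  (forall x, tens_coder p f (Delta_z x) = Delta_z (f x)) &
  (forall x, ksgn K p *: tens_coder p f (Delta_c x) = Delta_c (f x))].

Definition has_corestriction (phi : word -> g) (f : {linear bar -> bar}) :=
  forall w, valid_word w -> corestr (f (barword w)) = phi w.

(* phi gives the values on words of a linear map from the bar space to ss g *)
Definition induced_coderivation (p : int) (phi : word -> g)
    (f : {linear bar -> bar}) := [/\
  coderivation p f, has_corestriction phi f &
  forall f', coderivation p f' -> has_corestriction phi f' -> f' =1 f].

Definition codifferential (f : {linear bar -> bar}) :=
  coderivation (-1) f /\ forall x, f (f x) = 0.

(* on s(sx sy): s^-1 (x) s^-1 passes sx, whence the sign (-1)^|sx| *)
Definition lie_corestr (br : g -> g -> g) (w : word) : g :=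
  if w is [:: [:: p; q]] then ksgn K (p.1 + 1) *: br p.2 q.2 else 0.

(* ssx_1 (x) ... (x) ssx_n |-> ss D_n(x_1, ..., x_n). The double desuspension
   is even, so that its n-th tensor power carries no sign. Splitting it into two
   odd tensor powers with a Koszul sign for each of them would give the extra
   factor (-1)^(n(n-1)/2), and the resulting square zero condition would not be
   the one of odd_sh_leibniz. *)
Definition leib_corestr (D : nat -> seq g -> g) (n : nat) (w : word) : g :=
  if (size w == n) && all (fun c => size c == 1) w
  then D n [seq p.2 | p <- flatten w] else 0.

(* An n-ary operation is a function on sequences, of which only the values on
   sequences of length n are relevant. *)
Definition multilinear_op (n : nat) (D : seq g -> g) :=
  forall (s t : seq g) a x y, (size s + (size t).+1)%N = n ->
    D (s ++ (a *: x + y) :: t) = a *: D (s ++ x :: t) + D (s ++ y :: t).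

Definition degree_op (n : nat) (p : int) (D : seq g -> g) :=
  forall v : seq entry, size v = n -> (forall q, q \in v -> ghom q.1 q.2) ->
    ghom (\sum_(q <- v) q.1 + p) (D [seq q.2 | q <- v]).

Definition shdeg (n : nat) : int := 2 * n%:Z - 3.

Definition apply_entry (D : nat -> seq g -> g) (v : seq entry) : entry :=
  (\sum_(q <- v) q.1 + shdeg (size v), D (size v) [seq q.2 | q <- v]).

Definition tg_extension (D : nat -> seq g -> g) (n : nat) (v : seq entry) : Tg :=
  \sum_(n <= k < (size v).+1)
    unshuff fst None None (k - n) (fun a b =>
      ksgn K (shdeg n * \sum_(q <- a) q.1) *:
      tgword (a ++ apply_entry D (rcons b (nth (0, 0) v k.-1)) :: drop k v))
      (take k.-1 v).

(* F is the sum of the f n for n >= 1, finite on each vector *)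
Definition is_locally_finite_sum (E : lmodType K) (f : nat -> E -> E) (F : E -> E) :=
  forall x, exists N0, forall N, (N0 <= N)%N ->
    \sum_(1 <= n < N) f n x = F x.

Definition odd_sh_leibniz (D : nat -> seq g -> g) :=
  (forall n, (0 < n)%N -> multilinear_op n (D n) /\ degree_op n (shdeg n) (D n))
  /\ exists (f : nat -> {linear Tg -> Tg}) (F : {linear Tg -> Tg}), [/\
    forall n v, (0 < n)%N -> (forall q, q \in v -> ghom q.1 q.2) ->
      f n (tgword v) = tg_extension D n v,
    is_locally_finite_sum f F &
    forall x, F (F x) = 0].

Definition invariant_sh_leibniz (br : g -> g -> g) (D : nat -> seq g -> g) := [/\
  lie_bracket br, odd_sh_leibniz D &
  exists (f_lie : {linear bar -> bar}) (f : nat -> {linear bar -> bar})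
      (f_leib : {linear bar -> bar}), [/\
    induced_coderivation (-1) (lie_corestr br) f_lie,
    forall n, (0 < n)%N -> induced_coderivation (-1) (leib_corestr D n) (f n),
    is_locally_finite_sum f f_leib &
    codifferential (f_lie \+ f_leib)]].

Definition derived_bracket (br : g -> g -> g) (d : nat -> g -> g) (n : nat)
    (s : seq g) : g :=
  if s is x :: t then foldl br (d n.-1 x) t else 0.

End Spaces.

(* Main.v *)
(* A coderivation f of the bar coalgebra is determined by its corestriction: if
   the corestriction is zero, then by induction on the weight of a word, f takes
   it to an element killed by both coproducts. Such an element is a sum of
   letters, and of letters of size one in characteristic zero, since splitting a
   letter of size n and multiplying again is the factor 2^n - 2. Conversely, a
   map phi extends to the coderivation which sends u c, with last letter c, to
     f(u) c + sum (-1)^(|f| |u'|) u' (phi(u'', c') c'' + (-1)^|u''| phi(q u'') c),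
   the sums being over the unshuffles (u', u'') of u and (c', c'') of c, and q
   the cobar derivation, which splits one letter of a word into two.

   The square of an odd coderivation is a coderivation, so the codifferential
   squares to zero as soon as the corestriction of its square vanishes. That
   corestriction has three parts. The square of the Lie part lives on one letter
   of size three and vanishes by the Jacobi identity. The mixed part lives on
   words with one letter of size two and vanishes since derived brackets are
   iterated brackets and each map z |-> D_n(x_1, ..., x_(n-1), z) is a derivation.
   The square of the Leibniz part lives on words of letters of size one. The
   partial sum of the terms in which the inner operation ends at most at the k-th
   letter has a closed form, by induction on k and the derivation property: for
   k = 1 it is the relation sum_(i + j = n) d_i d_j = 0, and it is an empty sum
   when k is the length of the word.

   The sh Leibniz operations on the tensor coalgebra are those of the bar
   coalgebra on the words of letters of size one. *)

From HB Require Import structures.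
From mathcomp Require Import all_boot all_order all_algebra.
From mathcomp Require Import boolp freeg zify ring.
Require Import Defs.

Set Implicit Arguments.
Unset Strict Implicit.
Unset Printing Implicit Defensive.

Import Order.TTheory GRing.Theory Num.Theory.
Local Open Scope ring_scope.

(** * Signs and unshuffles *)

Section Parity.

(** The identities are proved on formal signed sums of words, before the relations of [bar] are
    imposed, so that only exponents of -1 have to be compared. Splittings with an empty piece are
    kept there, which frees the formulas from boundary cases. The price is that an empty letter is
    zero in [bar] while the formula for f need not vanish on it.

    The supports of the three parts come from counting the excess, the number of entries of a word
    minus the number of its letters. A Lie operation lowers the excess by one and a Leibniz
    operation keeps it, while the Lie corestriction sees only excess one and the Leibniz
    corestriction only excess zero. So the three composites need excess two, one and zero.

    The infinitely many operations D_n are bundled into one corestriction, whose arity is the number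
    of letters. Uniqueness is proved with a bound on the weight, so that a finite partial sum of the
    induced coderivations can be compared with the bundled one on words of small weight. *)

Definition pz (n : int) : bool := odd `|n|%N.

Lemma pzN n : pz (- n) = pz n.
Proof. by rewrite /pz abszN. Qed.

Lemma pzM m n : pz (m * n) = pz m && pz n.
Proof. by rewrite /pz abszM oddM. Qed.

Lemma pzD m n : pz (m + n) = pz m (+) pz n.
Proof.
wlog hm : m n / 0 <= m => [h|].
  have [/h//|/ltW m0] := ger0P m.
  by rewrite -[LHS]pzN opprD h ?pzN // oppr_ge0.
case: m hm => // m _; case: n => n; first by rewrite /pz -PoszD /= oddD.
rewrite NegzE /pz abszN /=; have [le|lt] := leqP n.+1 m.
  by rewrite subzn // absz_nat oddB.
rewrite -opprB abszN subzn 1?ltnW // absz_nat oddB 1?ltnW //.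
by rewrite addbC.
Qed.

Variable K : fieldType.

Lemma ksgnE n : ksgn K n = (-1) ^+ pz n.
Proof.
rewrite /ksgn /pz signr_odd; case: n => n //.
by rewrite /exprz -exprVn invrN invr1.
Qed.

Lemma ksgn_eq m n : pz m = pz n -> ksgn K m = ksgn K n.
Proof. by rewrite !ksgnE => ->. Qed.

Lemma ksgn0 : ksgn K 0 = 1. Proof. by []. Qed.

Lemma ksgn1 : ksgn K 1 = -1. Proof. by []. Qed.

Lemma oppr_ksgn (E : lmodType K) (x : E) : - x = ksgn K 1 *: x.
Proof. by rewrite ksgn1 scaleN1r. Qed.

Lemma scale_ksgnN (E : lmodType K) n (x : E) : - (ksgn K n *: x) = ksgn K (n + 1) *: x.
Proof. by rewrite ksgnD ksgn1 mulrN1 scaleNr. Qed.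

Lemma scale_ksgnD (E : lmodType K) m n (x : E) :
  ksgn K m *: (ksgn K n *: x) = ksgn K (m + n) *: x.
Proof. by rewrite scalerA ksgnD. Qed.

End Parity.

(** A sign depends only on the parity of its exponent, and [pz] is a ring morphism to the field with
    two elements. An equality of signs thus becomes a Boolean identity in the parities of the
    degrees, decided by cases. *)
Ltac parity :=
  rewrite ?(pzD, pzM, pzN) /=;
  repeat match goal with |- context [pz ?x] =>
    let v := eval compute in (pz x) in
    match v with true => change (pz x) with true | false => change (pz x) with false end
  end;
  repeat match goal with |- context [pz ?x] => case: (pz x) end; done.

Ltac ksgn_congr := rewrite ?scale_ksgnD; congr (_ *: _); apply: ksgn_eq; parity.

(** * Formal signed sums *)

Section SignedSums.
Variable K : fieldType.
Implicit Type E : lmodType K.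

(* A list of pairs (n, x) stands for the formal sum of the (-1)^n x, and coalgebra
   identities are stated as equalities of sums over an arbitrary function F. *)
Definition ev X E (s : seq (int * X)) (F : X -> E) : E :=
  \sum_(t <- s) ksgn K t.1 *: F t.2.

(** Exponents stay integers, so that degrees can be inserted as they are; only [ksgn] reduces them
    modulo 2. [twist] and [bind] are the map and the substitution of the monad of signed sums. *)
Definition twist X Y (h : X -> int) (k : X -> Y) (s : seq (int * X)) :=
  [seq (t.1 + h t.2, k t.2) | t <- s].

Definition bind X Y (s : seq (int * X)) (k : X -> seq (int * Y)) :=
  flatten [seq [seq (t.1 + t'.1, t'.2) | t' <- k t.2] | t <- s].

Lemma ev_nil X E (F : X -> E) : ev [::] F = 0.
Proof. exact: big_nil. Qed.

Lemma ev_cat X E s s' (F : X -> E) : ev (s ++ s') F = ev s F + ev s' F.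
Proof. exact: big_cat. Qed.

Lemma ev_ret X E (x : X) (F : X -> E) : ev [:: (0, x)] F = F x.
Proof. by rewrite /ev big_seq1 scale1r. Qed.

Lemma ev_twist X Y E h (k : X -> Y) s (F : Y -> E) :
  ev (twist h k s) F = ev s (fun x => ksgn K (h x) *: F (k x)).
Proof. by rewrite /ev big_map; apply: eq_bigr => t _; rewrite scale_ksgnD. Qed.

Lemma ev_bind X Y E s (k : X -> seq (int * Y)) (F : Y -> E) :
  ev (bind s k) F = ev s (fun x => ev (k x) F).
Proof.
rewrite /ev big_flatten big_map; apply: eq_bigr => t _.
by rewrite big_map scaler_sumr; apply: eq_bigr => t' _; rewrite scale_ksgnD.
Qed.

Lemma evD X E s (F G : X -> E) : ev s (fun x => F x + G x) = ev s F + ev s G.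
Proof. by rewrite /ev -big_split; apply: eq_bigr => t _; rewrite scalerDr. Qed.

Lemma evZ X E s a (F : X -> E) : ev s (fun x => a *: F x) = a *: ev s F.
Proof.
by rewrite /ev scaler_sumr; apply: eq_bigr => t _; rewrite !scalerA mulrC.
Qed.

Lemma evN X E s (F : X -> E) : ev s (fun x => - F x) = - ev s F.
Proof. by rewrite /ev -sumrN; apply: eq_bigr => t _; rewrite scalerN. Qed.

Lemma ev_const0 X E s : ev s (fun _ : X => 0 : E) = 0.
Proof. by apply: big1 => t _; rewrite scaler0. Qed.

Lemma ev_sum X E (I : Type) (r : seq I) (P : pred I) s (F : I -> X -> E) :
  ev s (fun x => \sum_(i <- r | P i) F i x) = \sum_(i <- r | P i) ev s (F i).
Proof. by rewrite /ev exchange_big; apply: eq_bigr => t _; rewrite scaler_sumr. Qed.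

Lemma ev_swap X Y E (s : seq (int * X)) (s' : seq (int * Y)) (F : X -> Y -> E) :
  ev s (fun x => ev s' (F x)) = ev s' (fun y => ev s (F^~ y)).
Proof.
rewrite {1}/ev; under eq_bigr do rewrite -evZ.
by rewrite -ev_sum.
Qed.

Lemma ev_linear X E E' (T : {linear E -> E'}) s (F : X -> E) :
  T (ev s F) = ev s (fun x => T (F x)).
Proof. by rewrite /ev linear_sum; apply: eq_bigr => t _; rewrite linearZ. Qed.

Lemma ev_lin X E E' (T : E -> E') s (F : X -> E) : linear T ->
  T (ev s F) = ev s (fun x => T (F x)).
Proof.
move=> h; have T0 : T 0 = 0 by have := h (-1) 0 0; rewrite scaleN1r addNr scaleN1r addNr.
rewrite /ev; elim: s => [|t s ih]; first by rewrite !big_nil.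
by rewrite !big_cons h ih.
Qed.

Lemma eq_ev X E s (F G : X -> E) : F =1 G -> ev s F = ev s G.
Proof. by move=> e; apply: eq_bigr => t _; rewrite e. Qed.

Definition supp (X : eqType) (s : seq (int * X)) : seq X := [seq t.2 | t <- s].

(** Relations between the degrees of a word and of its pieces hold only for pieces that occur, so
    rewriting under the sum needs membership in the support. *)
Lemma eq_ev_in (X : eqType) E s (F G : X -> E) :
  {in supp s, F =1 G} -> ev s F = ev s G.
Proof.
move=> e; apply: eq_big_seq => t ts; rewrite e //.
exact: map_f.
Qed.

Lemma ev_in0 (X : eqType) E s (F : X -> E) : {in supp s, F =1 fun=> 0} -> ev s F = 0.
Proof. by move=> h; rewrite (eq_ev_in h) ev_const0. Qed.

Lemma supp_cat (X : eqType) (s s' : seq (int * X)) : supp (s ++ s') = supp s ++ supp s'.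
Proof. exact: map_cat. Qed.

Lemma supp_twist (X Y : eqType) h (k : X -> Y) s : supp (twist h k s) = map k (supp s).
Proof. by rewrite /supp -!map_comp. Qed.

Lemma supp_bind (X Y : eqType) s (k : X -> seq (int * Y)) :
  supp (bind s k) = flatten [seq supp (k x) | x <- supp s].
Proof.
rewrite /supp map_flatten -!map_comp; congr flatten; apply: eq_map => t /=.
by rewrite -map_comp.
Qed.

End SignedSums.
Arguments eq_ev_in {K X E s F}.

Notation "\S_ ( x <- s ) F" := (ev s (fun x => F))
  (at level 41, F at level 41, x at level 50,
   format "'[' \S_ ( x  <-  s ) '/  '  F ']'") : ring_scope.

(** * The unshuffle coproduct *)

Section Unshuffles.
Variables (L : eqType) (deg : L -> int).

Definition tdeg (w : seq L) : int := \sum_(c <- w) deg c.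

(* the unshuffle coproduct, with the two terms in which a word is empty *)
Fixpoint dsh (w : seq L) : seq (int * (seq L * seq L)) :=
  if w is c :: w' then
    twist (fun=> 0) (fun x => (c :: x.1, x.2)) (dsh w') ++
    twist (fun x => deg c * tdeg x.1) (fun x => (x.1, c :: x.2)) (dsh w')
  else [:: (0, ([::], [::]))].

Lemma tdeg_cat a b : tdeg (a ++ b) = tdeg a + tdeg b.
Proof. exact: big_cat. Qed.

Lemma tdeg_cons c a : tdeg (c :: a) = deg c + tdeg a.
Proof. exact: big_cons. Qed.

Lemma tdeg0 : tdeg [::] = 0.
Proof. exact: big_nil. Qed.

Lemma tdeg_rcons a c : tdeg (rcons a c) = tdeg a + deg c.
Proof. by rewrite -cats1 tdeg_cat tdeg_cons tdeg0 addr0. Qed.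

(** Induction over the splittings of a word. The additivity of degree, size and weight and the
    distribution of the letters are instances. *)
Lemma dshP (P : seq L -> seq L -> seq L -> Prop) :
  P [::] [::] [::] ->
  (forall c w a b, P w a b -> P (c :: w) (c :: a) b /\ P (c :: w) a (c :: b)) ->
  forall w x, x \in supp (dsh w) -> P w x.1 x.2.
Proof.
move=> h0 h1; elim=> [|c w ih] x; first by rewrite inE => /eqP->.
rewrite /= supp_cat !supp_twist mem_cat => /orP[] /mapP[y /ih hy ->].
  by case: (h1 c _ _ _ hy).
by case: (h1 c _ _ _ hy).
Qed.

Lemma dsh_deg w x : x \in supp (dsh w) -> tdeg w = tdeg x.1 + tdeg x.2.
Proof.
move: w x; apply: (@dshP (fun w a b => tdeg w = tdeg a + tdeg b)) => [|c w a b e]; first by rewrite tdeg0 addr0.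
by rewrite !tdeg_cons e; split; [rewrite addrA | rewrite addrCA].
Qed.

Lemma dsh_size w x : x \in supp (dsh w) -> size w = (size x.1 + size x.2)%N.
Proof.
move: w x; apply: (@dshP (fun w a b => size w = (size a + size b)%N)) => [//|c w a b e] /=.
by rewrite e addSn addnS.
Qed.

Lemma dsh_mem c w x : x \in supp (dsh w) -> (c \in w) = (c \in x.1) || (c \in x.2).
Proof.
move: w x; apply: (@dshP (fun w a b => (c \in w) = (c \in a) || (c \in b))) => // d w a b e.
by rewrite !inE e -orbA; split=> //; rewrite orbCA.
Qed.

Variable K : fieldType.
Implicit Type E : lmodType K.

Lemma ev_dsh_nil E (F : _ -> E) : ev (dsh [::]) F = F ([::], [::]).
Proof. exact: ev_ret. Qed.

Lemma ev_dsh_cons E c w (F : _ -> E) : ev (dsh (c :: w)) F =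
  \S_(x <- dsh w) F (c :: x.1, x.2)
  + \S_(x <- dsh w) (ksgn K (deg c * tdeg x.1) *: F (x.1, c :: x.2)).
Proof.
rewrite /= ev_cat !ev_twist; congr (_ + _).
by apply: eq_ev => x; rewrite scale1r.
Qed.

Lemma ev_dsh1 E c (F : _ -> E) :
  ev (dsh [:: c]) F = F ([:: c], [::]) + F ([::], [:: c]).
Proof. by rewrite ev_dsh_cons !ev_dsh_nil tdeg0 mulr0 scale1r. Qed.

Lemma ev_dsh_cat E u v (F : _ -> E) : ev (dsh (u ++ v)) F =
  \S_(x <- dsh u) \S_(y <- dsh v)
    (ksgn K (tdeg x.2 * tdeg y.1) *: F (x.1 ++ y.1, x.2 ++ y.2)).
Proof.
elim: u F => [|c u ih] F /=.
  rewrite ev_dsh_nil; apply: eq_ev => -[a b] /=.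
  by rewrite tdeg0 mul0r scale1r.
rewrite ev_dsh_cons (ev_dsh_cons c u) !ih; congr (_ + _).
apply: eq_ev => x; rewrite -evZ; apply: eq_ev => y /=.
rewrite !tdeg_cat tdeg_cons; ksgn_congr.
Qed.

Lemma ev_dsh_rcons E u c (F : _ -> E) : ev (dsh (rcons u c)) F =
  \S_(x <- dsh u) (ksgn K (tdeg x.2 * deg c) *: F (rcons x.1 c, x.2))
  + \S_(x <- dsh u) F (x.1, rcons x.2 c).
Proof.
rewrite -cats1 ev_dsh_cat -evD; apply: eq_ev => x; rewrite ev_dsh1 /=.
by rewrite !cats1 !cats0 tdeg0 mulr0 scale1r tdeg_cons tdeg0 addr0.
Qed.

(** Counit property: exactly one unshuffle has an empty left word. It is used from right to left, to
    present a single term as a sum over unshuffles and compare it termwise. *)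
Lemma ev_dsh_nil_l E w (F : seq L -> E) :
  \S_(x <- dsh w) (if x.1 == [::] then F x.2 else 0) = F w.
Proof.
elim: w F => [|c w ih] F; first by rewrite ev_dsh_nil.
rewrite ev_dsh_cons /= ev_const0 add0r -[RHS](ih (fun b => F (c :: b))).
apply: eq_ev => x; case: eqP => [->|_]; last by rewrite scaler0.
by rewrite tdeg0 mulr0 scale1r.
Qed.

Lemma ev_dsh_nil_r E w (F : seq L -> E) :
  \S_(x <- dsh w) (if x.2 == [::] then F x.1 else 0) = F w.
Proof.
elim: w F => [|c w ih] F; first by rewrite ev_dsh_nil.
rewrite ev_dsh_cons /= (ih (fun a => F (c :: a))).
by rewrite ev_in0 ?addr0 // => x _; rewrite scaler0.
Qed.

(** Both sides distribute the letters over three words. By induction only the place of the first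
    letter matters, and its sign in the third word is split by additivity of the degree. *)
Lemma dsh_coassoc E w (F : seq L -> seq L -> seq L -> E) :
  \S_(x <- dsh w) \S_(y <- dsh x.1) F y.1 y.2 x.2 =
  \S_(x <- dsh w) \S_(y <- dsh x.2) F x.1 y.1 y.2.
Proof.
elim: w F => [|c w ih] F; first by rewrite !ev_dsh_nil.
rewrite [LHS]ev_dsh_cons [RHS]ev_dsh_cons.
under eq_ev do rewrite ev_dsh_cons.
under [in X in _ = _ + X]eq_ev do rewrite ev_dsh_cons /= scalerDr -!evZ.
rewrite /= !evD -addrA; congr (_ + (_ + _)).
- exact: (ih (fun a b d => F (c :: a) b d)).
- transitivity (\S_(x <- dsh w) \S_(y <- dsh x.1)
    ksgn K (deg c * tdeg y.1) *: F y.1 (c :: y.2) x.2) => //.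
  by rewrite (ih (fun a b d => ksgn K (deg c * tdeg a) *: F a (c :: b) d)).
transitivity (\S_(x <- dsh w) \S_(y <- dsh x.1)
    ksgn K (deg c * (tdeg y.1 + tdeg y.2)) *: F y.1 y.2 (c :: x.2)).
  apply: eq_ev => x; rewrite -evZ; apply: eq_ev_in => y yx.
  by rewrite (dsh_deg yx).
rewrite (ih (fun a b d => ksgn K (deg c * (tdeg a + tdeg b)) *: F a b (c :: d))).
by apply: eq_ev => x; apply: eq_ev => y; ksgn_congr.
Qed.

Lemma dsh_cocomm E w (F : seq L -> seq L -> E) :
  \S_(x <- dsh w) F x.1 x.2 =
  \S_(x <- dsh w) (ksgn K (tdeg x.1 * tdeg x.2) *: F x.2 x.1).
Proof.
elim: w F => [|c w ih] F.
  by rewrite !ev_dsh_nil tdeg0 mul0r scale1r.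
rewrite !ev_dsh_cons addrC; congr (_ + _).
  rewrite (ih (fun a b => ksgn K (deg c * tdeg a) *: F a (c :: b))).
  by apply: eq_ev => x /=; rewrite tdeg_cons; ksgn_congr.
rewrite (ih (fun a b => F (c :: a) b)).
by apply: eq_ev => x /=; rewrite tdeg_cons; ksgn_congr.
Qed.

End Unshuffles.
Arguments dsh : simpl never.

Section Degrees.
Variables (K : fieldType) (g : gradedSpace K).
Implicit Types (p : entry g) (c : letter g) (w : word g).

Lemma tdeg_sdeg c : tdeg (@sdeg K g) c = cdeg c. Proof. by []. Qed.
Lemma tdeg_ldeg w : tdeg (@ldeg K g) w = wdeg w. Proof. by []. Qed.
Lemma wdeg0 : wdeg ([::] : word g) = 0. Proof. exact: big_nil. Qed.
Lemma cdeg0 : cdeg ([::] : letter g) = 0. Proof. exact: big_nil. Qed.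
Lemma wdeg_rcons w c : wdeg (rcons w c) = wdeg w + ldeg c.
Proof. exact: tdeg_rcons. Qed.
Lemma dsh_cdeg c x : x \in supp (dsh (@sdeg K g) c) -> cdeg c = cdeg x.1 + cdeg x.2.
Proof. exact: dsh_deg. Qed.
Lemma dsh_wdeg w x : x \in supp (dsh (@ldeg K g) w) -> wdeg w = wdeg x.1 + wdeg x.2.
Proof. exact: dsh_deg. Qed.
Lemma ldegE c : ldeg c = cdeg c + 1. Proof. by []. Qed.

End Degrees.

Ltac degs := rewrite /= ?(tdeg_sdeg, tdeg_ldeg, wdeg_rcons, wdeg_cat, wdeg_cons,
  cdeg_cat, cdeg_cons, ldegE, wdeg0, cdeg0).
Ltac kcongr := degs; ksgn_congr.
Ltac kcongr_with e := degs; rewrite ?e; kcongr.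

(** * Coderivations on words *)

(* The coproduct Delta_c of a letter, including the terms with an empty letter,
   and its extension q to an odd derivation of words under concatenation. *)
Section Cobar.
Variables (K : fieldType) (g : gradedSpace K).
Implicit Types (E : lmodType K) (p : entry g) (c : letter g) (u v w : word g).
Local Notation dsh_e := (dsh (@sdeg K g)).
Local Notation dsh_l := (dsh (@ldeg K g)).

Definition sp c : seq (int * (letter g * letter g)) :=
  twist (fun x => cdeg x.1) id (dsh_e c).

Fixpoint cobar w : seq (int * word g) :=
  if w is c :: w' then
    twist (fun=> 0) (fun x => [:: x.1, x.2 & w']) (sp c) ++
    twist (fun=> ldeg c) (cons c) (cobar w')
  else [::].

Lemma ev_sp E c (F : _ -> E) :
  ev (sp c) F = \S_(x <- dsh_e c) (ksgn K (cdeg x.1) *: F x).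
Proof. exact: ev_twist. Qed.

Lemma supp_sp c : supp (sp c) = supp (dsh_e c).
Proof. by rewrite supp_twist map_id. Qed.

Lemma sp_deg c x : x \in supp (sp c) -> cdeg c = cdeg x.1 + cdeg x.2.
Proof. by rewrite supp_sp => /dsh_deg. Qed.

(** The shift of the letters makes coassociativity hold up to a sign. As [cobar] passes a letter
    with the opposite sign, of exponent [ldeg x.1 = cdeg x.1 + 1], two successive splittings of one
    letter cancel. *)
Lemma sp_coassoc E c (F : letter g -> letter g -> letter g -> E) :
  \S_(x <- sp c) \S_(y <- sp x.1) F y.1 y.2 x.2 =
  \S_(x <- sp c) (ksgn K (cdeg x.1) *: \S_(y <- sp x.2) F x.1 y.1 y.2).
Proof.
rewrite !ev_sp.
transitivity (\S_(x <- dsh_e c) \S_(y <- dsh_e x.1) (ksgn K (cdeg y.2) *: F y.1 y.2 x.2)).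
  apply: eq_ev => x; rewrite ev_sp -evZ; apply: eq_ev_in => y /dsh_deg e.
  by rewrite -tdeg_sdeg e; kcongr.
rewrite (dsh_coassoc (@sdeg K g) c (fun a b d => ksgn K (cdeg b) *: F a b d)).
apply: eq_ev => x; rewrite ev_sp -!evZ; apply: eq_ev => y; kcongr.
Qed.

(** The odd shift turns a cocommutative coproduct into an anticocommutative one. *)
Lemma sp_cocomm E c (F : letter g -> letter g -> E) :
  \S_(x <- sp c) F x.1 x.2 =
  - \S_(x <- sp c) (ksgn K (ldeg x.1 * ldeg x.2) *: F x.2 x.1).
Proof.
rewrite !ev_sp (dsh_cocomm (@sdeg K g) c (fun a b => ksgn K (cdeg a) *: F a b)) -evN.
by apply: eq_ev => x; rewrite !scale_ksgnD scale_ksgnN; kcongr.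
Qed.

Lemma ev_cobar0 E (G : word g -> E) : ev (cobar [::]) G = 0.
Proof. exact: ev_nil. Qed.

Lemma ev_cobar_cons E c w (G : word g -> E) : ev (cobar (c :: w)) G =
  \S_(x <- sp c) G [:: x.1, x.2 & w] +
  ksgn K (ldeg c) *: \S_(x <- cobar w) G (c :: x).
Proof.
rewrite /= ev_cat !ev_twist -evZ; congr (_ + _).
by apply: eq_ev => x; rewrite scale1r.
Qed.

Lemma ev_cobar_cat E u v (G : word g -> E) : ev (cobar (u ++ v)) G =
  \S_(x <- cobar u) G (x ++ v) +
  ksgn K (wdeg u) *: \S_(x <- cobar v) G (u ++ x).
Proof.
elim: u G => [|c u ih] G; first by rewrite ev_cobar0 add0r wdeg0 scale1r.
rewrite cat_cons !ev_cobar_cons ih -addrA scalerDr; congr (_ + (_ + _)).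
by rewrite scale_ksgnD wdeg_cons.
Qed.

Lemma ev_cobar_rcons E u c (G : word g -> E) : ev (cobar (rcons u c)) G =
  \S_(x <- cobar u) G (rcons x c) +
  ksgn K (wdeg u) *: \S_(x <- sp c) G (rcons (rcons u x.1) x.2).
Proof.
rewrite -cats1 ev_cobar_cat ev_cobar_cons ev_cobar0 scaler0 addr0.
congr (_ + _ *: _); first by apply: eq_ev => x; rewrite cats1.
by apply: eq_ev => x; rewrite -!cats1 -catA.
Qed.

Lemma supp_cobar_cons c w : supp (cobar (c :: w)) =
  [seq [:: x.1, x.2 & w] | x <- supp (sp c)] ++ [seq c :: x | x <- supp (cobar w)].
Proof.
by rewrite -[cobar _]/(_ ++ _) supp_cat; congr (_ ++ _); exact: supp_twist.
Qed.

(** An empty letter can only be split into two empty letters, so splitting never removes it. *)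
Lemma cobar_nil w x : x \in supp (cobar w) -> [::] \in w -> [::] \in x.
Proof.
elim: w x => [//|c w ih] x; rewrite supp_cobar_cons mem_cat inE.
case/orP=> /mapP[y hy ->]; rewrite !inE; last first.
  by case/orP=> [->//|/(ih _ hy) ->]; rewrite orbT.
case/orP=> [/eqP e|->]; last by rewrite !orbT.
by move: hy; rewrite -e supp_sp inE => /eqP ->.
Qed.

Lemma cobar_deg w x : x \in supp (cobar w) -> wdeg x = wdeg w + 1.
Proof.
elim: w x => [|c w ih] x //; rewrite supp_cobar_cons mem_cat.
case/orP=> /mapP[y hy ->]; degs; last by rewrite (ih _ hy) addrA.
move: hy => /sp_deg ->; rewrite -!addrA.
by congr (_ + _); rewrite addrCA [1 + (1 + _)]addrCA [wdeg w + 1]addrC.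
Qed.

(** q is a coderivation of the unshuffle coproduct. The terms that would contradict this send the
    two pieces of the split letter to different words; they form the sum [M] and cancel in pairs by
    anticocommutativity. *)
Lemma dsh_cobar E w (F : word g -> word g -> E) :
  \S_(x <- cobar w) \S_(y <- dsh_l x) F y.1 y.2 =
  \S_(y <- dsh_l w) \S_(a <- cobar y.1) F a y.2 +
  \S_(y <- dsh_l w) (ksgn K (wdeg y.1) *: \S_(b <- cobar y.2) F y.1 b).
Proof.
elim: w F => [|c w ih] F.
  by rewrite !ev_dsh_nil !ev_cobar0 scaler0 addr0.
rewrite ev_cobar_cons !ev_dsh_cons.
have -> : \S_(x <- sp c) \S_(y <- dsh_l [:: x.1, x.2 & w]) F y.1 y.2 =
    \S_(y <- dsh_l w) \S_(x <- sp c) F [:: x.1, x.2 & y.1] y.2 +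
    \S_(y <- dsh_l w) \S_(x <- sp c)
      (ksgn K ((cdeg c) * wdeg y.1) *: F y.1 [:: x.1, x.2 & y.2]).
  pose M x y := ksgn K (ldeg x.2 * wdeg y.1) *: F (x.1 :: y.1) (x.2 :: y.2) +
      ksgn K (ldeg x.1 * (ldeg x.2 + wdeg y.1)) *: F (x.2 :: y.1) (x.1 :: y.2).
  have M0 y : \S_(x <- sp c) M x y = 0.
    rewrite /M evD (sp_cocomm c (fun a b => ksgn K (ldeg b * wdeg y.1) *:
       F (a :: y.1) (b :: y.2))) addrC; apply/eqP; rewrite subr_eq0.
    by apply/eqP/eq_ev => x; kcongr.
  transitivity (\S_(x <- sp c) \S_(y <- dsh_l w) (F [:: x.1, x.2 & y.1] y.2 + M x y +
      ksgn K (cdeg c * wdeg y.1) *: F y.1 [:: x.1, x.2 & y.2])).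
    apply: eq_ev_in => x /sp_deg e; rewrite !ev_dsh_cons -!evD.
    apply: eq_ev => y; rewrite /M e /= -!addrA.
    by congr (_ + (_ + (_ + _))); kcongr.
  rewrite ev_swap -evD; apply: eq_ev => y; rewrite evD; congr (_ + _).
  by rewrite evD M0 addr0.
under [X in _ *: X]eq_ev do rewrite ev_dsh_cons.
rewrite evD (ih (fun a b => F (c :: a) b)).
rewrite (ih (fun a b => ksgn K (ldeg c * wdeg a) *: F a (c :: b))).
under [X in _ = X + _ + _]eq_ev do rewrite ev_cobar_cons.
under [X in _ = _ + (_ + X)]eq_ev do rewrite ev_cobar_cons !scalerDr.
rewrite !evD !scalerDr !addrA [RHS](ACl (1*5*2*4*3*6))/= -!addrA.
congr (_ + (_ + (_ + (_ + (_ + _))))).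
- by apply: eq_ev => y; rewrite -evZ; rewrite -evZ; apply: eq_ev => x; kcongr.
- by rewrite -evZ.
- by rewrite -evZ; apply: eq_ev => y; kcongr.
- rewrite -evZ; apply: eq_ev => y; rewrite -!evZ; apply: eq_ev_in => x /cobar_deg e.
  by rewrite e; kcongr.
by rewrite -evZ; apply: eq_ev => y; rewrite -!evZ; apply: eq_ev => x; kcongr.
Qed.

(** Splittings of two different letters anticommute, and two splittings of the same letter cancel by
    [sp_coassoc]. *)
Lemma cobarK E w (G : word g -> E) : \S_(x <- cobar w) ev (cobar x) G = 0.
Proof.
elim/last_ind: w G => [|u c ih] G; first exact: ev_cobar0.
rewrite ev_cobar_rcons.
under eq_ev do rewrite ev_cobar_rcons.
under [X in _ + _ *: X]eq_ev do rewrite !ev_cobar_rcons.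
rewrite !evD (ih (fun x => G (rcons x c))) add0r !scalerDr !addrA -addrA.
rewrite -[RHS]addr0; congr (_ + _); apply/eqP; rewrite addr_eq0; apply/eqP.
  rewrite ev_swap -evZ -evN; apply: eq_ev_in => x /cobar_deg e.
  by rewrite scale_ksgnN e.
rewrite -scalerN; congr (_ *: _); rewrite evZ.
rewrite (sp_coassoc c (fun a b d => G (rcons (rcons (rcons u a) b) d))).
by rewrite -evZ -evN; apply: eq_ev => x; rewrite scale_ksgnN; kcongr.
Qed.
End Cobar.
Arguments cobar : simpl never.

Section UnshuffleSwap.
Variables (L : eqType) (deg : L -> int) (K : fieldType).

Lemma dsh_swap23 (E : lmodType K) w (F : seq L -> seq L -> seq L -> E) :
  \S_(x <- dsh deg w) \S_(y <- dsh deg x.1) F y.1 y.2 x.2 =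
  \S_(x <- dsh deg w) \S_(y <- dsh deg x.1)
    (ksgn K (tdeg deg y.2 * tdeg deg x.2) *: F y.1 x.2 y.2).
Proof.
rewrite dsh_coassoc [RHS](dsh_coassoc deg w
  (fun a b d => ksgn K (tdeg deg b * tdeg deg d) *: F a d b)).
by apply: eq_ev => x; rewrite (dsh_cocomm deg x.2 (F x.1)).
Qed.

Lemma dsh_swap12 (E : lmodType K) w (F : seq L -> seq L -> seq L -> E) :
  \S_(x <- dsh deg w) \S_(y <- dsh deg x.2) F x.1 y.1 y.2 =
  \S_(x <- dsh deg w) \S_(y <- dsh deg x.2)
    (ksgn K (tdeg deg x.1 * tdeg deg y.1) *: F y.1 x.1 y.2).
Proof.
rewrite -dsh_coassoc -[RHS](dsh_coassoc deg w
  (fun a b d => ksgn K (tdeg deg a * tdeg deg b) *: F b a d)).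
by apply: eq_ev => x; rewrite (dsh_cocomm deg x.1 (fun a b => F a b x.2)).
Qed.

End UnshuffleSwap.

(** * The coderivation with a given corestriction, on formal sums *)

Section Coderivation.
Variables (K : fieldType) (g : gradedSpace K) (p : int) (psi : word g -> entry g).
(** A letter with a single entry of degree i has degree i + 2, because of the two suspensions; hence
    the -2. *)
Hypothesis psi_deg : forall w, (psi w).1 = wdeg w + p - 2.
Implicit Types (E : lmodType K) (c : letter g) (u v w : word g).
Local Notation dsh_e := (dsh (@sdeg K g)).
Local Notation dsh_l := (dsh (@ldeg K g)).

(* the component of the coderivation with values in one letter, on u (x) c *)
Definition cogen u c : seq (int * letter g) :=
  twist (fun=> 0) (fun x => psi (rcons u x.1) :: x.2) (dsh_e c) ++
  twist (fun=> wdeg u) (fun x => psi x :: c) (cobar u).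

(** The Zinbiel coproduct distinguishes the last letter, so the recursion removes letters from the
    end and runs on the reversed word. *)
Fixpoint coder_rev (r : word g) : seq (int * word g) :=
  if r is c :: r' then
    twist (fun=> 0) (fun x => rcons x c) (coder_rev r') ++
    bind (dsh_l (rev r')) (fun y =>
      twist (fun=> p * wdeg y.1) (rcons y.1) (cogen y.2 c))
  else [::].

Definition coder w := coder_rev (rev w).

Lemma ev_cogen E u c (G : letter g -> E) : ev (cogen u c) G =
  \S_(x <- dsh_e c) G (psi (rcons u x.1) :: x.2) +
  ksgn K (wdeg u) *: (\S_(x <- cobar u) G (psi x :: c)).
Proof.
rewrite ev_cat !ev_twist -evZ; congr (_ + _).
by apply: eq_ev => x; rewrite scale1r.
Qed.

Lemma ev_coder0 E (G : word g -> E) : ev (coder [::]) G = 0.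
Proof. exact: ev_nil. Qed.

Lemma ev_coder_rcons E u c (G : word g -> E) : ev (coder (rcons u c)) G =
  \S_(x <- coder u) G (rcons x c) +
  \S_(y <- dsh_l u) (ksgn K (p * wdeg y.1) *: \S_(l <- cogen y.2 c) G (rcons y.1 l)).
Proof.
rewrite /coder rev_rcons /= revK ev_cat ev_twist ev_bind; congr (_ + _).
  by apply: eq_ev => x; rewrite scale1r.
by apply: eq_ev => y; rewrite ev_twist evZ.
Qed.

Lemma psi_sdeg w : sdeg (psi w) = wdeg w + p - 1.
Proof. by rewrite /sdeg psi_deg -addrA. Qed.

Lemma cogen_deg u c l : l \in supp (cogen u c) -> ldeg l = wdeg u + ldeg c + p.
Proof.
rewrite /cogen supp_cat !supp_twist mem_cat => /orP[] /mapP[x hx ->];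
  rewrite ldegE cdeg_cons psi_sdeg.
  move: hx => /dsh_deg; rewrite !tdeg_sdeg; degs => ->.
  ring.
by rewrite (cobar_deg hx) ldegE; ring.
Qed.

(** The entry produced by [psi] goes to the left or to the right piece of the split letter. In the
    first case the rest of [c] is regrouped by coassociativity, in the second also by exchanging the
    first two pieces. *)
Lemma cogen_sp E u c (F : letter g -> letter g -> E) :
  \S_(l <- cogen u c) \S_(x <- sp l) F x.1 x.2 =
  ksgn K (wdeg u + p) *: (\S_(x <- sp c) \S_(l <- cogen u x.1) F l x.2) +
  \S_(x <- sp c) (ksgn K ((wdeg u + p) * cdeg x.1) *: \S_(l <- cogen u x.2) F x.1 l).
Proof.
have spE y c' : \S_(x <- sp (y :: c')) F x.1 x.2 =
    \S_(x <- dsh_e c') (ksgn K (sdeg y + cdeg x.1) *: F (y :: x.1) x.2) +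
    \S_(x <- dsh_e c') (ksgn K (cdeg x.1 + sdeg y * cdeg x.1) *: F x.1 (y :: x.2)).
  rewrite ev_sp ev_dsh_cons; congr (_ + _); apply: eq_ev => x /=.
    by rewrite cdeg_cons.
  by rewrite scale_ksgnD addrC.
rewrite ev_cogen; under eq_ev do rewrite spE.
under [X in _ + _ *: X]eq_ev do rewrite spE.
rewrite !evD.
under [X in _ = _ *: X + _]eq_ev do rewrite ev_cogen.
under [X in _ = _ + X]eq_ev do rewrite ev_cogen scalerDr.
rewrite !evD !scalerDr !addrA [LHS](ACl (1*3*2*4))/=.
congr (_ + _ + _ + _).
- rewrite -(dsh_coassoc (@sdeg K g) c (fun a b d =>
    ksgn K (sdeg (psi (rcons u a)) + cdeg b) *: F (psi (rcons u a) :: b) d)).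
  rewrite ev_sp -evZ; apply: eq_ev => x; rewrite -!evZ.
  by apply: eq_ev_in => y /dsh_cdeg e; rewrite e psi_sdeg; kcongr.
- rewrite ev_swap ev_sp -!evZ; apply: eq_ev => x; rewrite -!evZ; apply: eq_ev_in => y hy.
  by rewrite psi_sdeg (cobar_deg hy); kcongr.
- rewrite (dsh_swap12 (@sdeg K g) c (fun a b d =>
    ksgn K (cdeg b + sdeg (psi (rcons u a)) * cdeg b) *: F b (psi (rcons u a) :: d))).
  rewrite ev_sp; apply: eq_ev => x; rewrite -!evZ; apply: eq_ev => y.
  by rewrite psi_sdeg; kcongr.
rewrite ev_swap ev_sp -!evZ; apply: eq_ev => x; rewrite -!evZ; apply: eq_ev_in => y hy.
by rewrite psi_sdeg (cobar_deg hy); kcongr.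
Qed.

(** [cogen] vanishes on the terms which q produces from [u] and [c]. This is what its correction
    term [psi (q u)] is for: one sum is zero because q squares to zero, and the four others cancel
    in pairs. *)
Lemma cogen_cobar E u c (H : letter g -> E) :
  ksgn K (wdeg u) *: (\S_(x <- sp c) \S_(l <- cogen (rcons u x.1) x.2) H l) +
  \S_(y <- cobar u) \S_(l <- cogen y c) H l = 0.
Proof.
under eq_ev do rewrite ev_cogen ev_cobar_rcons !scalerDr.
under [X in _ + X]eq_ev do rewrite ev_cogen.
rewrite !evD !scalerDr !addrA.
have -> : \S_(x <- cobar u) (ksgn K (wdeg x) *: \S_(x0 <- cobar x) H (psi x0 :: c)) = 0.
  transitivity (ksgn K (wdeg u + 1) *:
      (\S_(x <- cobar u) \S_(x0 <- cobar x) H (psi x0 :: c))).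
    by rewrite -evZ; apply: eq_ev_in => y /cobar_deg ->.
  by rewrite cobarK scaler0.
rewrite addr0 [LHS](ACl ((1*3)*(2*4)))/=.
have cancel (a b : E) : a = - b -> a + b = 0 by move->; rewrite addNr.
rewrite -[RHS]addr0; congr (_ + _); apply: cancel.
  rewrite -scalerN; congr (_ *: _); rewrite !ev_sp.
  under eq_ev do rewrite -evZ.
  rewrite -(dsh_coassoc (@sdeg K g) c (fun a b d =>
    ksgn K (cdeg a) *: H (psi (rcons (rcons u a) b) :: d))) -evN.
  apply: eq_ev => x; rewrite ev_sp -!evZ -evN; apply: eq_ev_in => y /dsh_cdeg e.
  by rewrite !scale_ksgnD scale_ksgnN; kcongr_with e.
rewrite ev_sp [in RHS]ev_swap -evZ -evN; apply: eq_ev => x.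
rewrite -!evZ -evN; apply: eq_ev => y.
by rewrite oppr_ksgn; kcongr.
Qed.

Lemma coder_deg w x : x \in supp (coder w) -> wdeg x = wdeg w + p.
Proof.
elim/last_ind: w x => [//|u c ih] x.
rewrite /coder rev_rcons /= revK supp_cat supp_twist supp_bind mem_cat.
case/orP=> [/mapP[y /ih e ->]|/flattenP[s /mapP[y /dsh_wdeg e ->]]].
  by rewrite !wdeg_rcons e addrAC.
rewrite supp_twist => /mapP[l /cogen_deg e' ->].
by rewrite !wdeg_rcons e e'; ring.
Qed.

(** The produced letter ends in the left or in the right word. Together with the letters which it
    consumes, this is an unshuffle of [u] into three words, regrouped by [dsh_swap23] and
    [dsh_coassoc]. *)
Lemma dsh_coder E w (F : word g -> word g -> E) :
  \S_(x <- coder w) \S_(y <- dsh_l x) F y.1 y.2 =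
  \S_(y <- dsh_l w) \S_(a <- coder y.1) F a y.2 +
  \S_(y <- dsh_l w) (ksgn K (p * wdeg y.1) *: \S_(b <- coder y.2) F y.1 b).
Proof.
elim/last_ind: w F => [|u c ih] F.
  by rewrite !ev_dsh_nil !ev_coder0 scaler0 addr0.
rewrite ev_coder_rcons !ev_dsh_rcons.
under eq_ev do rewrite ev_dsh_rcons.
rewrite evD (ih (fun a b => F a (rcons b c))).
rewrite (ih (fun a b => ksgn K (wdeg b * ldeg c) *: F (rcons a c) b)).
under [X in _ + X = _]eq_ev do under eq_ev do rewrite ev_dsh_rcons.
under [X in _ + X = _]eq_ev do rewrite evD scalerDr.
under [X in _ = (X + _) + _]eq_ev do rewrite ev_coder_rcons scalerDr.
under [X in _ = _ + (_ + X)]eq_ev do rewrite ev_coder_rcons scalerDr.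
rewrite !evD !addrA.
rewrite [RHS](ACl (1*4*3*5*2*6))/=; congr (_ + _ + _ + _ + _ + _).
- by apply: eq_ev => y; rewrite evZ.
- apply: eq_ev => y; rewrite -!evZ; apply: eq_ev_in => b hb.
  by rewrite (coder_deg hb); kcongr.
- transitivity (\S_(x <- dsh_l u) \S_(y <- dsh_l x.1) (ksgn K (p * (wdeg y.1 + wdeg y.2)) *:
      \S_(l <- cogen x.2 c) (ksgn K (wdeg y.2 * ldeg l) *: F (rcons y.1 l) y.2))).
    apply: eq_ev => x; rewrite ev_swap -evZ; apply: eq_ev_in => y /dsh_wdeg e.
    by rewrite e.
  rewrite (dsh_swap23 (@ldeg K g) u (fun a b d => ksgn K (p * (wdeg a + wdeg b)) *:
      \S_(l <- cogen d c) (ksgn K (wdeg b * ldeg l) *: F (rcons a l) b))).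
  apply: eq_ev => x; rewrite -evZ; apply: eq_ev => y; rewrite -!evZ.
  by apply: eq_ev_in => l hl; rewrite (cogen_deg hl); kcongr.
transitivity (\S_(x <- dsh_l u) \S_(y <- dsh_l x.1) (ksgn K (p * (wdeg y.1 + wdeg y.2)) *:
    \S_(l <- cogen x.2 c) F y.1 (rcons y.2 l))).
  apply: eq_ev => x; rewrite ev_swap -evZ; apply: eq_ev_in => y /dsh_wdeg e.
  by rewrite e.
rewrite (dsh_coassoc (@ldeg K g) u (fun a b d => ksgn K (p * (wdeg a + wdeg b)) *:
      \S_(l <- cogen d c) F a (rcons b l))).
by apply: eq_ev => x; rewrite -evZ; apply: eq_ev => y; kcongr.
Qed.

(** The coderivation commutes with q up to the sign of its degree. A splitting inside the produced
    letter is handled by [cogen_sp]; the splittings of the letters that it consumes have no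
    counterpart on the left and add up to zero by [cogen_cobar]. *)
Lemma cobar_coder E w (G : word g -> E) :
  \S_(x <- coder w) \S_(y <- cobar x) G y =
  ksgn K p *: (\S_(x <- cobar w) \S_(y <- coder x) G y).
Proof.
elim/last_ind: w G => [|u c ih] G.
  by rewrite ev_coder0 ev_cobar0 scaler0.
rewrite ev_coder_rcons ev_cobar_rcons.
under eq_ev do rewrite ev_cobar_rcons.
under [X in _ + X = _]eq_ev do under eq_ev do rewrite ev_cobar_rcons.
under [X in _ + X = _]eq_ev => y do
  rewrite evD evZ (cogen_sp y.2 c (fun a b => G (rcons (rcons y.1 a) b))) !scalerDr.
under [X in _ = _ *: (X + _)]eq_ev do rewrite ev_coder_rcons.
under [X in _ = _ *: (_ + _ *: X)]eq_ev do rewrite !ev_coder_rcons ev_dsh_rcons.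
rewrite !evD (ih (fun x => G (rcons x c))) !scalerDr !addrA.
rewrite (dsh_cobar u (fun a b => ksgn K (p * wdeg a) *: \S_(l <- cogen b c) G (rcons a l))).
rewrite !scalerDr !addrA [RHS](ACl (1*4*2*5*6*(3*7)))/= -[LHS]addr0.
congr (_ + _ + _ + _ + _ + _).
- rewrite [in RHS]ev_swap -!evZ; apply: eq_ev_in => x hx.
  by rewrite (coder_deg hx) !scale_ksgnD addrC.
- rewrite -evZ; apply: eq_ev => x; rewrite ev_swap -!evZ; apply: eq_ev_in => y hy.
  by rewrite (cobar_deg hy); kcongr.
- rewrite [in RHS]ev_swap -!evZ; apply: eq_ev_in => x /dsh_wdeg e.
  by rewrite -!evZ; apply: eq_ev => y; kcongr_with e.
- rewrite [in RHS]ev_swap -!evZ; apply: eq_ev_in => x /dsh_wdeg e.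
  by rewrite -!evZ; apply: eq_ev => y; kcongr_with e.
rewrite [X in _ = _ + _ *: (_ *: X)]ev_swap -!evZ -evD -[LHS](ev_const0 E (dsh_l u)).
apply: eq_ev_in => x /dsh_wdeg e /=.
transitivity (ksgn K (p + wdeg x.1 + p * wdeg x.1) *:
  (ksgn K (wdeg x.2) *: (\S_(y <- sp c) \S_(l <- cogen (rcons x.2 y.1) y.2) G (rcons x.1 l)) +
  \S_(y <- cobar x.2) \S_(l <- cogen y c) G (rcons x.1 l))).
  by rewrite (cogen_cobar x.2 c (fun l => G (rcons x.1 l))) scaler0.
rewrite scalerDr addrC -!evZ; congr (_ + _); apply: eq_ev => y; rewrite -!evZ;
  apply: eq_ev => l; first by kcongr.
by kcongr_with e.
Qed.

(* the image of F under the transpose of the extension of the coderivation to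
   the tensor square *)
Definition coder2 E (F : word g -> word g -> E) u v : E :=
  \S_(a <- coder u) F a v + ksgn K (p * wdeg u) *: (\S_(b <- coder v) F u b).

(* Write a word as a word u followed by a letter c. The three terms of the
   coproducts are A = (q (x) 1) dsh(u) (1 (x) c), B = dsh(u) Delta_c(c) and
   dsh(u) (1 (x) c), where q is the cobar derivation. *)
Definition termA E (F : word g -> word g -> E) u c : E :=
  \S_(y <- dsh_l u) \S_(a <- cobar y.1) F a (rcons y.2 c).

Definition termB E (F : word g -> word g -> E) u c : E :=
  \S_(y <- dsh_l u) \S_(x <- sp c)
    (ksgn K (wdeg y.1 + wdeg y.2 + wdeg y.2 * ldeg x.1) *:
      F (rcons y.1 x.1) (rcons y.2 x.2)).

Definition termZ E (F : word g -> word g -> E) u c : E :=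
  \S_(y <- dsh_l u) F y.1 (rcons y.2 c).

(** Both coproducts of [bar] have a closed form only when the last letter is exposed. This is the
    sum over [coder (rcons u c)] of a functional written in terms of an initial word and a last
    letter. *)
Definition last_ev E (T : word g -> letter g -> E) u c : E :=
  \S_(x <- coder u) T x c +
  \S_(y <- dsh_l u) (ksgn K (p * wdeg y.1) *: \S_(l <- cogen y.2 c) T y.1 l).

Lemma termZ_coder E (F : word g -> word g -> E) u c :
  last_ev (termZ F) u c = termZ (coder2 F) u c.
Proof.
rewrite /last_ev /termZ /coder2 (dsh_coder u (fun a b => F a (rcons b c))).
rewrite evD -addrA; congr (_ + _).
under [X in _ = X]eq_ev do rewrite ev_coder_rcons scalerDr.
rewrite evD; congr (_ + _).
transitivity (\S_(x <- dsh_l u) \S_(y <- dsh_l x.1) (ksgn K (p * (wdeg y.1 + wdeg y.2)) *: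
    \S_(l <- cogen x.2 c) F y.1 (rcons y.2 l))).
  apply: eq_ev => x; rewrite ev_swap -evZ; apply: eq_ev_in => y /dsh_wdeg e.
  by rewrite e.
rewrite (dsh_coassoc (@ldeg K g) u (fun a b d => ksgn K (p * (wdeg a + wdeg b)) *:
      \S_(l <- cogen d c) F a (rcons b l))).
by apply: eq_ev => x; rewrite -evZ; apply: eq_ev => y; kcongr.
Qed.

Lemma termA_coder E (F : word g -> word g -> E) u c :
  last_ev (termA F) u c = ksgn K p *: termA (coder2 F) u c.
Proof.
rewrite /last_ev /termA /coder2.
rewrite (dsh_coder u (fun a b => \S_(x <- cobar a) F x (rcons b c))).
under [X in _ = _ *: X]eq_ev do rewrite evD.
rewrite evD scalerDr -!addrA; congr (_ + _).
  rewrite -evZ; apply: eq_ev => y.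
  by rewrite (cobar_coder y.1 (fun a => F a (rcons y.2 c))).
under [X in _ = _ *: X]eq_ev do under eq_ev do rewrite ev_coder_rcons scalerDr.
under [X in _ = _ *: X]eq_ev do rewrite evD.
rewrite evD scalerDr; congr (_ + _).
  rewrite -evZ; apply: eq_ev => y; rewrite ev_swap -!evZ; apply: eq_ev_in => x hx.
  rewrite -!evZ; apply: eq_ev => z; rewrite (cobar_deg hx); kcongr.
transitivity (\S_(x <- dsh_l u) \S_(y <- dsh_l x.1) (ksgn K (p * (wdeg y.1 + wdeg y.2)) *:
    \S_(l <- cogen x.2 c) \S_(a <- cobar y.1) F a (rcons y.2 l))).
  apply: eq_ev => x; rewrite ev_swap -evZ; apply: eq_ev_in => y /dsh_wdeg e.
  by rewrite e.
rewrite (dsh_coassoc (@ldeg K g) u (fun a b d => ksgn K (p * (wdeg a + wdeg b)) *: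
      \S_(l <- cogen d c) \S_(x <- cobar a) F x (rcons b l))).
rewrite -evZ; apply: eq_ev => x; transitivity (\S_(a <- cobar x.1) \S_(y <- dsh_l x.2)
    (ksgn K (p * (wdeg x.1 + wdeg y.1)) *: \S_(l <- cogen y.2 c) F a (rcons y.1 l))).
  by rewrite [RHS]ev_swap; apply: eq_ev => y; rewrite evZ [in RHS]ev_swap.
rewrite -evZ; apply: eq_ev_in => a ha; rewrite -!evZ; apply: eq_ev => y.
by rewrite (cobar_deg ha); kcongr.
Qed.

Lemma termB_coder E (F : word g -> word g -> E) u c :
  last_ev (termB F) u c = ksgn K p *: termB (coder2 F) u c.
Proof.
rewrite /last_ev /termB /coder2.
rewrite (dsh_coder u (fun a b => \S_(x <- sp c)
    (ksgn K (wdeg a + wdeg b + wdeg b * ldeg x.1) *: F (rcons a x.1) (rcons b x.2)))).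
under [X in _ = _ *: X]eq_ev do under eq_ev do rewrite !ev_coder_rcons !scalerDr.
under [X in _ = _ *: X]eq_ev do rewrite !evD.
rewrite !evD !scalerDr.
rewrite !addrA [RHS](ACl (1*3*(2*4)))/= -!addrA; congr (_ + (_ + _)).
- rewrite -evZ; apply: eq_ev => y; rewrite ev_swap -evZ; apply: eq_ev => x.
  by rewrite -!evZ; apply: eq_ev_in => a ha; rewrite (coder_deg ha); kcongr.
- rewrite -evZ; apply: eq_ev => y; rewrite ev_swap -!evZ; apply: eq_ev => x.
  by rewrite -!evZ; apply: eq_ev_in => a ha; rewrite (coder_deg ha); kcongr.
(* The produced letter is itself divided between the two words by [cogen_sp]. In [H1] the new entry
   lies in the left piece, in [H2] in the right one. *)
pose H1 a b d := ksgn K (p * (wdeg a + wdeg b) + wdeg d + p) *: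
  \S_(x <- sp c) \S_(l <- cogen d x.1)
    (ksgn K (wdeg a + wdeg b + wdeg b * ldeg l) *: F (rcons a l) (rcons b x.2)).
pose H2 a b d := ksgn K (p * (wdeg a + wdeg b)) *: \S_(x <- sp c)
  (ksgn K ((wdeg d + p) * cdeg x.1) *: \S_(l <- cogen d x.2)
    (ksgn K (wdeg a + wdeg b + wdeg b * ldeg x.1) *: F (rcons a x.1) (rcons b l))).
transitivity (\S_(x <- dsh_l u) \S_(y <- dsh_l x.1) H1 y.1 y.2 x.2 +
    \S_(x <- dsh_l u) \S_(y <- dsh_l x.1) H2 y.1 y.2 x.2).
  rewrite -evD; apply: eq_ev => x; rewrite ev_swap -evD -evZ.
  apply: eq_ev_in => y /dsh_wdeg e.
  rewrite (cogen_sp x.2 c (fun a b => ksgn K (wdeg y.1 + wdeg y.2 + wdeg y.2 * ldeg a) *: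
    F (rcons y.1 a) (rcons y.2 b))) scalerDr e.
  by congr (_ + _); rewrite /H1 -?addrA; kcongr.
rewrite (dsh_swap23 (@ldeg K g) u H1) (dsh_coassoc (@ldeg K g) u H2) -!evZ; congr (_ + _).
  apply: eq_ev => x.
  under [LHS]eq_ev do rewrite /H1 -!evZ.
  rewrite ev_swap -evZ; apply: eq_ev => z; rewrite -!evZ; apply: eq_ev_in => y /dsh_wdeg e.
  by rewrite -!evZ; apply: eq_ev_in => l hl; rewrite (cogen_deg hl); kcongr_with e.
apply: eq_ev => x.
under [LHS]eq_ev do rewrite /H2 -!evZ.
rewrite ev_swap -evZ; apply: eq_ev => z; rewrite -!evZ; apply: eq_ev_in => y /dsh_wdeg e.
by rewrite -!evZ; apply: eq_ev_in => l hl; rewrite ?(cogen_deg hl); kcongr_with e.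
Qed.

End Coderivation.

(** * The coproducts of the bar coalgebra *)

Section Masks.
Variable K : fieldType.
Implicit Type E : lmodType K.

Lemma bsum_sum E n (I : Type) (r : seq I) (P : pred I) (G : I -> bitseq -> E) :
  \sum_(i <- r | P i) bsum n (G i) = bsum n (fun m => \sum_(i <- r | P i) G i m).
Proof. by elim: n G => [|n ih] G //=; rewrite big_split /= !ih. Qed.

Lemma bsum0 E n : bsum n (fun=> 0 : E) = 0.
Proof. by elim: n => //= n ->; rewrite addr0. Qed.

Lemma koszul_cat m1 m2 d1 d2 : size m1 = size d1 ->
  koszul K (m1 ++ m2) (d1 ++ d2) = koszul K m1 d1 * koszul K m2 d2 *
    ksgn K ((\sum_(e <- mask (map negb m1) d1) e) * \sum_(e <- mask m2 d2) e).
Proof.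
elim: m1 d1 => [|b m1 ih] [|d d1] //=; first by rewrite big_nil mul0r ksgn0 mul1r mulr1.
case=> sz; rewrite ih //; case: b => /=; first by rewrite !mul1r.
rewrite mask_cat // big_cat big_cons /= mulrDr mulrDl !ksgnD !mulrA; congr (_ * _).
by rewrite -!mulrA; congr (_ * _); rewrite mulrC -mulrA.
Qed.

Variables (L : eqType) (deg : L -> int).
Implicit Type w : seq L.

Lemma sum_mask m w : \sum_(e <- mask m (map deg w)) e = tdeg deg (mask m w).
Proof. by rewrite -map_mask big_map. Qed.

Lemma ev_dsh_bsum E w (F : seq L -> seq L -> E) :
  \S_(x <- dsh deg w) F x.1 x.2 =
  bsum (size w) (fun m => koszul K m (map deg w) *: F (mask m w) (mask (map negb m) w)).
Proof.
elim: w F => [|c w ih] F /=; first by rewrite ev_dsh_nil scale1r.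
rewrite ev_dsh_cons (ih (fun a b => F (c :: a) b)).
rewrite (ih (fun a b => ksgn K (deg c * tdeg deg a) *: F a (c :: b))).
congr (_ + _); apply: eq_bsum => m _; rewrite ?mul1r //.
by rewrite scalerA mulrC sum_mask.
Qed.

Lemma unshuff_cond_bsum E a b i (F : seq L -> seq L -> E) w :
  unshuff deg a b i F w = bsum (size w) (fun m =>
    if (count id m == i) && unshuff_cond a b m then
      koszul K m (map deg w) *: F (mask m w) (mask (map negb m) w)
    else 0).
Proof. by rewrite -tuple_bsum /unshuff big_mkcond; apply: eq_bigr. Qed.

Lemma sum_unshuff E a b lo hi (F : seq L -> seq L -> E) w :
  \sum_(lo <= i < hi) unshuff deg a b i F w = bsum (size w) (fun m =>
    if (lo <= count id m < hi)%N && unshuff_cond a b m then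
      koszul K m (map deg w) *: F (mask m w) (mask (map negb m) w)
    else 0).
Proof.
under eq_bigr do rewrite unshuff_cond_bsum.
rewrite bsum_sum; apply: eq_bsum => m _.
case: (unshuff_cond a b m); last by rewrite andbF big1 // => i _; rewrite andbF.
under eq_bigr do rewrite andbT.
rewrite andbT; case: ifP => h.
  rewrite (bigD1_seq (count id m)) ?mem_index_iota ?iota_uniq //= eqxx.
  by rewrite big1 ?addr0 // => i; rewrite eq_sym => /negPf ->.
rewrite big_seq big1 // => i; rewrite mem_index_iota => hi'.
by case: eqP => // e; rewrite e hi' in h.
Qed.

Lemma sum_unshuff_all E (F : seq L -> seq L -> E) w :
  \sum_(0 <= i < (size w).+1) unshuff deg None None i F w = \S_(x <- dsh deg w) F x.1 x.2.
Proof.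
rewrite sum_unshuff ev_dsh_bsum; apply: eq_bsum => m sm.
by rewrite ltnS -sm count_size.
Qed.

(** The range of i excludes exactly the two unshuffles with an empty word, where [F] vanishes. *)
Lemma sum_unshuff_inner E (F : seq L -> seq L -> E) w :
  (forall b, F [::] b = 0) -> (forall a, F a [::] = 0) ->
  \sum_(1 <= i < size w) unshuff deg None None i F w = \S_(x <- dsh deg w) F x.1 x.2.
Proof.
move=> h1 h2; rewrite sum_unshuff ev_dsh_bsum; apply: eq_bsum => m sm.
rewrite andbT; case: ifP => // /negbT; rewrite negb_and -leqNgt leqn0 -leqNgt -sm.
case/orP=> hc.
  suff -> : mask m w = [::] by rewrite h1 scaler0.
  by apply/size0nil; rewrite size_mask //; apply/eqP.
suff -> : mask (map negb m) w = [::] by rewrite h2 scaler0.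
apply/size0nil; rewrite size_mask ?size_map // count_map; apply/eqP.
rewrite -(eqn_add2l (count id m)) addn0 -[X in _ == X](_ : size m = _); last first.
  by apply/eqP; rewrite eqn_leq hc count_size.
by rewrite -(count_predC id m) eqxx.
Qed.

Lemma sum_unshuff_last E (F : seq L -> seq L -> E) u c :
  (forall b, F [::] b = 0) ->
  \sum_(1 <= i < (size u).+1) unshuff deg None (Some (size u)) i F (rcons u c) =
  \S_(x <- dsh deg u) F x.1 (rcons x.2 c).
Proof.
move=> h1; rewrite sum_unshuff (ev_dsh_bsum u (fun a b => F a (rcons b c))).
rewrite size_rcons -addn1 bsum_cat; apply: eq_bsum => m sm /=.
rewrite /unshuff_cond /= !nth_cat sm ltnn subnn /= andbF add0r andbT.
rewrite count_cat /= !addn0 map_rcons -cats1 koszul_cat ?size_map //=.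
rewrite !big_nil !mulr0 ksgn0 !mulr1 -cats1 map_cat !mask_cat ?size_map //= cats0.
rewrite addn1 ltnS -sm count_size andbT; case: ifP => [_|/negbT]; first by rewrite cats1.
rewrite -leqNgt leqn0 => hc.
suff -> : mask m u = [::] by rewrite h1 scaler0.
by apply/size0nil; rewrite size_mask //; apply/eqP.
Qed.

End Masks.

Section BlockMasks.
Variables (K : fieldType) (g : gradedSpace K).
Implicit Types (E : lmodType K) (c l : letter g) (x y u : word g).
Local Notation dsh_l := (dsh (@ldeg K g)).

(** The block [z] is forced into the left word and the last block into the right one, so only the
    letters of [x] and [y] are unshuffled; [z] takes part in the signs as one letter of degree
    [wdeg z]. *)
Lemma sum_unshuff_block E (F : word g -> word g -> E) x y (z : word g) l :
  let w := [seq [:: c] | c <- x] ++ z :: rcons [seq [:: c] | c <- y] [:: l] in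
  \sum_(1 <= i < size w) unshuff (@wdeg K g) (Some (size x)) (Some (size w).-1) i
    (fun U V => F (flatten U) (flatten V)) w =
  \S_(a <- dsh_l x) \S_(b <- dsh_l y) (ksgn K (wdeg a.2 * (wdeg z + wdeg b.1)) *:
    F (a.1 ++ z ++ b.1) (a.2 ++ rcons b.2 l)).
Proof.
pose S (s : word g) : seq (word g) := [seq [:: c] | c <- s].
have flatS s : flatten (S s) = s by elim: s => //= a s ->.
have degS s : map (@wdeg K g) (S s) = map (@ldeg K g) s.
  by rewrite -map_comp; apply: eq_map => a /=; rewrite wdeg_cons wdeg0 addr0.
move=> w; rewrite sum_unshuff.
have sw : size w = (size x + (1 + (size y + 1)))%N.
  by rewrite size_cat /= size_rcons !size_map addn1.
rewrite (ev_dsh_bsum (@ldeg K g) x (fun a1 a2 => \S_(b <- dsh_l y)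
  (ksgn K (wdeg a2 * (wdeg z + wdeg b.1)) *: F (a1 ++ z ++ b.1) (a2 ++ rcons b.2 l)))).
rewrite sw bsum_cat; apply: eq_bsum => m1 sm1.
rewrite (ev_dsh_bsum (@ldeg K g) y (fun b1 b2 =>
  (ksgn K (wdeg (mask (map negb m1) x) * (wdeg z + wdeg b1)) *:
   F (mask m1 x ++ z ++ b1) (mask (map negb m1) x ++ rcons b2 l)))).
rewrite bsum_cat /= !bsum_cat.
have -> : bsum (size y) (fun m2 => bsum 1 (fun m3 =>
    if (0 < count id (m1 ++ false :: m2 ++ m3) < size x + (1 + (size y + 1)))%N &&
      unshuff_cond (Some (size x)) (Some (size x + (1 + (size y + 1))).-1%N) (m1 ++ false :: m2 ++ m3)
    then koszul K (m1 ++ false :: m2 ++ m3) (map (@wdeg K g) w) *: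
      F (flatten (mask (m1 ++ false :: m2 ++ m3) w))
        (flatten (mask (map negb (m1 ++ false :: m2 ++ m3)) w))
    else 0)) = 0.
  rewrite -[RHS](bsum0 E (size y)); apply: eq_bsum => m2 _.
  rewrite -[RHS](bsum0 E 1); apply: eq_bsum => m3 _.
  by rewrite /unshuff_cond nth_cat sm1 ltnn subnn /= andbF.
rewrite addr0 -bsumZ; apply: eq_bsum => m2 sm2 /=.
have condE b : unshuff_cond (Some (size x)) (Some (size x + (1 + (size y + 1))).-1)
    (m1 ++ true :: m2 ++ [:: b]) = ~~ b.
  have -> : (size x + (1 + (size y + 1))).-1%N = size (m1 ++ true :: m2).
    by rewrite size_cat /= sm1 sm2 !addnA addn1 /= -addnA.
  rewrite /unshuff_cond nth_cat sm1 ltnn subnn /=.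
  have -> : m1 ++ true :: m2 ++ [:: b] = rcons (m1 ++ true :: m2) b.
    by rewrite -cats1 -catA.
  by rewrite nth_rcons ltnn eqxx.
rewrite !condE andbF add0r andbT ifT; last first.
  rewrite !count_cat /=; have := count_size id m1; have := count_size id m2.
  rewrite sm1 sm2; rewrite count_cat /=; lia.
have -> : map (@wdeg K g) w = map (@ldeg K g) x ++ wdeg z :: rcons (map (@ldeg K g) y) (ldeg l).
  by rewrite map_cat /= map_rcons degS degS wdeg_cons wdeg0 addr0.
rewrite -!cats1 koszul_cat ?size_map //= koszul_cat ?size_map //= !big_nil !mulr0.
rewrite ksgn0 !mulr1 mul1r mask_cat ?size_map //= cats0 big_cons !sum_mask.
rewrite !scalerA !map_cat /= map_cat /w -cats1 !mask_cat ?size_map //=.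
rewrite !mask_cat ?size_map //= !flatten_cat /= ?flatten_cat /= ?cats0.
rewrite -!(map_mask (cons^~ [::])) !flatS mulrA.
by [].
Qed.

Lemma split_letterE E (F : letter g -> letter g -> E) c :
  (forall b, F [::] b = 0) -> (forall a, F a [::] = 0) ->
  split_letter F c = \S_(x <- sp c) F x.1 x.2.
Proof.
move=> h1 h2; rewrite /split_letter sum_unshuff_inner ?ev_sp // => [b|a].
  by rewrite h1 scaler0.
by rewrite h2 scaler0.
Qed.

(** The splittings of letters of the left word are sorted by the position of the split letter in
    [u], which is the way [dc_termA] is indexed. *)
Lemma dsh_cobar_sum E u (F : word g -> word g -> E) :
  \S_(y <- dsh_l u) \S_(a <- cobar y.1) F a y.2 =
  \sum_(k < size u) ksgn K (wdeg (take k u)) *: \S_(z <- sp (nth [::] u k))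
    \S_(p <- dsh_l (take k u)) \S_(r <- dsh_l (drop k.+1 u))
      (ksgn K (wdeg p.2 * (ldeg z.1 + ldeg z.2 + wdeg r.1)) *:
       F (p.1 ++ [:: z.1, z.2 & r.1]) (p.2 ++ r.2)).
Proof.
elim: u F => [|c u ih] F; first by rewrite ev_dsh_nil ev_cobar0 big_ord0.
rewrite big_ord_recl /= ?drop0 ?take0 wdeg0 ksgn0 scale1r ev_dsh_cons.
under eq_ev do rewrite ev_cobar_cons.
rewrite evD evZ (ih (fun a b => F (c :: a) b)) -addrA; congr (_ + _).
  rewrite ev_swap; apply: eq_ev => z; rewrite ev_dsh_nil /=.
  by apply: eq_ev => y; rewrite wdeg0 mul0r scale1r.
transitivity (ksgn K (ldeg c) *: \sum_(k < size u) (ksgn K (wdeg (take k u)) *: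
   \S_(z <- sp (nth [::] u k))
    \S_(p <- dsh_l (take k u)) \S_(r <- dsh_l (drop k.+1 u))
      (ksgn K (wdeg p.2 * (ldeg z.1 + ldeg z.2 + wdeg r.1)) *:
       F (c :: p.1 ++ [:: z.1, z.2 & r.1]) (p.2 ++ r.2))) +
  ksgn K (ldeg c) *: \S_(y <- dsh_l u) \S_(a <- cobar y.1) 
    (ksgn K (ldeg c * wdeg a) *: F a (c :: y.2))).
  congr (_ + _); rewrite -evZ; apply: eq_ev => y; rewrite -!evZ; apply: eq_ev_in => a ha.
  by rewrite (cobar_deg ha); kcongr.
rewrite (ih (fun a b => ksgn K (ldeg c * wdeg a) *: F a (c :: b))) -scalerDr -big_split.
rewrite scaler_sumr; apply: eq_bigr => k _ /=.
rewrite -scalerDr scale_ksgnD wdeg_cons; congr (_ *: _); rewrite -evD.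
apply: eq_ev => z; rewrite ev_dsh_cons; congr (_ + _).
apply: eq_ev => y; rewrite -evZ; apply: eq_ev => r; kcongr.
Qed.

Lemma set_nth_mid (T : Type) (e0 e d : T) (s t : seq T) :
  set_nth e0 (s ++ e :: t) (size s) d = s ++ d :: t.
Proof. by elim: s => //= a s ->. Qed.

(** [split_letter] leaves out the splittings with an empty piece and [sp] includes them. Such a
    piece always lands in the left word, where [F] vanishes. *)
Lemma dc_termA_rcons E (F : word g -> word g -> E) u l :
  (forall a b, [::] \in a -> F a b = 0) ->
  dc_termA F (rcons u l) = termA F u l.
Proof.
move=> F0; rewrite /termA (dsh_cobar_sum u (fun a b => F a (rcons b l))) /dc_termA.
rewrite size_rcons /=; apply: eq_bigr => k _.
have ks : size (take k u) = k by rewrite size_takel // ltnW.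
have -> : nth [::] (rcons u l) k = nth [::] u k by rewrite nth_rcons ltn_ord.
have -> : take k (rcons u l) = take k u by rewrite -cats1 takel_cat // ltnW.
set c := nth [::] u k; set s := drop k.+1 u; set t := take k u.
have eu : u = t ++ c :: s by rewrite -drop_nth // cat_take_drop.
have su : (size u).+1 = size ([seq [:: c] | c <- t] ++ [:: [::]] :: rcons [seq [:: c] | c <- s] [:: l]).
  by rewrite eu !size_cat /= size_rcons !size_map !addnS.
rewrite -scaler_sumr; congr (_ *: _).
pose H i a b := unshuff (@wdeg K g) (Some (size t)) (Some (size u)) i
  (fun U V => F (flatten U) (flatten V))
  ([seq [:: c] | c <- t] ++ [:: a; b] :: rcons [seq [:: c] | c <- s] [:: l]).
have H0 i a b : [::] \in [:: a; b] -> H i a b = 0.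
  move=> ab; rewrite /H unshuff_cond_bsum; set w := _ ++ _.
  rewrite -[RHS](bsum0 E (size w)).
  apply: eq_bsum => m sm; case: ifP => // /andP[_ /andP[hm _]].
  rewrite F0 ?scaler0 //; apply/flattenP; exists [:: a; b] => //.
  rewrite mask_mid; last by rewrite sm size_cat.
  by rewrite size_map hm !mem_cat mem_head orbT.
transitivity (\sum_(1 <= i < (size u).+1) \S_(z <- sp c) H i z.1 z.2).
  apply: eq_bigr => i _; rewrite -split_letterE; last 2 first.
  - by move=> b; apply: H0; rewrite mem_head.
  - by move=> a; apply: H0; rewrite !inE eqxx orbT.
  apply: eq_split_letter => a b; rewrite /H -[X in Some X]ks -/t; congr unshuff.
  rewrite [in rcons u l]eu rcons_cat rcons_cons map_cat /= map_rcons.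
  by rewrite -[X in set_nth _ _ X _]ks -/t -(size_map (cons^~ [::]) t) set_nth_mid.
rewrite -ev_sum; apply: eq_ev => z; rewrite /H.
have := sum_unshuff_block F t s [:: z.1; z.2] l; cbv zeta.
have -> : size ([seq [:: c0] | c0 <- t] ++ [:: z.1; z.2] :: rcons [seq [:: c0] | c0 <- s] [:: l])
  = (size u).+1 by rewrite su !size_cat.
move=> /= ->; apply: eq_ev => a; apply: eq_ev => b.
by rewrite !wdeg_cons wdeg0 addr0 !addrA rcons_cat.
Qed.

Definition bar_tens u v : tensor (bar g) (bar g) := tens (barword u) (barword v).

Lemma barword_nil w : [::] \in w -> barword w = 0 :> bar g.
Proof.
case/splitPr=> u v; have := barword_letter u v.
by case/letter_killsP.
Qed.

Lemma bar_tens_nil_l u v : [::] \in u -> bar_tens u v = 0.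
Proof. by move=> h; rewrite /bar_tens (barword_nil h); exact: (linear0 (tensr _)). Qed.

Lemma bar_tens_nil_r u v : [::] \in v -> bar_tens u v = 0.
Proof. by move=> h; rewrite /bar_tens (barword_nil h); exact: (linear0 (tens _)). Qed.

Lemma barword_nil0 : barword [::] = 0 :> bar g.
Proof. by case: ((bar_killsP (@barword K g)).1 (@barword_kills K g)). Qed.

Lemma bar_tens0_l v : bar_tens [::] v = 0.
Proof. by rewrite /bar_tens barword_nil0; exact: (linear0 (tensr _)). Qed.

Lemma dz_word_rcons u c : dz_word (rcons u c) = termZ bar_tens u c.
Proof.
rewrite /dz_word size_rcons /=.
exact: (sum_unshuff_last (@ldeg K g) (F := bar_tens) u c bar_tens0_l).
Qed.

Definition flip_ksgn (E : lmodType K) (F : word g -> word g -> E) u v : E :=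
  ksgn K (wdeg u * wdeg v) *: F v u.

Lemma dc_termB_rcons u c : dc_termB (rcons u c) = termB bar_tens u c.
Proof.
rewrite /dc_termB size_rcons /= last_rcons -cats1 take_size_cat //.
rewrite -scaler_sumr.
rewrite (sum_unshuff_all (@ldeg K g) (fun a b => split_letter (fun (x y : letter g) =>
  ksgn K (wdeg b * ldeg x) *: bar_tens (rcons a x) (rcons b y)) c)).
rewrite -evZ; apply: eq_ev_in => y /dsh_wdeg e; rewrite split_letterE.
- by rewrite -evZ; apply: eq_ev => x; kcongr_with e.
- by move=> b; rewrite bar_tens_nil_l ?scaler0 // mem_rcons mem_head.
by move=> a; rewrite bar_tens_nil_r ?scaler0 // mem_rcons mem_head.
Qed.

Definition dc_last (E : lmodType K) (F : word g -> word g -> E) u c : E :=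
  termA F u c - termA (flip_ksgn F) u c + termB F u c.

Lemma dc_word_rcons u c : dc_word (rcons u c) = dc_last bar_tens u c.
Proof.
rewrite /dc_word dc_termB_rcons dc_termA_rcons; last exact: bar_tens_nil_l.
rewrite (dc_termA_rcons (F := flip_ksgn bar_tens)) // => a b h.
by rewrite /flip_ksgn bar_tens_nil_r ?scaler0.
Qed.
End BlockMasks.

(** * Coderivations of the bar coalgebra *)

(* Maps of letters and words which are compatible with the relations of bar,
   except possibly with the vanishing of the empty letter. *)
Section Symmetric.
Variables (K : fieldType) (g : gradedSpace K).
Implicit Types (E : lmodType K) (c : letter g) (u v w : word g).
Local Notation dsh_e := (dsh (@sdeg K g)).
Local Notation dsh_l := (dsh (@ldeg K g)).

Lemma killsD (X : choiceType) E (rel : {freeg X / K} -> Prop) (phi psi : X -> E) :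
  kills phi rel -> kills psi rel -> kills (fun x => phi x + psi x) rel.
Proof.
move=> h h' r hr; transitivity (fglift phi r + fglift psi r).
  by rewrite !fgliftE -big_split; apply: eq_bigr => x _; rewrite scalerDr.
by rewrite h // h' // addr0.
Qed.

Definition letter_sym E (H : letter g -> E) :=
  (forall c c', kills (fun p => H (c ++ p :: c')) (@entry_rel K g)) /\
  (forall c p q c', H (c ++ p :: q :: c') =
     ksgn K (sdeg p * sdeg q) *: H (c ++ q :: p :: c')).

Definition word_sym E (G : word g -> E) := forall u v, letter_sym (fun c => G (u ++ c :: v)).

Lemma eq_letter_sym E (H H' : letter g -> E) : H =1 H' -> letter_sym H -> letter_sym H'.
Proof.
move=> e [h1 h2]; split=> [c c'|c p q c']; last by rewrite -!e h2.
by apply: eq_kills (h1 c c') => p; rewrite e.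
Qed.

Lemma letter_symD E (H H' : letter g -> E) :
  letter_sym H -> letter_sym H' -> letter_sym (fun c => H c + H' c).
Proof.
move=> [h1 h2] [h1' h2']; split=> [c c'|c p q c']; last by rewrite h2 h2' scalerDr.
exact: killsD.
Qed.

Lemma letter_sym_ev E (X : eqType) (s : seq (int * X)) (H : X -> letter g -> E) :
  (forall x, letter_sym (H x)) -> letter_sym (fun c => \S_(x <- s) H x c).
Proof.
move=> h; split=> [c c'|c p q c'].
  by apply: kills_sum => t _; apply: kills_scale; case: (h t.2).
by rewrite -evZ; apply: eq_ev => x; case: (h x).
Qed.

Lemma letter_sym_deg E (H : letter g -> E) (h : int -> K) (f : letter g -> int) :
  (forall c c', cdeg c = cdeg c' -> f c = f c') ->
  letter_sym H -> letter_sym (fun c => h (f c) *: H c).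
Proof.
move=> hf [h1 h2]; split=> [c c'|c p q c'].
  apply: eq_kills (entry_deg_kills
    (fun d => h (f [:: (cdeg c + (d + cdeg c') - 1, 0)])) (h1 c c')) => p.
  by congr (h _ *: _); apply: hf; rewrite cdeg_cat !cdeg_cons cdeg0 /sdeg /= subrK addr0.
rewrite h2 !scalerA mulrC; congr (_ * h _ *: _); apply: hf.
by rewrite !cdeg_cat !cdeg_cons; congr (_ + _); rewrite addrCA.
Qed.

Lemma letter_symZ E (H : letter g -> E) a : letter_sym H -> letter_sym (fun c => a *: H c).
Proof. exact: (@letter_sym_deg E H (fun=> a) (fun=> 0)). Qed.

(** Two exchanged neighbours either stay in the same piece, where the symmetry of [F] applies, or
    are separated, and then the Koszul sign of the unshuffle accounts for the exchange. *)
Lemma letter_sym_dsh E (F : letter g -> letter g -> E) :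
  (forall b, letter_sym (F^~ b)) -> (forall a, letter_sym (F a)) ->
  letter_sym (fun c => \S_(x <- dsh_e c) F x.1 x.2).
Proof.
move=> hl hr; split=> [c c'|c p q c'].
  apply: (@eq_kills _ _ _ _ (fun p => \S_(x <- dsh_e c) (
     \S_(y <- dsh_e c') (ksgn K (cdeg x.2 * (sdeg p + cdeg y.1)) *:
       F (x.1 ++ p :: y.1) (x.2 ++ y.2)) +
     \S_(y <- dsh_e c') (ksgn K (sdeg p * cdeg y.1 + cdeg x.2 * cdeg y.1) *:
       F (x.1 ++ y.1) (x.2 ++ p :: y.2))))).
    move=> p; rewrite ev_dsh_cat; apply: eq_ev => x; rewrite ev_dsh_cons.
    congr (_ + _); apply: eq_ev => y /=; first by degs.
    by rewrite scale_ksgnD.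
  apply: kills_sum => x _; apply: kills_scale; apply: killsD.
    apply: kills_sum => y _; apply: kills_scale.
    have [h _] := hl (x.2.2 ++ y.2.2).
    exact: (entry_deg_kills (fun d => ksgn K (cdeg x.2.2 * (d + cdeg y.2.1))) (h _ _)).
  apply: kills_sum => y _; apply: kills_scale.
  have [h _] := hr (x.2.1 ++ y.2.1).
  exact: (entry_deg_kills
    (fun d => ksgn K (d * cdeg y.2.1 + cdeg x.2.2 * cdeg y.2.1)) (h _ _)).
rewrite !ev_dsh_cat -evZ; apply: eq_ev => x; rewrite !ev_dsh_cons -!evD.
rewrite -evZ; apply: eq_ev => y /=.
rewrite !scalerDr !addrA [RHS](ACl (1*3*2*4))/=.
have [_ sl] := hl (x.2 ++ y.2); have [_ sr] := hr (x.1 ++ y.1).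
rewrite sl (sr x.2 p q); congr (_ + _ + _ + _); kcongr.
Qed.

Lemma word_sym_deg E (G : word g -> E) (h : int -> K) (f : word g -> int) :
  (forall u v, wdeg u = wdeg v -> f u = f v) ->
  word_sym G -> word_sym (fun w => h (f w) *: G w).
Proof.
move=> hf hG u v; apply: (@letter_sym_deg _ _ h (fun c => f (u ++ c :: v))); last exact: hG.
by move=> c c' e; apply: hf; rewrite !wdeg_cat !wdeg_cons !ldegE e.
Qed.

Lemma word_sym_ev E (X : eqType) (s : seq (int * X)) (G : X -> word g -> E) :
  (forall x, word_sym (G x)) -> word_sym (fun w => \S_(x <- s) G x w).
Proof. by move=> h u v; apply: letter_sym_ev => x; apply: h. Qed.

Lemma word_sym_shift E (G : word g -> E) u v :
  word_sym G -> word_sym (fun w => G (u ++ w ++ v)).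
Proof.
move=> h a b; apply: eq_letter_sym (h (u ++ a) (b ++ v)) => c.
by rewrite -!catA.
Qed.

Lemma word_sym_rcons E (G : word g -> E) c : word_sym G -> word_sym (fun w => G (rcons w c)).
Proof.
move=> h a b; apply: eq_letter_sym (word_sym_shift [::] [:: c] h a b) => d.
by rewrite /= cats1.
Qed.

Lemma word_sym_dsh E (F : word g -> word g -> E) :
  (forall b, word_sym (F^~ b)) -> (forall a, word_sym (F a)) ->
  word_sym (fun w => \S_(x <- dsh_l w) F x.1 x.2).
Proof.
move=> hl hr u v.
apply: (@eq_letter_sym _ (fun c => \S_(x <- dsh_l u) (
     \S_(y <- dsh_l v) (ksgn K (wdeg x.2 * (ldeg c + wdeg y.1)) *:
       F (x.1 ++ c :: y.1) (x.2 ++ y.2)) +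
     \S_(y <- dsh_l v) (ksgn K (ldeg c * wdeg y.1 + wdeg x.2 * wdeg y.1) *:
       F (x.1 ++ y.1) (x.2 ++ c :: y.2))))).
  move=> c; rewrite ev_dsh_cat; apply: eq_ev => x; rewrite ev_dsh_cons.
  congr (_ + _); apply: eq_ev => y /=; first by degs.
  by rewrite scale_ksgnD.
apply: letter_sym_ev => x; apply: letter_symD; apply: letter_sym_ev => y.
  apply: (@letter_sym_deg _ _ (ksgn K) (fun c => wdeg x.2 * (ldeg c + wdeg y.1))).
    by move=> c c'; rewrite !ldegE => ->.
  exact: (hl (x.2 ++ y.2)).
apply: (@letter_sym_deg _ _ (ksgn K) (fun c => ldeg c * wdeg y.1 + wdeg x.2 * wdeg y.1)).
  by move=> c c'; rewrite !ldegE => ->.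
exact: (hr (x.1 ++ y.1)).
Qed.

Lemma word_sym_cobar E (G : word g -> E) :
  word_sym G -> word_sym (fun w => ev (cobar w) G).
Proof.
move=> hG u v.
apply: (@eq_letter_sym _ (fun c => \S_(x <- cobar u) G (x ++ c :: v) +
  ksgn K (wdeg u) *: (\S_(x <- sp c) G (u ++ [:: x.1, x.2 & v]) +
  ksgn K (ldeg c) *: \S_(x <- cobar v) G (u ++ c :: x)))).
  by move=> c; rewrite ev_cobar_cat ev_cobar_cons.
apply: letter_symD; first by apply: letter_sym_ev => x; apply: hG.
apply: letter_symZ; apply: letter_symD.
  apply: (@eq_letter_sym _ (fun c => \S_(x <- dsh_e c)
      (ksgn K (cdeg x.1) *: G (u ++ [:: x.1, x.2 & v])))).
    by move=> c; rewrite ev_sp.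
  apply: (letter_sym_dsh (F := fun a b => ksgn K (cdeg a) *: G (u ++ [:: a, b & v]))) => [b|a].
    by apply: (@letter_sym_deg _ _ (ksgn K) (@cdeg K g)) => //; apply: hG.
  apply: letter_symZ; apply: eq_letter_sym (hG (rcons u a) v) => b.
  by rewrite cat_rcons.
apply: (@letter_sym_deg _ _ (ksgn K) (@ldeg K g)) => [c c'|].
  by rewrite !ldegE => ->.
by apply: letter_sym_ev => x; apply: hG.
Qed.

Section Coder.
Variables (p : int) (psi : word g -> entry g).
(** An [entry] is a raw pair of a degree and a vector, so [psi] cannot be linear by itself; it is
    linear and symmetric only when followed by a functional that respects the relations between
    entries. *)
Hypothesis psi_sym : forall E (G : entry g -> E), kills G (@entry_rel K g) ->
  word_sym (fun w => G (psi w)).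

Lemma cogen_sym_r E u (G : letter g -> E) :
  letter_sym G -> letter_sym (fun c => ev (cogen psi u c) G).
Proof.
move=> hG; have hpsi c : kills (fun q => G (q :: c)) (@entry_rel K g) by exact: (hG.1 [::] c).
apply: eq_letter_sym (fun c => esym (ev_cogen psi u c G)) _; apply: letter_symD.
  apply: (letter_sym_dsh (F := fun a b => G (psi (rcons u a) :: b))) => [b|a].
    apply: eq_letter_sym (psi_sym (hpsi b) u [::]) => a.
    by rewrite cats1.
  by split=> [c c'|c q q' c']; [apply: (hG.1 (_ :: c)) | apply: (hG.2 (_ :: c))].
apply: letter_symZ; apply: letter_sym_ev => x.
by split=> [c c'|c q q' c']; [apply: (hG.1 (_ :: c)) | apply: (hG.2 (_ :: c))].
Qed.

Lemma cogen_sym_l E c (G : letter g -> E) :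
  letter_sym G -> word_sym (fun u => ev (cogen psi u c) G).
Proof.
move=> hG; have hpsi c' : kills (fun q => G (q :: c')) (@entry_rel K g) by exact: (hG.1 [::] c').
move=> u v; apply: eq_letter_sym (fun c' => esym (ev_cogen psi _ c G)) _.
apply: letter_symD.
  apply: letter_sym_ev => x.
  exact: (word_sym_rcons x.1 (psi_sym (hpsi x.2))).
apply: (@word_sym_deg E (fun w => \S_(x <- cobar w) G (psi x :: c)) (ksgn K)
  (@wdeg K g) _ _ u v) => //.
by apply: word_sym_cobar; exact: (psi_sym (hpsi c)).
Qed.

(** Induction on the letters that follow the varied letter: when there is none it enters [cogen] as
    its last argument, otherwise through the word before the last letter. *)
Lemma coder_sym E (G : word g -> E) :
  word_sym G -> word_sym (fun w => ev (coder p psi w) G).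
Proof.
move=> + u v; elim/last_ind: v G => [|v d ih] G hG.
  apply: (@eq_letter_sym _ (fun c => ev (coder p psi (rcons u c)) G)) => [c|].
    by rewrite cats1.
  apply: eq_letter_sym (fun c => esym (ev_coder_rcons p psi u c G)) _.
  apply: letter_symD.
    apply: letter_sym_ev => x; apply: eq_letter_sym (hG x [::]) => c.
    by rewrite cats1.
  apply: letter_sym_ev => y; apply: letter_symZ; apply: cogen_sym_r.
  by apply: eq_letter_sym (hG y.1 [::]) => c; rewrite cats1.
apply: (@eq_letter_sym _ (fun c => ev (coder p psi (rcons (u ++ c :: v) d)) G)) => [c|].
  by rewrite rcons_cat.
apply: eq_letter_sym (fun c => esym (ev_coder_rcons p psi _ d G)) _.
apply: letter_symD; first exact: (ih (fun w => G (rcons w d)) (word_sym_rcons d hG)).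
apply: (@word_sym_dsh E (fun a b =>
  ksgn K (p * wdeg a) *: \S_(l <- cogen psi b d) G (rcons a l)) _ _ u v) => [b|a].
  apply: (@word_sym_deg _ _ (ksgn K) (fun a => p * wdeg a)) => [w w' ->//|].
  by apply: word_sym_ev => l; apply: word_sym_rcons.
have := cogen_sym_l d (G := fun l => G (rcons a l)).
move=> h w w'; apply: letter_symZ; apply: h.
by apply: eq_letter_sym (hG a [::]) => c; rewrite cats1.
Qed.

End Coder.
End Symmetric.

Section BarLinear.
Variables (K : fieldType) (g : gradedSpace K).
Implicit Types (E : lmodType K) (c : letter g) (u v w : word g).

Lemma presented_span (X : choiceType) (rel : {freeg X / K} -> Prop) (x : presented rel) :
  exists s : seq (K * X), x = \sum_(t <- s) t.1 *: gen rel t.2.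
Proof.
pose r : {freeg X / K} := repr x; exists [seq (coeff y r, y) | y <- dom r].
have -> : x = \pi_(presented rel)%qT r by rewrite reprK.
by rewrite pi_genE fgliftE [RHS]big_map.
Qed.

Lemma presented_ext (X : choiceType) (rel : {freeg X / K} -> Prop) E
    (f1 f2 : presented rel -> E) : linear f1 -> linear f2 ->
  (forall x, f1 (gen rel x) = f2 (gen rel x)) -> f1 =1 f2.
Proof.
move=> h1 h2 h x; have [s ->] := presented_span x.
have lin0 (f : presented rel -> E) : linear f -> f 0 = 0.
  by move=> hf; have := hf (-1) 0 0; rewrite scaleN1r addNr scaleN1r addNr.
elim: s => [|t s ih]; first by rewrite big_nil !lin0.
by rewrite big_cons h1 h2 ih h.
Qed.

Lemma bar_span (x : bar g) : exists s : seq (K * word g),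
  x = \sum_(t <- s) t.1 *: barword t.2.
Proof. exact: presented_span. Qed.

Lemma bar_ext E (f1 f2 : bar g -> E) : linear f1 -> linear f2 ->
  (forall w, f1 (barword w) = f2 (barword w)) -> f1 =1 f2.
Proof. exact: presented_ext. Qed.

Lemma tensor_ext (V W : lmodType K) E (f1 f2 : tensor V W -> E) : linear f1 -> linear f2 ->
  (forall x y, f1 (tens x y) = f2 (tens x y)) -> f1 =1 f2.
Proof. by move=> h1 h2 h; apply: presented_ext => // -[x y]; apply: h. Qed.

Lemma tens_mapE (V W V' W' : lmodType K) (f : {linear V -> V'}) (h : {linear W -> W'}) x y :
  tens_map f h (tens x y) = tens (f x) (h y).
Proof. exact: plift_gen. Qed.

Lemma Delta_zE w : Delta_z g (barword w) = dz_word w.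
Proof. exact: plift_gen. Qed.

Lemma Delta_cE w : Delta_c g (barword w) = dc_word w.
Proof. exact: plift_gen. Qed.

Lemma koszul_opE p w : koszul_op g p (barword w) = ksgn K (p * wdeg w) *: barword w.
Proof. exact: plift_gen. Qed.

Lemma tens_coder_linear p (f : {linear bar g -> bar g}) : linear (tens_coder p f).
Proof. by move=> a x y; rewrite /tens_coder !linearP scalerDr addrACA. Qed.

Lemma tens_coderE p (f : {linear bar g -> bar g}) u v :
  tens_coder p f (bar_tens u v) = tens (f (barword u)) (barword v) +
    ksgn K (p * wdeg u) *: tens (barword u) (f (barword v)).
Proof.
rewrite /tens_coder !tens_mapE koszul_opE; congr (_ + _).
by rewrite -[LHS]/(tensr _ _) linearZ.
Qed.

Lemma bar_hom0 n : bar_hom n (0 : bar g).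
Proof. by exists [::]; rewrite ?big_nil. Qed.

Lemma bar_hom_word w : bar_hom (wdeg w) (barword w).
Proof.
exists [:: (1, w)]; last by rewrite big_seq1 scale1r.
by move=> t; rewrite inE => /eqP ->.
Qed.

Lemma bar_homP n a x y : bar_hom n x -> bar_hom n y -> bar_hom n (a *: x + y : bar g).
Proof.
case=> s hs -> [s' hs' ->]; exists ([seq (a * t.1, t.2) | t <- s] ++ s').
  by move=> t; rewrite mem_cat => /orP[/mapP[t' /hs h ->]|/hs'].
rewrite big_cat big_map scaler_sumr; congr (_ + _).
by apply: eq_bigr => t _; rewrite scalerA.
Qed.

Lemma bar_hom_ev n (X : eqType) (s : seq (int * X)) (F : X -> bar g) :
  {in supp s, forall x, bar_hom n (F x)} -> bar_hom n (ev s F).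
Proof.
rewrite /ev; elim: s => [|t s ih] h; first by rewrite big_nil; exact: bar_hom0.
rewrite big_cons; apply: bar_homP; first by apply: h; rewrite mem_head.
by apply: ih => x hx; apply: h; rewrite inE hx orbT.
Qed.

Lemma kills_entry0 E (G : entry g -> E) i : kills G (@entry_rel K g) -> G (i, 0) = 0.
Proof.
move=> h; have := h _ (entry_lin 1 (ghom0 g i) (ghom0 g i)).
rewrite !fgliftB fgliftZ !fglift1 !scale1r addr0 subrr sub0r => /eqP.
by rewrite oppr_eq0 => /eqP.
Qed.

Lemma barword_sym : word_sym (@barword K g).
Proof.
move=> u v; have [_ h1 h2] := (letter_killsP _).1 (barword_letter u v).
by split.
Qed.

End BarLinear.

Section CoderMap.
Variables (K : fieldType) (g : gradedSpace K) (p : int) (psi : word g -> entry g).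
Hypothesis psi_deg : forall w, (psi w).1 = wdeg w + p - 2.
Hypothesis psi_nil : forall w, [::] \in w -> (psi w).2 = 0.
Hypothesis psi_sym : forall (E : lmodType K) (G : entry g -> E),
  kills G (@entry_rel K g) -> word_sym (fun w => G (psi w)).
Implicit Types (E : lmodType K) (c : letter g) (u v w : word g).
Local Notation dsh_e := (dsh (@sdeg K g)).
Local Notation dsh_l := (dsh (@ldeg K g)).
Local Notation coder := (coder p psi).

(** The case distinction is forced: for a word [rcons u [::]], which is zero in [bar], the
    correction term of [cogen] gives letters [[:: psi x]] with x in [cobar u], and these need not
    vanish. *)
Definition coder_word w : bar g := if [::] \in w then 0 else ev (coder w) (@barword K g).

Lemma coder_word_kills : kills coder_word (@bar_rel K g).
Proof.
apply/bar_killsP; split=> [|u v]; first by rewrite /coder_word in_nil ev_coder0.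
have [h1 h2] := @coder_sym K g p psi psi_sym _ _ (barword_sym (g := g)) u v.
have inE' c : ([::] \in u ++ c :: v) = ([::] \in u) || (c == [::]) || ([::] \in v).
  by rewrite mem_cat inE eq_sym orbA.
apply/letter_killsP; split=> [|c c'|c q q' c'].
- by rewrite /coder_word inE' orbT.
- have e0 q : (c ++ q :: c' == [::]) = false by case: c.
  pose b := ([::] \in u) || ([::] \in v).
  apply: (@eq_kills _ _ _ _ (fun q => if b then 0 else
     ev (coder (u ++ (c ++ q :: c') :: v)) (@barword K g))).
    by move=> q; rewrite /coder_word inE' e0 orbF.
  by case: b; [exact: kills_cst0 | exact: h1].
have e0 q0 d : (c ++ q0 :: d == [::]) = false by case: c.
rewrite /coder_word !inE' !e0 !orbF; case: ifP => _; first by rewrite scaler0.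
exact: h2.
Qed.

Definition coder_map : {linear bar g -> bar g} := plift coder_word_kills.

Lemma coder_mapE w : coder_map (barword w) = coder_word w.
Proof. exact: plift_gen. Qed.

Lemma coder_map_hom w : bar_hom (wdeg w + p) (coder_map (barword w)).
Proof.
rewrite coder_mapE /coder_word; case: ifP => _; first exact: bar_hom0.
apply: bar_hom_ev => x hx; rewrite -(coder_deg psi_deg hx); exact: bar_hom_word.
Qed.

Lemma coder2_word u v : [::] \notin u -> [::] \notin v ->
  tens_coder p coder_map (bar_tens u v) = coder2 p psi (@bar_tens K g) u v.
Proof.
move=> hu hv; rewrite tens_coderE !coder_mapE /coder_word !ifN //.
congr (_ + _ *: _); first exact: (ev_linear (tensr (barword v))).
exact: (ev_linear (tens (barword u))).
Qed.

Lemma coder_map_z x : tens_coder p coder_map (Delta_z g x) = Delta_z g (coder_map x).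
Proof.
move: x; apply: bar_ext => [a x y|a x y|w]; first by rewrite !linearP tens_coder_linear.
  by rewrite !linearP.
have T0 : tens_coder p coder_map 0 = 0 by rewrite /tens_coder !linear0 addr0.
have [hw|hw] := boolP ([::] \in w).
  by rewrite barword_nil // !linear0.
case/lastP: w hw => [|u c] hw; first by rewrite barword_nil0 !linear0.
rewrite coder_mapE Delta_zE /coder_word ifN //.
rewrite dz_word_rcons ev_linear ev_coder_rcons.
transitivity (last_ev p psi (termZ (@bar_tens K g)) u c); last first.
  congr (_ + _); apply: eq_ev => y; first by rewrite Delta_zE dz_word_rcons.
  by congr (_ *: _); apply: eq_ev => l; rewrite Delta_zE dz_word_rcons.
rewrite termZ_coder // /termZ (ev_lin _ _ (tens_coder_linear p coder_map)).
apply: eq_ev_in => y /dsh_mem e; move: hw; rewrite mem_rcons inE e !negb_or.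
case/andP=> hc /andP[h1 h2]; rewrite coder2_word // mem_rcons inE negb_or hc.
exact: h2.
Qed.

(* q creates empty letters, on which coder is not the coderivation: the
   contributions of the words with an empty letter are shown to cancel. *)
Section EmptyLetter.
Variable E : lmodType K.

(** The second condition reflects that [psi w] has value zero when [w] has an empty letter, so that
    a letter which begins with it is zero in [bar]. *)
Definition nil_free (G : word g -> E) :=
  (forall w, [::] \in w -> G w = 0) /\
  (forall u w c v, [::] \in w -> G (u ++ (psi w :: c) :: v) = 0).

Lemma nil_free_rcons G c : nil_free G -> nil_free (fun w => G (rcons w c)).
Proof.
move=> [h1 h2]; split=> [w hw|u w d v hw]; first by rewrite h1 // mem_rcons inE hw orbT.
by rewrite rcons_cat h2.
Qed.

Lemma coder_rcons_nil G u c : nil_free G -> [::] \in u ->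
  ev (coder (rcons u c)) G = \S_(x <- coder u) G (rcons x c).
Proof.
move=> [h1 h2] hu; rewrite ev_coder_rcons [X in _ + X]ev_in0 ?addr0 // => y hy.
move: hu; rewrite (dsh_mem [::] hy) => /orP[hy1|hy2].
  by rewrite ev_in0 ?scaler0 // => l _; rewrite h1 // mem_rcons inE hy1 orbT.
have e1 : \S_(x <- dsh_e c) G (rcons y.1 (psi (rcons y.2 x.1) :: x.2)) = 0.
  by apply: ev_in0 => x _; rewrite -cats1 h2 // mem_rcons inE hy2 orbT.
have e2 : \S_(x <- cobar y.2) G (rcons y.1 (psi x :: c)) = 0.
  by apply: ev_in0 => x hx; rewrite -cats1 h2 //; apply: cobar_nil hx hy2.
by rewrite ev_cogen e1 e2 scaler0 addr0 scaler0.
Qed.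

Lemma sp_nil c (H : letter g -> letter g -> E) : c != [::] ->
  \S_(x <- sp c) (if (x.1 == [::]) || (x.2 == [::]) then H x.1 x.2 else 0) =
  H [::] c + ksgn K (cdeg c) *: H c [::].
Proof.
move=> hc; rewrite ev_sp.
transitivity (\S_(x <- dsh_e c) (if x.1 == [::] then H [::] x.2 else 0) +
  \S_(x <- dsh_e c) (if x.2 == [::] then ksgn K (cdeg x.1) *: H x.1 [::] else 0)); last first.
  rewrite (ev_dsh_nil_l (@sdeg K g) c (H [::])).
  by rewrite (ev_dsh_nil_r (@sdeg K g) c (fun a => ksgn K (cdeg a) *: H a [::])).
rewrite -evD; apply: eq_ev_in => x /dsh_size sx.
case: eqP => [e1|_] /=; case: eqP => [e2|_]; rewrite ?e1 ?e2 ?cdeg0 ?scale1r ?addr0 //.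
- by move: hc; rewrite -size_eq0 sx e1 e2.
- by rewrite add0r.
by rewrite scaler0.
Qed.

(** Splitting a letter c gives the two terms with an empty letter just before and just after c.
    Along the word these telescope, and only the term with the empty letter at the very end
    survives. *)
Lemma cobar_coder_nil G u : nil_free G -> [::] \notin u ->
  \S_(x <- cobar u) (if [::] \in x then ev (coder x) G else 0) =
  - (ksgn K (wdeg u) *: ev (coder (rcons u [::])) G).
Proof.
elim/last_ind: u G => [|u c ih] G hG.
  rewrite ev_cobar0 ev_coder_rcons ev_coder0 add0r ev_dsh_nil ev_cogen ev_cobar0.
  have /= e := hG.2 [::] [:: [::]] [::] [::] isT.
  by rewrite ev_dsh_nil /= e !scaler0 addr0 !scaler0 oppr0.
rewrite mem_rcons inE negb_or eq_sym => /andP[hc hu].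
have hu0 : ([::] \in u) = false by apply/negbTE.
rewrite ev_cobar_rcons.
under [X in _ + _ *: X]eq_ev => x do rewrite !mem_rcons !inE mem_rcons inE hu0 orbF
  ![[::] == _]eq_sym orbC.
rewrite (sp_nil (fun a b => ev (coder (rcons (rcons u a) b)) G) hc).
rewrite (@coder_rcons_nil G (rcons u [::])) // ?mem_rcons ?mem_head //.
have -> : \S_(x <- cobar u) (if [::] \in rcons x c then ev (coder (rcons x c)) G else 0) =
    \S_(x <- cobar u) (if [::] \in x then \S_(y <- coder x) G (rcons y c) else 0).
  apply: eq_ev => x; rewrite mem_rcons inE eq_sym (negbTE hc) /=; case: ifP => // hx.
  exact: coder_rcons_nil.
rewrite (ih _ (nil_free_rcons c hG) hu) scalerDr addrA addNr add0r.
by rewrite scale_ksgnN; kcongr.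
Qed.

End EmptyLetter.

Lemma termAD E (F G : word g -> word g -> E) u c :
  termA (fun a b => F a b + G a b) u c = termA F u c + termA G u c.
Proof. by rewrite /termA -evD; apply: eq_ev => y; rewrite evD. Qed.

Lemma dc_lastD E (F G : word g -> word g -> E) u c :
  dc_last (fun a b => F a b + G a b) u c = dc_last F u c + dc_last G u c.
Proof.
rewrite /dc_last; have -> : termA (flip_ksgn (fun a b => F a b + G a b)) u c =
    termA (flip_ksgn F) u c + termA (flip_ksgn G) u c.
  rewrite -termAD; apply: eq_ev => y; apply: eq_ev => a.
  by rewrite /flip_ksgn scalerDr.
have -> : termB (fun a b => F a b + G a b) u c = termB F u c + termB G u c.
  rewrite -evD; apply: eq_ev => y; rewrite -evD; apply: eq_ev => x.
  by rewrite scalerDr.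
by rewrite termAD opprD !addrA [LHS](ACl (1*3*5*2*4*6))/=.
Qed.

Lemma dc_last_lin E E' (T : E -> E') (F : word g -> word g -> E) u c : linear T ->
  T (dc_last F u c) = dc_last (fun a b => T (F a b)) u c.
Proof.
move=> h; have hD x y : T (x + y) = T x + T y by have := h 1 x y; rewrite !scale1r.
have hB x y : T (x - y) = T x - T y by rewrite addrC -scaleN1r h scaleN1r addrC.
have T0 : T 0 = 0 by rewrite -(subrr 0) hB subrr.
have hZ a x : T (a *: x) = a *: T x by rewrite -[a *: x]addr0 h T0 addr0.
rewrite /dc_last hD hB; congr (_ - _ + _); rewrite ev_lin //; apply: eq_ev => y;
  rewrite ev_lin //; apply: eq_ev => a; by rewrite ?/flip_ksgn ?hZ.
Qed.

Lemma eq_dc_last E (F G : word g -> word g -> E) u c :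
  (forall a b, F a b = G a b) -> dc_last F u c = dc_last G u c.
Proof. by move=> e; congr dc_last; apply/funext => a; apply/funext => b. Qed.

(** The excess of [coder2] over the action of [coder_map] on the tensor square, when the left word
    has an empty letter; [coder2_nil_r] is the one for the right word. *)
Definition coder2_nil_l u v : tensor (bar g) (bar g) :=
  if [::] \in u then \S_(a <- coder u) bar_tens a v else 0.

Definition coder2_nil_r u v : tensor (bar g) (bar g) :=
  if [::] \in v then ksgn K (p * wdeg u) *: \S_(b <- coder v) bar_tens u b else 0.

Lemma psi_kills E (G : word g -> E) : word_sym G -> (forall w, [::] \in w -> G w = 0) ->
  nil_free G.
Proof.
move=> h1 h2; split=> // u w c v hw; rewrite [psi w]surjective_pairing psi_nil //.
exact: (kills_entry0 (psi w).1 ((h1 u v).1 [::] c)).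
Qed.

Lemma bar_tens_sym_l v : word_sym (fun u => bar_tens u v).
Proof.
move=> a b; have [h1 h2] := @barword_sym K g a b; split=> [c c'|c q q' c'].
  exact: (kills_linear (tensr (barword v)) (h1 c c')).
by rewrite /bar_tens h2 -[LHS]/(tensr _ _) linearZ.
Qed.

Lemma bar_tens_sym_r u : word_sym (bar_tens u).
Proof.
move=> a b; have [h1 h2] := @barword_sym K g a b; split=> [c c'|c q q' c'].
  exact: (kills_linear (tens (barword u)) (h1 c c')).
by rewrite /bar_tens h2 linearZ.
Qed.

(** By [cobar_coder_nil] the error in the term A is carried by words whose last letter is empty. The
    splitting of [c] with an empty left piece in the term B gives the same words with the opposite
    sign. *)
Lemma dc_last_nil_l u c : [::] \notin rcons u c -> dc_last coder2_nil_l u c = 0.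
Proof.
rewrite mem_rcons inE negb_or eq_sym => /andP[hc hu].
have hr y : y \in supp (dsh_l u) -> ([::] \in rcons y.2 c) = false.
  move/dsh_mem => /(_ [::]) e; move: hu; rewrite e negb_or => /andP[_ h].
  by rewrite mem_rcons inE eq_sym (negbTE hc) (negbTE h).
have hl y : y \in supp (dsh_l u) -> ([::] \in y.1) = false.
  move/dsh_mem => /(_ [::]) e; move: hu; rewrite e negb_or => /andP[h _].
  by rewrite (negbTE h).
have -> : dc_last coder2_nil_l u c = termA coder2_nil_l u c + termB coder2_nil_l u c.
  rewrite /dc_last; congr (_ + _); rewrite -[RHS]subr0; congr (_ - _).
  apply: ev_in0 => y hy; apply: ev_in0 => a _.
  by rewrite /flip_ksgn /coder2_nil_l hr // scaler0.
rewrite /termA /termB -evD; apply: ev_in0 => y hy /=.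
have hG : nil_free (fun a => bar_tens a (rcons y.2 c)).
  by apply: psi_kills; [exact: bar_tens_sym_l | move=> w; exact: bar_tens_nil_l].
rewrite /coder2_nil_l (cobar_coder_nil hG) ?hl //.
pose H a b := if a == [::] then
  ksgn K (wdeg y.1 + wdeg y.2 + wdeg y.2 * ldeg a) *:
    (\S_(z <- coder (rcons y.1 a)) bar_tens z (rcons y.2 b)) else 0.
have -> : \S_(x <- sp c) (ksgn K (wdeg y.1 + wdeg y.2 + wdeg y.2 * ldeg x.1) *:
    (if [::] \in rcons y.1 x.1
     then \S_(a <- coder (rcons y.1 x.1)) bar_tens a (rcons y.2 x.2) else 0)) =
    \S_(x <- sp c) (if (x.1 == [::]) || (x.2 == [::]) then H x.1 x.2 else 0).
  apply: eq_ev => x; rewrite /H mem_rcons inE hl // orbF eq_sym.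
  by case: eqP => //= _; rewrite scaler0; case: eqP.
rewrite (sp_nil H hc) /H eqxx (negbTE hc) scaler0 addr0.
by rewrite [X in X + _]scale_ksgnN addrC; apply/eqP; rewrite addr_eq0 scale_ksgnN;
  apply/eqP; kcongr.
Qed.

(** As for the left word, but now the flipped term A cancels against the splitting of [c] with an
    empty right piece. The flip exchanges the two words, which is undone by cocommutativity. *)
Lemma dc_last_nil_r u c : [::] \notin rcons u c -> dc_last coder2_nil_r u c = 0.
Proof.
rewrite mem_rcons inE negb_or eq_sym => /andP[hc hu].
have hr (y : word g * word g) : y \in supp (dsh_l u) -> ([::] \in rcons y.2 c) = false.
  move/dsh_mem => /(_ [::]) e; move: hu; rewrite e negb_or => /andP[_ h].
  by rewrite mem_rcons inE eq_sym (negbTE hc) (negbTE h).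
have hl (y : word g * word g) : y \in supp (dsh_l u) -> ([::] \in y.1) = false.
  move/dsh_mem => /(_ [::]) e; move: hu; rewrite e negb_or => /andP[h _].
  by rewrite (negbTE h).
have hG v : nil_free (bar_tens v).
  by apply: psi_kills; [exact: bar_tens_sym_r | move=> w; exact: bar_tens_nil_r].
pose T a b := ksgn K ((wdeg a + 1 + p) * (wdeg b + ldeg c) + wdeg a + 1) *:
  (\S_(z <- coder (rcons a [::])) bar_tens (rcons b c) z).
have tA : termA coder2_nil_r u c = 0.
  by apply: ev_in0 => y hy; apply: ev_in0 => a _; rewrite /coder2_nil_r hr.
have tF : termA (flip_ksgn coder2_nil_r) u c = \S_(y <- dsh_l u) T y.1 y.2.
  apply: eq_ev_in => y hy.
  transitivity (ksgn K ((wdeg y.1 + 1 + p) * (wdeg y.2 + ldeg c)) *: \S_(a <- cobar y.1)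
      (if [::] \in a then \S_(z <- coder a) bar_tens (rcons y.2 c) z else 0)).
    rewrite -evZ; apply: eq_ev_in => a ha; rewrite /flip_ksgn /coder2_nil_r.
    by case: ifP => _; rewrite ?scaler0 // (cobar_deg ha); kcongr.
  by rewrite (cobar_coder_nil (hG _)) ?hl // scale_ksgnN /T; kcongr.
rewrite /dc_last tA tF sub0r addrC.
rewrite (dsh_cocomm (@ldeg K g) u T); apply/eqP; rewrite subr_eq0; apply/eqP.
apply: eq_ev_in => y hy /=.
pose H a b := if b == [::] then
  ksgn K (wdeg y.1 + wdeg y.2 + wdeg y.2 * ldeg a + p * (wdeg y.1 + ldeg a)) *:
    (\S_(z <- coder (rcons y.2 b)) bar_tens (rcons y.1 a) z) else 0.
transitivity (\S_(x <- sp c) (if (x.1 == [::]) || (x.2 == [::]) then H x.1 x.2 else 0)).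
  have h2 : ([::] \in y.2) = false.
    by move: (hr y hy); rewrite mem_rcons inE => /norP[_ /negbTE].
  apply: eq_ev => x; rewrite /H /coder2_nil_r mem_rcons inE h2 orbF eq_sym orbC.
  case: eqP => //= _; last by rewrite scaler0; case: eqP.
  by kcongr.
rewrite (sp_nil H hc) /H eqxx (negbTE hc) add0r /T; kcongr.
Qed.

Lemma coder2_flip E (F : word g -> word g -> E) :
  flip_ksgn (coder2 p psi F) = coder2 p psi (flip_ksgn F).
Proof.
apply/funext => u; apply/funext => v.
rewrite /flip_ksgn /coder2 scalerDr addrC; congr (_ + _).
  by rewrite -!evZ; apply: eq_ev_in => a ha; rewrite (coder_deg psi_deg ha); kcongr.
by rewrite -!evZ; apply: eq_ev_in => a ha; rewrite (coder_deg psi_deg ha); kcongr.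
Qed.

Lemma last_evD E (T T' : word g -> letter g -> E) u c :
  last_ev p psi (fun a b => T a b + T' a b) u c = last_ev p psi T u c + last_ev p psi T' u c.
Proof.
rewrite /last_ev addrACA -!evD; congr (_ + _).
by apply: eq_ev => y; rewrite evD scalerDr.
Qed.

Lemma last_evN E (T : word g -> letter g -> E) u c :
  last_ev p psi (fun a b => - T a b) u c = - last_ev p psi T u c.
Proof.
rewrite /last_ev opprD -!evN; congr (_ + _).
by apply: eq_ev => y; rewrite evN scalerN.
Qed.

Lemma dc_last_coder E (F : word g -> word g -> E) u c :
  last_ev p psi (dc_last F) u c = ksgn K p *: dc_last (coder2 p psi F) u c.
Proof.
rewrite /dc_last !last_evD last_evN coder2_flip !scalerDr scalerN.
by rewrite !termA_coder // termB_coder.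
Qed.

Lemma coder_map_c x :
  ksgn K p *: tens_coder p coder_map (Delta_c g x) = Delta_c g (coder_map x).
Proof.
move: x; apply: bar_ext => [a x y|a x y|w].
- by rewrite linearP tens_coder_linear scalerDr !scalerA mulrC.
- by rewrite !linearP.
have T0 : tens_coder p coder_map 0 = 0 by rewrite /tens_coder !linear0 addr0.
have [hw|hw] := boolP ([::] \in w).
  by rewrite barword_nil // !linear0 T0 scaler0.
case/lastP: w hw => [|u c] hw; first by rewrite barword_nil0 !linear0 T0 scaler0.
rewrite coder_mapE Delta_cE /coder_word ifN //.
rewrite dc_word_rcons ev_linear ev_coder_rcons.
transitivity (last_ev p psi (dc_last (@bar_tens K g)) u c); last first.
  congr (_ + _); apply: eq_ev => y; first by rewrite Delta_cE dc_word_rcons.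
  by congr (_ *: _); apply: eq_ev => l; rewrite Delta_cE dc_word_rcons.
rewrite dc_last_coder; congr (_ *: _).
pose F1 a b := tens_coder p coder_map (bar_tens a b).
have -> : dc_last (coder2 p psi (@bar_tens K g)) u c = dc_last F1 u c.
  (* The two error terms contribute zero to [dc_last]; adding them completes the action of
     [coder_map] to [coder2]. *)
  rewrite -[RHS]addr0 -(dc_last_nil_l hw) -dc_lastD -[RHS]addr0 -(dc_last_nil_r hw) -dc_lastD.
  apply: eq_dc_last => a b; rewrite /F1 tens_coderE !coder_mapE /coder_word /coder2.
  rewrite /coder2_nil_l /coder2_nil_r [RHS](ACl ((1*3)*(2*4)))/=; congr (_ + _).
    case: ifP => _; last by rewrite addr0; exact/esym/(ev_linear (tensr (barword b))).
    by rewrite [tens 0 _](linear0 (tensr (barword b))) add0r.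
  case: ifP => _; last by rewrite addr0; congr (_ *: _); exact/esym/(ev_linear (tens (barword a))).
  by rewrite (linear0 (tens (barword a))) scaler0 add0r.
exact: (dc_last_lin (@bar_tens K g) u c (tens_coder_linear p coder_map)).
Qed.

Lemma coder_map_coderivation : coderivation p coder_map.
Proof.
by split; [exact: coder_map_hom | exact: coder_map_z | exact: coder_map_c].
Qed.

End CoderMap.

(** * Uniqueness of coderivations *)

Section Weight.
Variables (K : fieldType) (g : gradedSpace K).
Implicit Types (E : lmodType K) (c : letter g) (u v w : word g).
Local Notation dsh_l := (dsh (@ldeg K g)).

Definition weight w : nat := size (flatten w).

Lemma weight_cat u v : weight (u ++ v) = (weight u + weight v)%N.
Proof. by rewrite /weight flatten_cat size_cat. Qed.

Lemma weight_cons c u : weight (c :: u) = (size c + weight u)%N.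
Proof. exact: size_cat. Qed.

Lemma weight_rcons u c : weight (rcons u c) = (weight u + size c)%N.
Proof. by rewrite -cats1 weight_cat weight_cons addn0. Qed.

Lemma dsh_weight w x : x \in supp (dsh_l w) -> weight w = (weight x.1 + weight x.2)%N.
Proof.
move: w x; apply: (@dshP _ _ (fun w a b => weight w = (weight a + weight b)%N)) => //.
by move=> c w a b e; rewrite !weight_cons e addnA; split=> //; rewrite addnCA addnA.
Qed.

Lemma cobar_weight w x : x \in supp (cobar w) -> weight x = weight w.
Proof.
elim: w x => [//|c w ih] x; rewrite supp_cobar_cons mem_cat.
case/orP=> /mapP[y hy ->]; rewrite !weight_cons; last by rewrite (ih _ hy).
by move: hy; rewrite supp_sp => /dsh_size ->; rewrite addnA.
Qed.

Lemma cobar_size w x : x \in supp (cobar w) -> size x = (size w).+1.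
Proof.
elim: w x => [//|c w ih] x; rewrite supp_cobar_cons mem_cat.
by case/orP=> /mapP[y hy ->] //=; rewrite (ih _ hy).
Qed.

Lemma weight_gt0 w : w != [::] -> [::] \notin w -> (0 < weight w)%N.
Proof.
case: w => // c w _; rewrite inE negb_or eq_sym weight_cons => /andP[hc _].
by rewrite addn_gt0 lt0n size_eq0 hc.
Qed.

Lemma eq_dc_last_in E (F G : word g -> word g -> E) u c :
  (forall a b, (weight a + weight b)%N = weight (rcons u c) -> F a b = G a b) ->
  dc_last F u c = dc_last G u c.
Proof.
move=> e; have eA y a : y \in supp (dsh_l u) -> a \in supp (cobar y.1) ->
    (weight a + weight (rcons y.2 c))%N = weight (rcons u c).
  by move=> /dsh_weight hy /cobar_weight ->; rewrite !weight_rcons hy addnA.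
congr (_ - _ + _); apply: eq_ev_in => y hy; apply: eq_ev_in => a ha.
- by rewrite e // eA.
- by rewrite /flip_ksgn e // addnC eA.
rewrite e // !weight_rcons (dsh_weight hy).
by move: ha; rewrite supp_sp => /dsh_size ->; rewrite addnACA.
Qed.

Lemma eq_termZ_in E (F G : word g -> word g -> E) u c :
  (forall a b, (weight a + weight b)%N = weight (rcons u c) -> F a b = G a b) ->
  termZ F u c = termZ G u c.
Proof.
move=> e; apply: eq_ev_in => y hy; rewrite e //.
by rewrite !weight_rcons (dsh_weight hy) addnA.
Qed.

End Weight.

(** * Elements killed by both coproducts *)

Section Primitive.
Variables (K : fieldType) (charK0 : [pchar K] =i pred0) (g : gradedSpace K).
Implicit Types (E : lmodType K) (c : letter g) (u v w : word g).
Local Notation dsh_e := (dsh (@sdeg K g)).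
Local Notation dsh_l := (dsh (@ldeg K g)).

Lemma letter_sym_kills E (H : letter g -> E) :
  letter_sym H -> H [::] = 0 -> kills H (@letter_rel K g).
Proof. by move=> [h1 h2] h0; apply/letter_killsP. Qed.

Lemma word_sym_kills E (G : word g -> E) : word_sym G -> G [::] = 0 ->
  (forall w, [::] \in w -> G w = 0) -> kills G (@bar_rel K g).
Proof.
move=> hs h0 hn; apply/bar_killsP; split=> // u v; apply: letter_sym_kills.
  exact: hs.
by rewrite hn // mem_cat mem_head orbT.
Qed.

Lemma bar_bilinear_lift E (F : word g -> word g -> E) :
  (forall v, kills (F^~ v) (@bar_rel K g)) -> (forall u, kills (F u) (@bar_rel K g)) ->
  exists T : {linear tensor (bar g) (bar g) -> E}, forall u v, T (bar_tens u v) = F u v.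
Proof.
move=> hl hr.
have kr (x : bar g) : kills (fun v => plift (hl v) x) (@bar_rel K g).
  have [s ->] := bar_span x.
  apply: (@eq_kills _ _ _ _ (fun v => \sum_(t <- s) t.1 *: F t.2 v)).
    by move=> v; rewrite linear_sum; apply: eq_bigr => t _; rewrite linearZ /= [in RHS]plift_gen.
  by apply: kills_sum => t _; apply: kills_scale; apply: hr.
have hk : kills (fun xy => plift (kr xy.1) xy.2) (@tens_rel K (bar g) (bar g)).
  move=> _ [a x x' y|a x y y']; rewrite !fgliftB fgliftZ !fglift1 /=; last first.
    by rewrite linearP -addrA -opprD subrr.
  apply/eqP; rewrite -addrA -opprD subr_eq0; apply/eqP.
  move: y; apply: bar_ext => [b y y'|b y y'|v]; first exact: linearP.
    by rewrite (linearP (plift (kr x))) (linearP (plift (kr x'))) !scalerDr addrACA !scalerA [a * b]mulrC.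
  by rewrite !plift_gen linearP.
exists (plift hk) => u v; rewrite [LHS]plift_gen /=.
by rewrite [LHS]plift_gen [LHS]plift_gen.
Qed.

Lemma letter_sym_move E (H : letter g -> E) d a q b : letter_sym H ->
  H (d ++ a ++ q :: b) = ksgn K (cdeg a * sdeg q) *: H (d ++ q :: a ++ b).
Proof.
move=> [_ h]; elim: a d => [|e a ih] d; first by rewrite cdeg0 mul0r scale1r.
rewrite cat_cons -cat_rcons ih cat_rcons h; kcongr.
Qed.

(** Moving an entry of the right piece back to its place costs exactly the Koszul sign of the
    unshuffle, so each of the 2^n unshuffles contributes the letter itself. *)
Lemma dsh_merge E (H : letter g -> E) c : letter_sym H ->
  \S_(x <- dsh_e c) H (x.1 ++ x.2) = 2 ^+ size c *: H c.
Proof.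
move=> hH; suff h d : \S_(x <- dsh_e c) H (d ++ x.1 ++ x.2) = 2 ^+ size c *: H (d ++ c).
  exact: (h [::]).
elim: c d => [|q c ih] d; first by rewrite ev_dsh_nil scale1r.
rewrite ev_dsh_cons /=.
have -> : \S_(x <- dsh_e c) (ksgn K (sdeg q * tdeg (@sdeg K g) x.1) *: H (d ++ x.1 ++ q :: x.2))
    = \S_(x <- dsh_e c) H (rcons d q ++ x.1 ++ x.2).
  apply: eq_ev => x; rewrite letter_sym_move // cat_rcons scale_ksgnD tdeg_sdeg mulrC.
  by rewrite -[RHS]scale1r -(ksgn0 K); congr (_ *: _); apply: ksgn_eq; parity.
under eq_ev do rewrite -cat_rcons.
by rewrite ih cat_rcons -scalerDl exprS mulr2n mulrDl mul1r.
Qed.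

Lemma dsh_merge_inner E (H : letter g -> E) c : letter_sym H -> c != [::] ->
  \S_(x <- dsh_e c) (if (x.1 == [::]) || (x.2 == [::]) then 0 else H (x.1 ++ x.2)) =
  (2 ^+ size c - 2) *: H c.
Proof.
move=> hH hc; rewrite scalerBl -(dsh_merge c hH); apply/(canRL (addrK _))/esym.
rewrite scalerDl scale1r.
rewrite -{1}(ev_dsh_nil_l (@sdeg K g) c H) -{1}(ev_dsh_nil_r (@sdeg K g) c H) -!evD.
apply: eq_ev_in => x /dsh_size e.
case: eqP => [e1|_] /=; case: eqP => [e2|_]; rewrite ?e1 ?e2 ?add0r ?addr0 ?cats0 //.
by move: hc; rewrite -size_eq0 e e1 e2.
Qed.

Lemma two_exp_neq0 n : (1 < n)%N -> 2 ^+ n - 2 != 0 :> K.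
Proof.
move=> n1; have h := (pcharf0P K).1 charK0.
have le2 : (2 <= 2 ^ n)%N by rewrite -{1}(expn1 2) leq_exp2l // ltnW.
rewrite -natrX -natrB // h subn_eq0 -ltnNge -{1}(expn1 2) ltn_exp2l //.
Qed.

Lemma size_mid (T : Type) (u v : seq T) (c : T) : size (u ++ c :: v) = (size u + size v).+1.
Proof. by rewrite size_cat addnS. Qed.

(** The last letter always goes to the right, so exactly one term of the coproduct of [rcons u c]
    has a right word of one letter, namely u (x) c. The inverse selects it and concatenates; the
    condition [u != [::]] excludes one-letter words. *)
Lemma Delta_z_left_inverse : exists R : {linear tensor (bar g) (bar g) -> bar g},
  forall w, R (Delta_z g (barword w)) = if (1 < size w)%N then barword w else 0.
Proof.
pose F u v : bar g := if (size v == 1%N) && (u != [::]) then barword (u ++ v) else 0.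
have F0l v : F [::] v = 0 by rewrite /F andbF.
have F0r u : F u [::] = 0 by [].
have sym0 : letter_sym (fun _ : letter g => 0 : bar g).
  by split=> [c c'|c p q c']; [exact: kills_cst0 | rewrite scaler0].
have Fl v : word_sym (F^~ v).
  move=> a b; rewrite /F; case: (size v == 1%N) => //=.
  apply: eq_letter_sym (barword_sym a (b ++ v)) => c.
  by rewrite -catA -size_eq0 size_mid.
have Fr u : word_sym (F u).
  move=> a b; rewrite /F; case: (u != [::]); last by apply: eq_letter_sym sym0 => c; rewrite andbF.
  case e : ((size a + size b).+1 == 1%N); last by apply: eq_letter_sym sym0 => c; rewrite size_mid e.
  by apply: eq_letter_sym (barword_sym (u ++ a) b) => c; rewrite size_mid e /= catA.
have Fnl u v : [::] \in u -> F u v = 0.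
  by move=> h; rewrite /F barword_nil ?if_same // mem_cat h.
have Fnr u v : [::] \in v -> F u v = 0.
  by move=> h; rewrite /F barword_nil ?if_same // mem_cat h orbT.
have [||R RE] := @bar_bilinear_lift _ F.
- by move=> v; apply: word_sym_kills => // w; apply: Fnl.
- by move=> u; apply: word_sym_kills => // w; apply: Fnr.
exists R; elim/last_ind => [|u c _]; first by rewrite barword_nil0 !linear0.
rewrite Delta_zE dz_word_rcons /termZ ev_linear size_rcons.
under eq_ev do rewrite RE.
transitivity (\S_(y <- dsh_l u) (if y.2 == [::] then
   if (0 < size y.1)%N then barword (rcons y.1 c) else 0 else 0)).
  apply: eq_ev => y; rewrite /F size_rcons eqSS size_eq0 lt0n size_eq0.
  by case: eqP => [->|] //=; rewrite cats1.
by rewrite (ev_dsh_nil_r (@ldeg K g) u (fun a => if (0 < size a)%N then barword (rcons a c) else 0)).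
Qed.

Lemma Delta_c_left_inverse : exists R : {linear tensor (bar g) (bar g) -> bar g},
  forall c, R (Delta_c g (barword [:: c])) = if (1 < size c)%N then barword [:: c] else 0.
Proof.
(* The sign undoes the one in [sp], and the constant is the number of unshuffles with two nonempty
   pieces. It is nonzero here, since two nonempty pieces have at least two entries together. *)
pose C c d : bar g := if (c == [::]) || (d == [::]) then 0 else
  (2 ^+ size (c ++ d) - 2)^-1 *: (ksgn K (cdeg c) *: barword [:: c ++ d]).
pose F u v : bar g := if (size u == 1%N) && (size v == 1%N) then C (flatten u) (flatten v) else 0.
have sym0 : letter_sym (fun _ : letter g => 0 : bar g).
  by split=> [c c'|c p q c']; [exact: kills_cst0 | rewrite scaler0].
have Cl d : letter_sym (C^~ d).
  have e0 a q b : (a ++ q :: b == [::] :> letter g) = false by case: a.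
  have [h1 h2] := @barword_sym K g [::] [::]; rewrite /C; split=> [c c'|c p q c'].
    apply: (@eq_kills _ _ _ _ (fun q => if d == [::] then 0 else
        (2 ^+ ((size c + size c').+1 + size d) - 2)^-1 *:
         (ksgn K (cdeg c + (sdeg q + cdeg c')) *: barword [:: c ++ q :: (c' ++ d)]))).
      by move=> q; rewrite e0 size_cat size_mid cdeg_cat cdeg_cons -catA.
    case: (d == [::]); first exact: kills_cst0.
    apply: kills_scale.
    exact: (entry_deg_kills (fun z => ksgn K (cdeg c + (z + cdeg c'))) (h1 c (c' ++ d))).
  rewrite !e0; case: (d == [::]); first by rewrite scaler0.
  rewrite -!catA /= h2 !size_cat /= !scalerA; congr (_ *: _); rewrite !cdeg_cat !cdeg_cons.
  rewrite -[RHS]mulrA [RHS]mulrC; congr (_ * ksgn K (_ + _) * _).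
  by rewrite addrCA.
have Cr d : letter_sym (C d).
  have e0 a q b : (a ++ q :: b == [::] :> letter g) = false by case: a.
  have [h1 h2] := @barword_sym K g [::] [::]; rewrite /C; split=> [c c'|c p q c'].
    apply: (@eq_kills _ _ _ _ (fun q => if d == [::] then 0 else
        (2 ^+ (size d + (size c + size c').+1) - 2)^-1 *:
         (ksgn K (cdeg d) *: barword [:: (d ++ c) ++ q :: c']))).
      by move=> q; rewrite e0 orbF size_cat size_mid -catA.
    case: (d == [::]); first exact: kills_cst0.
    by do 2!apply: kills_scale; exact: h1.
  rewrite !e0 !orbF; case: (d == [::]); first by rewrite scaler0.
  rewrite !catA /= h2 !size_cat /= !scalerA; congr (_ *: _).
  by rewrite -[RHS]mulrA [RHS]mulrC.
have C0 c : C [::] c = 0 by [].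
have C0' c : C c [::] = 0 by rewrite /C orbT.
have flat1 u : size u == 1%N -> [::] \in u -> flatten u = [::].
  by case: u => [|c [|]] //= _; rewrite inE => /eqP <-.
have F_l v : word_sym (F^~ v).
  move=> a b; case e : ((size a + size b).+1 == 1%N); last first.
    by apply: eq_letter_sym sym0 => c; rewrite /F size_mid e.
  apply: (@eq_letter_sym _ _ _ (fun c => if size v == 1%N then C c (flatten v) else 0)).
    move=> c; rewrite /F size_mid e /=; move: e; case: a => //; case: b => // _.
    by rewrite /= cats0.
  by case: (size v == 1%N) => //; apply: Cl.
have F_r u : word_sym (F u).
  move=> a b; case e : ((size a + size b).+1 == 1%N); last first.
    by apply: eq_letter_sym sym0 => c; rewrite /F size_mid e andbF.
  apply: (@eq_letter_sym _ _ _ (fun c => if size u == 1%N then C (flatten u) c else 0)).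
    move=> c; rewrite /F size_mid e /= andbT; move: e; case: a => //; case: b => // _.
    by rewrite /= cats0.
  by case: (size u == 1%N) => //; apply: Cr.
have [||R RE] := @bar_bilinear_lift _ F.
- move=> v; apply: word_sym_kills => // w hw; rewrite /F; case: ifP => // /andP[h _].
  by rewrite flat1.
- move=> u; apply: word_sym_kills => // [|w hw]; first by rewrite /F andbF.
  by rewrite /F; case: ifP => // /andP[_ h]; rewrite (flat1 w).
exists R => c; rewrite Delta_cE (dc_word_rcons [::] c) /dc_last /termA /termB !ev_dsh_nil.
rewrite !ev_cobar0 subrr add0r ev_linear.
under eq_ev do rewrite linearZ /= RE.
case: (eqVneq c [::]) => [->|hc].
  by rewrite ev_sp ev_dsh_nil /F /= C0 !scaler0.
transitivity ((2 ^+ size c - 2)^-1 *: ((2 ^+ size c - 2) *: (barword [:: c] : bar g))).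
  rewrite -(dsh_merge_inner (H := fun d => barword [:: d])) //; last exact: (@barword_sym K g [::] [::]).
  rewrite ev_sp -evZ; apply: eq_ev_in => x /dsh_size e.
  rewrite /F /= !cats0 /C size_cat e; case: ifP => _; first by rewrite !scaler0.
  by rewrite !scalerA wdeg0 addr0 mul0r addr0 ksgn0 mulr1 mulrAC ksgnK mul1r.
have : (0 < size c)%N by rewrite lt0n size_eq0.
case: ifPn => [h _|]; first by rewrite scalerA mulVf ?scale1r // two_exp_neq0.
by case: (size c) => [|[|]] //= _ _; rewrite expr1 subrr scale0r scaler0.
Qed.

Lemma corestrE w : corestr g (barword w) = corestr_word w.
Proof. exact: plift_gen. Qed.

Definition single w := (size w == 1%N) && (weight w == 1%N).

Lemma one_letter_lift : exists T : {linear bar g -> bar g},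
  forall w, T (barword w) = if size w == 1%N then barword w else 0.
Proof.
have hk : kills (fun w => if size w == 1%N then barword w else 0) (@bar_rel K g).
  apply: word_sym_kills => // [u v|w hw]; last by rewrite barword_nil ?if_same.
  case e : ((size u + size v).+1 == 1%N).
    by apply: eq_letter_sym (barword_sym u v) => c; rewrite size_mid e.
  apply: (@eq_letter_sym _ _ _ (fun=> 0)) => [c|]; first by rewrite size_mid e.
  by split=> [c c'|c p q c']; [exact: kills_cst0 | rewrite scaler0].
by exists (plift hk) => w; apply: plift_gen.
Qed.

Lemma one_entry_lift : exists T : {linear bar g -> bar g},
  forall w, T (barword w) = if single w then barword w else 0.
Proof.
have sym0 : letter_sym (fun _ : letter g => 0 : bar g).
  by split=> [c c'|c p q c']; [exact: kills_cst0 | rewrite scaler0].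
have sE u v c p c' : single (u ++ (c ++ p :: c') :: v) =
    ((size u + size v).+1 == 1%N) && ((weight u + weight v + size c + size c').+1 == 1%N).
  rewrite /single size_mid weight_cat weight_cons size_mid; congr (_ && (_ == _)).
  by rewrite addSn addnS addnCA !addnA [(_ + weight u)%N]addnC; lia.
have hk : kills (fun w => if single w then barword w else 0) (@bar_rel K g).
  apply: word_sym_kills => // [u v|w hw]; last by rewrite barword_nil ?if_same.
  have [h1 h2] := barword_sym u v; split=> [c c'|c p q c'].
    pose b := ((size u + size v).+1 == 1%N) && ((weight u + weight v + size c + size c').+1 == 1%N).
    apply: (@eq_kills _ _ _ _ (fun p => if b then barword (u ++ (c ++ p :: c') :: v) else 0)).
      by move=> p; rewrite sE.
    by case: b; [exact: h1 | exact: kills_cst0].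
  by rewrite !sE /= -/(size _); case: ifP => _; [exact: h2 | rewrite scaler0].
by exists (plift hk) => w; apply: plift_gen.
Qed.

Lemma primitive_eq0 n (x : bar g) : bar_hom n x ->
  Delta_z g x = 0 -> Delta_c g x = 0 -> corestr g x = 0 -> x = 0.
Proof.
move=> hx hz hc hs.
have [Rz RzE] := Delta_z_left_inverse; have [Rc RcE] := Delta_c_left_inverse.
have [P1 P1E] := one_letter_lift; have [P11 P11E] := one_entry_lift.
have x1 : x = P1 x.
  have h : P1 =1 fun y => y - Rz (Delta_z g y).
    apply: bar_ext => [a y z|a y z|w]; first exact: linearP.
      by rewrite (linearP (Delta_z g)) (linearP Rz) opprD scalerBr addrACA.
    rewrite RzE P1E; case: w => [|c [|d w]] /=; rewrite ?subr0 ?subrr //.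
    by rewrite barword_nil0.
  by rewrite h hz linear0 subr0.
have x11 : x = P11 x.
  have h : (fun y => P1 y - Rc (Delta_c g (P1 y))) =1 P11.
    apply: bar_ext => [a y z|a y z|w]; last 2 first.
    - exact: linearP.
    - rewrite P1E P11E /single; case: (eqVneq (size w) 1%N) => [|_]; last by rewrite !linear0 addr0.
      case: w => [|c []] // _; rewrite RcE weight_cons addn0.
      by case: c => [|p [|q c]] /=; rewrite ?subr0 ?subrr // barword_nil.
    by rewrite (linearP P1) (linearP (Delta_c g)) (linearP Rc) opprD scalerBr addrACA.
  by rewrite -h -x1 hc linear0 subr0.
(* Homogeneity is used here: in degree n all one-entry words have their entry in degree n - 2, so
   they add up to a single word whose entry is the corestriction. *)
suff [_ h] : ghom (n - 2) (corestr g x) /\ P11 x = barword [:: [:: (n - 2, corestr g x)]].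
  rewrite x11 h hs.
  exact: (kills_entry0 (n - 2) ((barword_sym (g := g) [::] [::]).1 [::] [::])).
case: hx => s hs' ->; elim: s hs' => [|t s ih] hs'.
  rewrite big_nil !linear0; split; first exact: ghom0.
  by apply/esym; exact: (kills_entry0 (n - 2) ((barword_sym (g := g) [::] [::]).1 [::] [::])).
have [|h1 h2] := ih; first by move=> p hp; apply: hs'; rewrite inE hp orbT.
rewrite big_cons !linearP h2 P11E corestrE.
have ht : wdeg t.2 = n by apply: hs'; rewrite mem_head.
case: (boolP (single t.2)) => st; last first.
  have -> : corestr_word t.2 = 0.
    by move: st; rewrite /single /weight; case: (t.2) => [|[|p [|q c]] [|d w]].
  by rewrite !scaler0 !add0r.
move: st ht; rewrite /single /weight; case: (t.2) => [|[|p [|q c]] [|d w]] //= _ ht.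
have ep : p.1 = n - 2.
  by move: ht; rewrite wdeg_cons wdeg0 addr0 ldegE cdeg_cons cdeg0 addr0 /sdeg => <-; rewrite -addrA addrK.
case: asboolP => hp; last first.
  rewrite scaler0 add0r; split=> //.
  have := (barword_sym (g := g) [::] [::]).1 [::] [::] _ (entry_nonhom hp).
  by rewrite fglift1 /= -surjective_pairing => ->; rewrite scaler0 add0r.
rewrite ep in hp; split; first exact: ghomP.
have := (barword_sym (g := g) [::] [::]).1 [::] [::] _ (entry_lin t.1 hp h1).
rewrite !fgliftB fgliftZ !fglift1 /= => /eqP; rewrite -addrA -opprD subr_eq0 => /eqP ->.
by rewrite -ep -surjective_pairing.
Qed.

End Primitive.

(** * Coderivations with equal corestrictions *)

Section Uniqueness.
Variables (K : fieldType) (g : gradedSpace K).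
Implicit Types (c : letter g) (u v w : word g) (f : {linear bar g -> bar g}).

Definition hom_word w := forall c q, c \in w -> q \in c -> ghom q.1 q.2.

Lemma barword_nonhom w : ~ hom_word w -> barword w = 0 :> bar g.
Proof.
move=> h; have [c [q [cw qc hq]]] : exists c q, [/\ c \in w, q \in c & ~ ghom q.1 q.2].
  apply: contrapT => hn; apply: h => c q cw qc; apply: contrapT => hq.
  by apply: hn; exists c, q.
case/splitPr: cw => u v; case/splitPr: qc => a b.
have := (barword_sym (g := g) u v).1 a b _ (entry_nonhom hq).
by rewrite fglift1 -surjective_pairing.
Qed.

Lemma invalid_word w : ~ valid_word w -> barword w = 0 :> bar g.
Proof.
move=> hw; have [->|w0] := eqVneq w [::]; first exact: barword_nil0.
have [wn|wn] := boolP ([::] \in w); first exact: barword_nil.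
by apply: barword_nonhom => h; apply: hw.
Qed.

Lemma tens_coder_bar_tens0 p f u v : bar_tens u v = 0 -> tens_coder p f (bar_tens u v) = 0.
Proof. by move=> ->; rewrite /tens_coder !linear0 addr0. Qed.

(** Each coproduct of a word involves pairs of words whose weights add up to its own; when neither
    is zero in [bar] both are lighter, and the induction applies. The bound [N] lets a truncated sum
    of coderivations be compared with the full one. *)
Lemma coderivation_eq (charK0 : [pchar K] =i pred0) p f1 f2 N :
  coderivation p f1 -> coderivation p f2 ->
  (forall w, valid_word w -> (weight w <= N)%N ->
     corestr g (f1 (barword w)) = corestr g (f2 (barword w))) ->
  forall w, (weight w <= N)%N -> f1 (barword w) = f2 (barword w).
Proof.
move=> [h1 z1 c1] [h2 z2 c2] hc w; have [n] := ubnP (weight w).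
elim: n w => // n ih w; rewrite ltnS => wn wN.
have [vw|/invalid_word ->] := pselect (valid_word w); last by rewrite !linear0.
have eT a b : (weight a + weight b)%N = weight w ->
    tens_coder p f1 (bar_tens a b) = tens_coder p f2 (bar_tens a b).
  move=> e; have z : bar_tens a b = 0 -> tens_coder p f1 (bar_tens a b) = tens_coder p f2 (bar_tens a b).
    by move=> h; rewrite !tens_coder_bar_tens0.
  have [ea|a0] := eqVneq a [::]; first by apply: z; rewrite ea bar_tens0_l.
  have [eb|b0] := eqVneq b [::].
    by apply: z; rewrite eb /bar_tens barword_nil0; exact: (linear0 (tens _)).
  have [na|na] := boolP ([::] \in a); first by apply/z/bar_tens_nil_l.
  have [nb|nb] := boolP ([::] \in b); first by apply/z/bar_tens_nil_r.
  have wa := weight_gt0 a0 na; have wb := weight_gt0 b0 nb.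
  by rewrite !tens_coderE !ih //; lia.
have ez : Delta_z g (f1 (barword w)) = Delta_z g (f2 (barword w)).
  rewrite -z1 -z2 Delta_zE.
  case/lastP: w eT {wn wN vw} => [|u c] eT; first by rewrite /dz_word big_geq // /tens_coder !linear0.
  rewrite dz_word_rcons /termZ !(ev_lin _ _ (tens_coder_linear _ _)).
  exact: (@eq_termZ_in _ _ _ (fun a b => tens_coder p f1 (bar_tens a b))
    (fun a b => tens_coder p f2 (bar_tens a b))).
have ec : Delta_c g (f1 (barword w)) = Delta_c g (f2 (barword w)).
  rewrite -c1 -c2 Delta_cE; congr (_ *: _).
  case/lastP: w eT {wn wN vw ez} => [|u c] eT.
    by rewrite -Delta_cE barword_nil0 linear0 /tens_coder !linear0.
  rewrite dc_word_rcons !(dc_last_lin _ _ _ (tens_coder_linear _ _)).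
  exact: (@eq_dc_last_in _ _ _ (fun a b => tens_coder p f1 (bar_tens a b))
    (fun a b => tens_coder p f2 (bar_tens a b))).
apply/eqP; rewrite -subr_eq0; apply/eqP.
apply: (primitive_eq0 charK0 (n := wdeg w + p)).
- by rewrite [X in bar_hom _ X]addrC -scaleN1r; apply: bar_homP; [exact: h2 | exact: h1].
- by rewrite linearB ez subrr.
- by rewrite linearB ec subrr.
by rewrite linearB (hc _ vw wN) subrr.
Qed.

Lemma tens_coder_tens p f x y :
  tens_coder p f (tens x y) = tens (f x) y + tens (koszul_op g p x) (f y).
Proof. by rewrite /tens_coder !tens_mapE. Qed.

Lemma coderivation0 p : coderivation p (\0 : {linear bar g -> bar g}).
Proof.
have T0 x : tens_coder p (\0 : {linear bar g -> bar g}) x = 0.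
  move: x; apply: tensor_ext => [|a x y|x y]; first exact: tens_coder_linear.
    by rewrite scaler0 addr0.
  rewrite tens_coder_tens; transitivity (tensr y (0 : bar g) + tens (koszul_op g p x) (0 : bar g)) => //.
  by rewrite !linear0 addr0.
split=> [w|x|x]; first exact: bar_hom0.
  by rewrite T0 linear0.
by rewrite T0 scaler0 linear0.
Qed.

Lemma coderivationD p f1 f2 : coderivation p f1 -> coderivation p f2 ->
  coderivation p (f1 \+ f2 : {linear bar g -> bar g}).
Proof.
move=> [h1 z1 c1] [h2 z2 c2].
have TD x : tens_coder p (f1 \+ f2 : {linear bar g -> bar g}) x =
    tens_coder p f1 x + tens_coder p f2 x.
  move: x; apply: tensor_ext => [|a x y|x y]; first exact: tens_coder_linear.
    by rewrite (tens_coder_linear p f1) (tens_coder_linear p f2) addrACA -scalerDr.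
  rewrite !tens_coder_tens addrACA; congr (_ + _); last exact: (linearD (tens _)).
  exact: (linearD (tensr y)).
split=> [w|x|x].
- by rewrite -[X in bar_hom _ (X + _)]scale1r; apply: bar_homP.
- by rewrite TD z1 z2 -linearD.
by rewrite TD scalerDr c1 c2 -linearD.
Qed.

Lemma koszul_op_hom p n (x : bar g) : bar_hom n x -> koszul_op g p x = ksgn K (p * n) *: x.
Proof.
case=> s hs ->; rewrite linear_sum scaler_sumr; apply: eq_big_seq => t ts.
by rewrite linearZ /= koszul_opE hs // !scalerA mulrC.
Qed.

Lemma koszul_op_coderivation p f x : coderivation p f ->
  koszul_op g p (f x) = ksgn K p *: f (koszul_op g p x).
Proof.
move=> [h _ _]; move: x; apply: bar_ext => [a x y|a x y|w].
- by rewrite !linearP.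
- by rewrite (linearP (koszul_op g p)) (linearP f) scalerDr !scalerA mulrC.
by rewrite (koszul_op_hom p (h w)) koszul_opE linearZ /= scale_ksgnD; kcongr.
Qed.

(** In the square of f (x) 1 + 1 (x) f the two cross terms have opposite signs, because the degree
    of f is odd. *)
Lemma coderivation_square p f : pz p -> coderivation p f ->
  coderivation (p + p) (f \o f : {linear bar g -> bar g}).
Proof.
move=> podd hf; have [h z c] := hf.
have kk x : koszul_op g p (koszul_op g p x) = koszul_op g (p + p) x.
  move: x; apply: bar_ext => [a x y|a x y|w]; [by rewrite !linearP | by rewrite !linearP |].
  by rewrite !koszul_opE linearZ /= koszul_opE; kcongr.
have TT x : tens_coder (p + p) (f \o f : {linear bar g -> bar g}) x =
    tens_coder p f (tens_coder p f x).
  move: x; apply: tensor_ext => [|a x y|x y]; first exact: tens_coder_linear.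
    by rewrite !tens_coder_linear.
  have TD s t : tens_coder p f (s + t) = tens_coder p f s + tens_coder p f t.
    by have := tens_coder_linear p f 1 s t; rewrite !scale1r.
  rewrite !tens_coder_tens TD !tens_coder_tens kk koszul_op_coderivation //.
  rewrite -addrA; congr (_ + _); rewrite addrA -[LHS]add0r; congr (_ + _).
  rewrite (_ : ksgn K p = -1) ?scaleN1r; last by rewrite ksgnE podd.
  rewrite [X in _ = X + _](linearN (tensr (f y))) addNr //.
split=> [w|x|x].
- suff h2 : bar_hom (wdeg w + (p + p)) (f (f (barword w))) by exact: h2.
  have [s hs ->] := h w; rewrite linear_sum.
  under eq_bigr do rewrite linearZ /=.
  elim: s hs => [|t s ih] hs; first by rewrite big_nil; exact: bar_hom0.
  rewrite big_cons; apply: bar_homP; last by apply: ih => q hq; apply: hs; rewrite inE hq orbT.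
  by rewrite addrA -(hs t) ?mem_head.
- by rewrite TT !z.
rewrite TT ksgnD -scalerA.
have TZ a t : tens_coder p f (a *: t) = a *: tens_coder p f t.
  by have := tens_coder_linear p f a t 0; rewrite !addr0 => ->; rewrite [tens_coder p f 0]/tens_coder !linear0 !addr0.
by rewrite -TZ c c.
Qed.

End Uniqueness.

(** * Induced coderivations *)

Section Cogenerators.
Variables (K : fieldType) (charK0 : [pchar K] =i pred0) (g : gradedSpace K).
Implicit Types (c : letter g) (u v w : word g) (f : {linear bar g -> bar g}).

(* phi is the restriction to words of a linear map bar -> ss g of degree p *)
Record cogenerator (p : int) (phi : word g -> g) : Prop := Cogenerator {
  cogen_nil : phi [::] = 0;
  cogen_nil_in : forall w, [::] \in w -> phi w = 0;
  cogen_hom : forall w, hom_word w -> ghom (wdeg w + p - 2) (phi w);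
  cogen_lin : forall u v c c' i a x y, phi (u ++ (c ++ (i, a *: x + y) :: c') :: v) =
    a *: phi (u ++ (c ++ (i, x) :: c') :: v) + phi (u ++ (c ++ (i, y) :: c') :: v);
  cogen_sym : forall u v c q q' c', hom_word (u ++ (c ++ q :: q' :: c') :: v) ->
    phi (u ++ (c ++ q :: q' :: c') :: v) =
    ksgn K (sdeg q * sdeg q') *: phi (u ++ (c ++ q' :: q :: c') :: v)
}.

(** Words with an entry that is not homogeneous of its stated degree vanish in [bar], but the raw
    function [phi] may be nonzero on them; hence the cut-off. *)
Definition psi_of p (phi : word g -> g) w : entry g :=
  (wdeg w + p - 2, if `[< hom_word w >] then phi w else 0).

Lemma hom_word_mid u v c c' (q : entry g) : hom_word (u ++ (c ++ q :: c') :: v) <->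
  [/\ hom_word (u ++ (c ++ c') :: v) & ghom q.1 q.2].
Proof.
split=> [h|[h hq]].
  split=> [d e|]; last by apply: (h (c ++ q :: c')); rewrite mem_cat mem_head orbT.
  rewrite mem_cat inE orbCA => /orP[/eqP ->|hd] he; last first.
    by apply: (h d e _ he); rewrite mem_cat inE orbCA hd orbT.
  apply: (h (c ++ q :: c')); first by rewrite mem_cat mem_head orbT.
  by move: he; rewrite !mem_cat inE => /orP[->//|->]; rewrite !orbT.
move=> d e; rewrite mem_cat inE orbCA => /orP[/eqP ->|hd] he; last first.
  by apply: (h d e _ he); rewrite mem_cat inE orbCA hd orbT.
move: he; rewrite mem_cat inE orbCA => /orP[/eqP -> //|he].
by apply: (h (c ++ c') e); rewrite ?mem_cat ?mem_head ?orbT.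
Qed.

Lemma hom_word_swap u v c c' (q q' : entry g) :
  hom_word (u ++ (c ++ q :: q' :: c') :: v) -> hom_word (u ++ (c ++ q' :: q :: c') :: v).
Proof.
rewrite -cat_rcons => /hom_word_mid[]; rewrite cat_rcons => /hom_word_mid [h hq] hq'.
rewrite -cat_rcons; apply/hom_word_mid; split=> //.
by rewrite cat_rcons; apply/hom_word_mid.
Qed.

Section OneCogenerator.
Variables (p : int) (phi : word g -> g) (hphi : cogenerator p phi).
Local Notation psi := (psi_of p phi).

Lemma psi_of_deg w : (psi w).1 = wdeg w + p - 2. Proof. by []. Qed.

Lemma psi_of_nil w : [::] \in w -> (psi w).2 = 0.
Proof. by move=> h; rewrite /= (cogen_nil_in hphi h) if_same. Qed.

Lemma psi_of_hom w : ghom (psi w).1 (psi w).2.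
Proof.
rewrite /=; case: asboolP => h; first exact: (cogen_hom hphi).
exact: ghom0.
Qed.

Lemma psi_of_sym (E : lmodType K) (G : entry g -> E) :
  kills G (@entry_rel K g) -> word_sym (fun w => G (psi w)).
Proof.
move=> hG u v; have G0 i : G (i, 0) = 0 by exact: kills_entry0.
have GP i a x y : ghom i x -> ghom i y -> G (i, a *: x + y) = a *: G (i, x) + G (i, y).
  move=> hx hy; have := hG _ (entry_lin a hx hy); rewrite !fgliftB fgliftZ !fglift1 => /eqP.
  by rewrite -addrA -opprD subr_eq0 => /eqP.
split=> [c c' _ [i x hx|i a x y hx hy]|c q q' c'].
- rewrite fglift1 /psi_of asboolF ?G0 // => /hom_word_mid [_]; exact: hx.
- rewrite !fgliftB fgliftZ !fglift1 /psi_of.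
  have eD z z' : wdeg (u ++ (c ++ (i, z) :: c') :: v) = wdeg (u ++ (c ++ (i, z') :: c') :: v).
    by rewrite !wdeg_cat !wdeg_cons !ldegE !cdeg_cat !cdeg_cons.
  rewrite (eD (a *: x + y) 0) (eD x 0) (eD y 0).
  have [hc|hc] := pselect (hom_word (u ++ (c ++ c') :: v)).
    have hh z : ghom i z -> hom_word (u ++ (c ++ (i, z) :: c') :: v).
      by move=> hz; apply/hom_word_mid.
    have hxy : ghom i (a *: x + y) by apply: ghomP.
    rewrite (asboolT (hh _ hxy)) (asboolT (hh _ hx)) (asboolT (hh _ hy)) (cogen_lin hphi).
    have gx := cogen_hom hphi (hh _ hx); have gy := cogen_hom hphi (hh _ hy).
    rewrite (eD x 0) in gx; rewrite (eD y 0) in gy.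
    by rewrite (GP _ _ _ _ gx gy) addrAC addrK subrr.
  have hn z : ~ hom_word (u ++ (c ++ (i, z) :: c') :: v) by move=> /hom_word_mid [].
  by rewrite !(asboolF (hn _)) G0 scaler0 !subr0.
have eD : wdeg (u ++ (c ++ q :: q' :: c') :: v) = wdeg (u ++ (c ++ q' :: q :: c') :: v).
  by rewrite !wdeg_cat !wdeg_cons !ldegE !cdeg_cat !cdeg_cons [sdeg q + (sdeg q' + _)]addrCA.
have [hw|hw] := pselect (hom_word (u ++ (c ++ q :: q' :: c') :: v)).
  have hw' := hom_word_swap hw.
  rewrite /psi_of (asboolT hw) (asboolT hw') -eD (cogen_sym hphi hw) -[X in (_, X)]addr0.
  have gx := cogen_hom hphi hw'; rewrite -eD in gx.
  by rewrite (GP _ _ _ _ gx (ghom0 g _)) G0 addr0.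
have hw' : ~ hom_word (u ++ (c ++ q' :: q :: c') :: v) by move/hom_word_swap.
by rewrite /psi_of (asboolF hw) (asboolF hw') !G0 scaler0.
Qed.

Definition cogen_map : {linear bar g -> bar g} := coder_map p psi_of_sym.

Lemma cogen_mapE w : [::] \notin w -> cogen_map (barword w) = ev (coder p psi w) (@barword K g).
Proof. by move=> h; rewrite /cogen_map coder_mapE /coder_word ifN. Qed.

Lemma cogen_map_coderivation : coderivation p cogen_map.
Proof. exact: (coder_map_coderivation psi_of_deg psi_of_nil). Qed.

(** Only the terms where the produced letter consumes all of [u] have one letter: the terms that
    keep [c] untouched have a nonempty word before it. *)
Lemma ev_coder_letter (E : lmodType K) (F : word g -> E) u c :
  (forall w, size w != 1%N -> F w = 0) ->
  ev (coder p psi (rcons u c)) F = \S_(l <- cogen psi u c) F [:: l].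
Proof.
move=> hF; rewrite ev_coder_rcons.
have x0 w x : x \in supp (coder p psi w) -> x != [::].
  elim/last_ind: w x => [//|w d _] x.
  rewrite /coder rev_rcons /= revK supp_cat supp_twist supp_bind mem_cat.
  case/orP=> [/mapP[y _ ->]|/flattenP[s /mapP[y _ ->]]]; first by rewrite -size_eq0 size_rcons.
  by rewrite supp_twist => /mapP[l _ ->]; rewrite -size_eq0 size_rcons.
rewrite [X in X + _]ev_in0 ?add0r => [|x /x0 hx]; last first.
  by rewrite hF // size_rcons eqSS size_eq0.
rewrite -[RHS](ev_dsh_nil_l (@ldeg K g) u (fun v => \S_(l <- cogen psi v c) F [:: l])).
apply: eq_ev => y; case: eqP => [->|/eqP hy]; first by rewrite wdeg0 mulr0 ksgn0 scale1r.
rewrite ev_in0 ?scaler0 // => l _; rewrite hF // size_rcons eqSS size_eq0 //.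
Qed.

Lemma cogen_map_corestr w : corestr g (cogen_map (barword w)) = (psi w).2.
Proof.
have [hw|hw] := boolP ([::] \in w).
  by rewrite barword_nil // !linear0 psi_of_nil.
case/lastP: w hw => [_|u c hw].
  by rewrite barword_nil0 !linear0 /= (cogen_nil hphi) if_same.
rewrite cogen_mapE // ev_linear.
under eq_ev do rewrite corestrE.
rewrite ev_coder_letter; last by move=> [|[|? [|? ?]] [|? ?]].
have hc : c != [::] by move: hw; rewrite mem_rcons inE eq_sym negb_or => /andP[].
rewrite ev_cogen [X in _ *: X]ev_in0 ?scaler0 ?addr0; last first.
  by move=> x _; case: (c) hc.
rewrite -(ev_dsh_nil_r (@sdeg K g) c (fun d => (psi (rcons u d)).2)).
apply: eq_ev => x; case: (x.2) => [|? ?] //=.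
by rewrite asboolT //; exact: (psi_of_hom (rcons u x.1)).
Qed.

Lemma cogen_map_induced : induced_coderivation p phi cogen_map.
Proof.
have hc : has_corestriction phi cogen_map.
  by move=> w [_ _ hw]; rewrite cogen_map_corestr /= asboolT.
split=> // [|f' hf' hc' x]; first exact: cogen_map_coderivation.
move: x; apply: bar_ext => [a x y|a x y|w]; [exact: linearP | exact: linearP |].
apply: (coderivation_eq charK0 hf' cogen_map_coderivation (N := weight w)) => // v vv _.
by rewrite hc // hc'.
Qed.

End OneCogenerator.
End Cogenerators.

(** * The cogenerators of the two structures *)

Section Leibniz.
Variables (K : fieldType) (g : gradedSpace K) (D : nat -> seq g -> g).
Implicit Types (c : letter g) (u v w : word g).
Hypothesis D_lin : forall n, (0 < n)%N -> multilinear_op n (D n).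
Hypothesis D_deg : forall n, (0 < n)%N -> degree_op n (shdeg n) (D n).
Hypothesis D0 : D 0 [::] = 0.

Definition single_letters w := all (fun c => size c == 1%N) w.

Lemma single_letters_weight w : single_letters w -> weight w = size w.
Proof. by elim: w => //= c w ih /andP[/eqP hc /ih hw]; rewrite weight_cons hc hw. Qed.

Lemma single_letters_wdeg w : single_letters w ->
  wdeg w = \sum_(q <- flatten w) q.1 + 2 * (size w)%:Z.
Proof.
elim: w => [|c w ih] /=; first by rewrite wdeg0 big_nil.
case: c => [|q []] //= /ih e; rewrite wdeg_cons ldegE cdeg_cons cdeg0 e big_cons /sdeg intS.
ring.
Qed.

Lemma single_letters_mid u v c q q' c' :
  single_letters (u ++ (c ++ q :: q' :: c') :: v) = false.
Proof.
rewrite /single_letters all_cat /= size_cat /= !addnS /=.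
by rewrite andbF.
Qed.

Lemma leib_cogenerator n : (0 < n)%N -> cogenerator (-1) (leib_corestr D n).
Proof.
move=> n0; split=> [|w hw|w hw|u v c c' i a x y|u v c q q' c' _].
- by rewrite /leib_corestr eq_sym eqn0Ngt n0.
- rewrite /leib_corestr; case: ifP => // /andP[_ /allP h].
  by have := h _ hw.
- rewrite /leib_corestr; case: ifP => [/andP[/eqP sw h1]|_]; last exact: ghom0.
  have := D_deg n0; move=> /(_ (flatten w)) hD.
  have -> : wdeg w + -1 - 2 = \sum_(q <- flatten w) q.1 + shdeg n.
    by rewrite single_letters_wdeg // sw /shdeg; ring.
  apply: hD; first by rewrite -sw -single_letters_weight.
  by move=> q /flattenP[c cw qc]; apply: (hw c q).
- rewrite /leib_corestr !size_cat /= !all_cat /= !size_cat /=.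
  case: ifP => [/andP[sn h1]|_]; last by rewrite scaler0 addr0.
  have E z : [seq q.2 | q <- flatten (u ++ (c ++ (i, z) :: c') :: v)] =
      [seq q.2 | q <- flatten u ++ c] ++ z :: [seq q.2 | q <- c' ++ flatten v].
    by rewrite flatten_cat /= -catA cat_cons catA map_cat.
  rewrite !E; apply: (D_lin n0).
  have hs : single_letters (u ++ (c ++ (i, x) :: c') :: v).
    by rewrite /single_letters all_cat /= size_cat.
  have := single_letters_weight hs; rewrite /weight size_cat /= -(eqP sn) => <-.
  by rewrite !size_map flatten_cat /= -catA cat_cons catA size_cat.
have e := single_letters_mid u v c; rewrite /single_letters in e.
by rewrite /leib_corestr !e !andbF scaler0.
Qed.

(** The sum of all [leib_corestr D n]: on a given word only the arity equal to its length
    contributes. *)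
Definition leib_total w : g := leib_corestr D (size w) w.

Lemma leib_total_cogenerator : cogenerator (-1) leib_total.
Proof.
have h u v c : leib_total (u ++ c :: v) = leib_corestr D (size u + size v).+1 (u ++ c :: v).
  by rewrite /leib_total size_mid.
have H u v := leib_cogenerator (ltn0Sn (size u + size v)).
split=> [|w hw|w hw|u v c c' i a x y|u v c q q' c' hw].
- by rewrite /leib_total /leib_corestr /= D0.
- by case/splitPr: hw => u v; rewrite h (cogen_nil_in (H u v)) // mem_cat mem_head orbT.
- case: w hw => [_|c w hw]; first by rewrite /leib_total /leib_corestr /= D0; exact: ghom0.
  by have := h [::] w c; rewrite /= => ->; apply: (cogen_hom (H [::] w)).
- by rewrite !h (cogen_lin (H u v)).
by rewrite !h (cogen_sym (H u v)).
Qed.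

End Leibniz.

Section LieCogenerator.
Variables (K : fieldType) (g : gradedSpace K) (br : g -> g -> g).
Hypothesis br_lie : lie_bracket br.
Implicit Types (c : letter g) (u v w : word g).

(** The sign of exponent |sx| in [lie_corestr] turns the antisymmetry of the bracket into graded
    symmetry for the degrees shifted by one. *)
Lemma lie_cogenerator : cogenerator (-1) (lie_corestr br).
Proof.
have [[brl brr] brh bra _] := br_lie.
have br0 x : br 0 x = 0.
  by have := brl x (-1) 0 0; rewrite scaleN1r addNr scaleN1r addNr.
split=> [//|w|w hw|u v c c' i a x y|u v c q q' c' hw].
- by case: w => [|[|p [|q [|? ?]]] [|? ?]].
- case: w hw => [|[|p [|q [|? ?]]] [|? ?]] hw /=; try exact: ghom0.
  rewrite (_ : _ - 2 = p.1 + q.1); last first.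
    by rewrite wdeg_cons wdeg0 ldegE !cdeg_cons cdeg0 /sdeg; ring.
  rewrite -[_ *: _]addr0; apply: ghomP (ghom0 g _).
  by apply: brh; apply: (hw [:: p; q]); rewrite !inE eqxx ?orbT.
- case: u => [|d [|d' u]] /=; last 2 first.
  + by case: d => [|? [|? [|? ?]]]; rewrite ?scaler0 ?addr0.
  + by case: d => [|? [|? [|? ?]]]; rewrite ?scaler0 ?addr0.
  case: v => [|d v]; last first.
    by case: c => [|? [|? [|? ?]]]; case: c' => [|? [|? ?]]; rewrite /= ?scaler0 ?addr0.
  case: c => [|p [|p' c]]; case: c' => [|q [|q' c']] /=; rewrite ?scaler0 ?addr0 //.
  + by rewrite brl scalerDr !scalerA mulrC.
  + by rewrite brr scalerDr !scalerA mulrC.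
  + by case: c => [|? ?] /=; rewrite ?scaler0 ?addr0.
  + by case: c => [|? ?] /=; rewrite ?scaler0 ?addr0.
  by case: c => [|? ?] /=; rewrite ?scaler0 ?addr0.
case: u hw => [|d [|d' u]] hw /=; last 2 first.
- by case: d hw => [|? [|? [|? ?]]] hw; rewrite ?scaler0.
- by case: d hw => [|? [|? [|? ?]]] hw; rewrite ?scaler0.
case: v hw => [|d v] hw; last first.
  by case: c hw => [|? [|? [|? ?]]] hw; case: c' hw => [|? ?] hw; rewrite /= ?scaler0.
case: c hw => [|p [|p' [|? ?]]]; case: c' => [|? ?] hw /=; rewrite ?scaler0 //.
have hq : ghom q.1 q.2 by apply: (hw [:: q; q']); rewrite !inE eqxx ?orbT.
have hq' : ghom q'.1 q'.2 by apply: (hw [:: q; q']); rewrite !inE eqxx ?orbT.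
rewrite (bra _ _ _ _ hq hq') oppr_ksgn /sdeg; kcongr.
Qed.

End LieCogenerator.

Section DerivedBracket.
Variables (K : fieldType) (g : gradedSpace K) (br : g -> g -> g) (d : nat -> g -> g).
Hypothesis br_lie : lie_bracket br.
Hypothesis d_lin : forall n, linear (d n).
Hypothesis d_deg : forall n, has_degree (2 * n%:Z - 1) (d n).

Lemma foldl_br_linear t : linear (fun x => foldl br x t).
Proof.
have [[brl _] _ _ _] := br_lie.
elim: t => [|y t ih] a x x' //=.
by rewrite brl ih.
Qed.

Lemma foldl_br_hom i x (t : seq (entry g)) : ghom i x -> (forall q, q \in t -> ghom q.1 q.2) ->
  ghom (i + \sum_(q <- t) q.1) (foldl br x [seq q.2 | q <- t]).
Proof.
have [_ brh _ _] := br_lie.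
elim: t i x => [|q t ih] i x hx ht /=; first by rewrite big_nil addr0.
rewrite big_cons addrA; apply: ih; last by move=> r hr; apply: ht; rewrite inE hr orbT.
by apply: brh => //; apply: ht; rewrite mem_head.
Qed.

Lemma derived_bracket_linear n : multilinear_op n (derived_bracket br d n).
Proof.
have [[_ brr] _ _ _] := br_lie.
move=> [|x0 s] t a x y _ /=; first by rewrite d_lin foldl_br_linear.
by rewrite !foldl_cat /= brr foldl_br_linear.
Qed.

Lemma derived_bracket_degree n : (0 < n)%N -> degree_op n (shdeg n) (derived_bracket br d n).
Proof.
case: n => // n _ [|q v] //= _ hv.
rewrite big_cons (_ : _ + shdeg _ = q.1 + (2 * n%:Z - 1) + \sum_(r <- v) r.1).
  apply: foldl_br_hom; last by move=> r hr; apply: hv; rewrite inE hr orbT.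
  by apply: d_deg; apply: hv; rewrite mem_head.
by rewrite /shdeg intS; ring.
Qed.

End DerivedBracket.

Arguments psi_of : simpl never.
Arguments lie_corestr : simpl never.

(** * The square of the codifferential *)

Section Squares.
Variables (K : fieldType) (g : gradedSpace K) (br : g -> g -> g) (d : nat -> g -> g).
Hypothesis br_lie : lie_bracket br.
Hypothesis d_lin : forall n, linear (d n).
Hypothesis d_deg : forall n, has_degree (2 * n%:Z - 1) (d n).
Hypothesis d_der : forall n, derivation br (2 * n%:Z - 1) (d n).
Implicit Types (c : letter g) (u v w : word g) (q : entry g) (a b t : seq (entry g)).
Local Notation dsh_e := (dsh (@sdeg K g)).
Local Notation dsh_l := (dsh (@ldeg K g)).
Local Notation phiL := (lie_corestr br).
Local Notation phiB := (leib_total (derived_bracket br d)).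
Local Notation psiL := (psi_of (-1) phiL).
Local Notation psiB := (psi_of (-1) phiB).

Let phiL_cogen : cogenerator (-1) phiL := lie_cogenerator br_lie.
Let phiB_cogen : cogenerator (-1) phiB :=
  leib_total_cogenerator (fun n _ => derived_bracket_linear (d := d) br_lie d_lin (n := n))
    (fun n => @derived_bracket_degree K g br d br_lie d_deg n) erefl.

Lemma cogen_entry0 p (phi : word g -> g) i u v c c' : cogenerator p phi ->
  phi (u ++ (c ++ (i, 0) :: c') :: v) = 0.
Proof.
move=> h; have := cogen_lin h u v c c' i 1 0 0.
by rewrite scaler0 addr0 scale1r => /eqP; rewrite -subr_eq subrr eq_sym => /eqP.
Qed.

Lemma br0l y : br 0 y = 0.
Proof.
have [[brl _] _ _ _] := br_lie.
by have := brl y (-1) 0 0; rewrite scaleN1r addNr scaleN1r addNr.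
Qed.

Lemma brDl x y z : br (x + y) z = br x z + br y z.
Proof. by have [[brl _] _ _ _] := br_lie; have := brl z 1 x y; rewrite !scale1r. Qed.

Lemma brZl (k : K) x z : br (k *: x) z = k *: br x z.
Proof. by have [[brl _] _ _ _] := br_lie; have := brl z k x 0; rewrite br0l !addr0. Qed.

Lemma br0r y : br y 0 = 0.
Proof.
have [[_ brr] _ _ _] := br_lie.
by have := brr y (-1) 0 0; rewrite scaleN1r addNr scaleN1r addNr.
Qed.

Lemma brZr (k : K) x z : br x (k *: z) = k *: br x z.
Proof. by have [[_ brr] _ _ _] := br_lie; have := brr x k z 0; rewrite br0r !addr0. Qed.

Lemma br_sym i j x y : ghom i x -> ghom j y -> br x y = ksgn K (i * j + 1) *: br y x.
Proof. by have [_ _ h _] := br_lie => hx hy; rewrite (h i j) // scale_ksgnN. Qed.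

Lemma jacobi i j x y z : ghom i x -> ghom j y ->
  br x (br y z) = br (br x y) z + ksgn K (i * j) *: br y (br x z).
Proof. by have [_ _ _ h] := br_lie; apply: h. Qed.

Lemma phiL_size w : size w != 1%N -> phiL w = 0.
Proof. by case: w => [|[|? [|? [|? ?]]] [|? ?]]. Qed.

Lemma phiL_size_letter c : size c != 2%N -> phiL [:: c] = 0.
Proof. by case: c => [|? [|? [|? ?]]]. Qed.

Lemma phiL0 i c : phiL [:: (i, 0) :: c] = 0.
Proof. exact: (cogen_entry0 i [::] [::] [::] c phiL_cogen). Qed.

Lemma psiE p (phi : word g -> g) w : hom_word w -> psi_of p phi w = (wdeg w + p - 2, phi w).
Proof. by move=> h; rewrite /psi_of asboolT. Qed.

Lemma psi0 p (phi : word g -> g) w : phi w = 0 -> psi_of p phi w = (wdeg w + p - 2, 0).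
Proof. by move=> h; rewrite /psi_of h if_same. Qed.

(** A word in the image of q has at least two letters, while the Lie corestriction sees only
    one-letter words. *)
Lemma psiL_cobar u x : x \in supp (cobar u) -> phiL x = 0.
Proof.
case: u => [|c u] //; rewrite supp_cobar_cons mem_cat => /orP[]/mapP[y hy ->].
  exact: phiL_size.
apply: phiL_size; move: hy; case: u => // c' u; rewrite supp_cobar_cons mem_cat.
by case/orP=> /mapP[? _ ->].
Qed.

Lemma hom_letter c q : hom_word [:: c] -> q \in c -> ghom q.1 q.2.
Proof. by move=> h; apply: h; rewrite mem_head. Qed.

Lemma lie_square w : hom_word w -> ev (coder (-1) psiL w) phiL = 0.
Proof.
case/lastP: w => [|u c] hw; first exact: ev_coder0.
rewrite (ev_coder_letter _ _ _ _ phiL_size) ev_cogen.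
rewrite [X in _ *: X]ev_in0 ?scaler0 ?addr0; last first.
  by move=> x /psiL_cobar /psi0 ->; apply: phiL0.
case: u hw => [|c0 u] hw; last first.
  rewrite ev_in0 // => x _; rewrite psi0 ?phiL0 // phiL_size //.
  by rewrite size_rcons.
have [sc|sc] := eqVneq (size c) 3%N; last first.
  rewrite ev_in0 // => x /dsh_size e.
  have [s1|s1] := eqVneq (size x.1) 2%N; last by rewrite psi0 ?phiL0 // phiL_size_letter.
  by apply: phiL_size_letter => /=; apply: contra sc => /eqP[s2]; rewrite e s1 s2.
case: c sc hw => [|x [|y [|z []]]] //= _ hw.
have hx : ghom x.1 x.2 by apply: (hom_letter hw); rewrite !inE eqxx ?orbT.
have hy : ghom y.1 y.2 by apply: (hom_letter hw); rewrite !inE eqxx ?orbT.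
have hz : ghom z.1 z.2 by apply: (hom_letter hw); rewrite !inE eqxx ?orbT.
have hP q q' : ghom q.1 q.2 -> ghom q'.1 q'.2 -> hom_word [:: [:: q; q']].
  by move=> h h' c r; rewrite inE => /eqP ->; rewrite !inE => /orP[]/eqP->.
rewrite !ev_dsh_cons !ev_dsh_nil /=.
have e1 p : phiL [:: [:: p]] = 0 by [].
have e3 p q r : phiL [:: [:: p; q; r]] = 0 by [].
have e4 p q r s : phiL [:: [:: p; q; r; s]] = 0 by [].
rewrite !e1 !e3 e4 !scaler0 !addr0 !add0r.
rewrite (psiE _ _ (hP x y hx hy)) (psiE _ _ (hP x z hx hz)) (psiE _ _ (hP y z hy hz)).
have e2 p q : phiL [:: [:: p; q]] = ksgn K (p.1 + 1) *: br p.2 q.2 by [].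
rewrite !e2 /= !brZl !scale_ksgnD.
have [_ brh _ _] := br_lie.
(* Of the three double brackets only [[y, z], x] is expanded by the Jacobi identity; the two
   resulting terms then cancel the other two. *)
rewrite (br_sym (brh _ _ _ _ hy hz) hx) (jacobi _ hx hy) scalerDr !scale_ksgnD.
rewrite (br_sym hy (brh _ _ _ _ hx hz)).
rewrite !scale_ksgnD scalerDr !scale_ksgnD !addrA; degs; rewrite /sdeg.
rewrite [LHS](ACl ((1*3)*(2*4)))/= -[RHS]addr0; congr (_ + _); apply/eqP; rewrite addr_eq0;
  apply/eqP; rewrite scale_ksgnN; kcongr.
Qed.

(* The first entries of a and z are the slots of a derived bracket: for fixed a
   it is a derivation in z, since inner derivations are derivations. *)
Definition slot (k : nat) (s : seq g) (z : g) : g :=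
  if s is x :: s' then br (foldl br (d k x) s') z else d k z.

Local Notation vals a := [seq q.2 | q <- a].
Definition hom_entries a := forall q, q \in a -> ghom q.1 q.2.

Lemma slot_hom k a i z : hom_entries a -> ghom i z ->
  ghom (i + (\sum_(q <- a) q.1 + 2 * k%:Z - 1)) (slot k (vals a) z).
Proof.
case: a => [|q a] ha hz /=.
  by rewrite big_nil add0r; apply: d_deg.
have [_ brh _ _] := br_lie.
rewrite big_cons addrC (_ : _ + _ - 1 = q.1 + (2 * k%:Z - 1) + \sum_(r <- a) r.1); last by ring.
apply: brh => //; apply: (foldl_br_hom br_lie); first by apply: d_deg; apply: ha; rewrite mem_head.
by move=> r hr; apply: ha; rewrite inE hr orbT.
Qed.

Lemma slot_der k a i x y : hom_entries a -> ghom i x ->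
  slot k (vals a) (br x y) = br (slot k (vals a) x) y +
    ksgn K ((\sum_(q <- a) q.1 + 1) * i) *: br x (slot k (vals a) y).
Proof.
case: a => [|q a] ha hx /=.
  by rewrite big_nil add0r mul1r (d_der k y hx); congr (_ + _ *: _); apply: ksgn_eq; parity.
have hA : ghom (q.1 + (2 * k%:Z - 1) + \sum_(r <- a) r.1) (foldl br (d k q.2) (vals a)).
  apply: (foldl_br_hom br_lie); first by apply: d_deg; apply: ha; rewrite mem_head.
  by move=> r hr; apply: ha; rewrite inE hr orbT.
rewrite (jacobi _ hA hx) big_cons; congr (_ + _ *: _); apply: ksgn_eq; parity.
Qed.

Lemma derived_bracket_slot n (s t : seq g) z :
  derived_bracket br d n (s ++ z :: t) = foldl br (slot n.-1 s z) t.
Proof. by case: s => [|x s] //=; rewrite foldl_cat. Qed.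

Definition letters a : word g := [seq [:: q] | q <- a].

Lemma letters_single a : single_letters (letters a).
Proof. by elim: a. Qed.

Lemma letters_cat a b : letters (a ++ b) = letters a ++ letters b.
Proof. exact: map_cat. Qed.

Lemma letters_rcons a q : letters (rcons a q) = rcons (letters a) [:: q].
Proof. exact: map_rcons. Qed.

Lemma letters_nil a : ([::] \in letters a) = false.
Proof. by elim: a. Qed.

Lemma flatten_letters a : flatten (letters a) = a.
Proof. by elim: a => //= q a ->. Qed.

Lemma letters_hom a : hom_entries a -> hom_word (letters a).
Proof.
move=> ha c q /mapP[r ra ->]; rewrite inE => /eqP->; exact: ha.
Qed.

Lemma hom_letters a : hom_word (letters a) -> hom_entries a.
Proof. by move=> h q qa; apply: (h [:: q]); rewrite ?map_f ?mem_head. Qed.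

Lemma hom_word_cat u v : hom_word (u ++ v) <-> hom_word u /\ hom_word v.
Proof.
split=> [h|[h1 h2] c q]; last by rewrite mem_cat => /orP[/h1|/h2]; apply.
by split=> c q cw; apply: h; rewrite mem_cat cw ?orbT.
Qed.

Lemma single_lettersP u : single_letters u -> exists a, u = letters a.
Proof.
elim: u => [|c u ih] /=; first by exists [::].
by case: c => [|q []] //= /ih [a ->]; exists (q :: a).
Qed.

Lemma weight_size u : [::] \notin u -> (size u <= weight u)%N.
Proof.
elim: u => // c u ih; rewrite inE negb_or weight_cons => /andP[hc /ih h] /=.
by case: c hc => //= q c _; rewrite addSn ltnS (leq_trans h) // leq_addl.
Qed.

Lemma weight_size_single u : [::] \notin u -> weight u = size u -> single_letters u.
Proof.
elim: u => // c u ih; rewrite inE negb_or weight_cons => /andP[hc hu] /=.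
have := weight_size hu; case: c hc => [|q [|r c]] //= _ le; first by rewrite add1n => -[/(ih hu)].
by move=> e; move: le; lia.
Qed.

Lemma double_letterP u : [::] \notin u -> weight u = (size u).+1 ->
  exists a x y b, u = letters a ++ [:: x; y] :: letters b.
Proof.
elim: u => // c u ih; rewrite inE negb_or weight_cons => /andP[hc hu] /=.
have le := weight_size hu; case: c hc => [|q [|r [|r' c]]] //= _.
- rewrite add1n => -[/(ih hu) [a [x [y [b ->]]]]].
  by exists (q :: a), x, y, b.
- rewrite add2n => -[/(weight_size_single hu) /single_lettersP [b ->]].
  by exists [::], q, r, b.
by move=> e; move: le; lia.
Qed.

Lemma phiB_letters a : phiB (letters a) = derived_bracket br d (size a) (vals a).
Proof.
by rewrite /leib_total /leib_corestr eqxx -/(single_letters (letters a)) letters_single flatten_letters size_map.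
Qed.

Lemma phiB_single u : single_letters u = false -> phiB u = 0.
Proof. by rewrite /leib_total /leib_corestr eqxx /single_letters => ->. Qed.

Lemma single_letters_cat u v : single_letters (u ++ v) = single_letters u && single_letters v.
Proof. exact: all_cat. Qed.

Lemma single_letters_rcons v c : single_letters (rcons v c) = single_letters v && (size c == 1%N).
Proof. by rewrite -cats1 single_letters_cat /= andbT. Qed.

(** The Lie part acts on one letter at a time, so the produced letter consumes no letter of [u]. *)
Lemma coder_lie_rcons (E : lmodType K) (G : word g -> E) u c :
  (forall v i c, G (rcons v ((i, 0) :: c)) = 0) ->
  ev (coder (-1) psiL (rcons u c)) G = \S_(x <- coder (-1) psiL u) G (rcons x c) +
    ksgn K (wdeg u) *: (\S_(x <- dsh_e c) G (rcons u (psiL [:: x.1] :: x.2))).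
Proof.
move=> hG; rewrite ev_coder_rcons; congr (_ + _).
rewrite -[RHS](ev_dsh_nil_r (@ldeg K g) u (fun v => ksgn K (wdeg v) *:
  (\S_(x <- dsh_e c) G (rcons v (psiL [:: x.1] :: x.2))))).
apply: eq_ev => y; rewrite ev_cogen [X in _ + _ *: X]ev_in0; last first.
  by move=> x /psiL_cobar /psi0 ->; apply: hG.
rewrite scaler0 addr0; case: eqP => [->|/eqP hy]; first by kcongr.
rewrite ev_in0 ?scaler0 // => x _; rewrite psi0 ?hG // phiL_size // size_rcons eqSS size_eq0 //.
Qed.

Lemma phiB_rcons0 v w i c : phiB (rcons v ((i, 0) :: c) ++ w) = 0.
Proof. by rewrite cat_rcons; apply: (cogen_entry0 i v w [::] c phiB_cogen). Qed.

(** The tail [letters t] collects the letters already removed from the end, which the induction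
    leaves untouched. A nonzero term must consist of letters of size one after two entries of one
    letter have been merged, which fixes the weight. *)
Lemma leib_after_lie_eq0 u t : [::] \notin u -> weight u != (size u).+1 ->
  \S_(x <- coder (-1) psiL u) phiB (x ++ letters t) = 0.
Proof.
elim/last_ind: u t => [|u c ih] t; first by rewrite ev_coder0.
rewrite mem_rcons inE negb_or eq_sym weight_rcons size_rcons => /andP[hc hu] hw.
rewrite (coder_lie_rcons (G := fun x => phiB (x ++ letters t))); last first.
  by move=> v i c'; apply: phiB_rcons0.
rewrite [X in _ *: X]ev_in0 ?scaler0 ?addr0; last first.
  move=> x hx; have [s2|s2] := eqVneq (size x.1) 2%N; last by rewrite psi0 ?phiB_rcons0 // phiL_size_letter.
  apply: phiB_single; apply: contraNF hw; rewrite single_letters_cat single_letters_rcons /=.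
  case/andP=> /andP[/single_letters_weight -> /eqP[s0]] _.
  by rewrite (dsh_size hx) s2 s0 addn0 addn2.
have [s1|s1] := eqVneq (size c) 1%N; last first.
  by apply: ev_in0 => x _; apply: phiB_single; rewrite single_letters_cat single_letters_rcons (negbTE s1) andbF.
case: c s1 hc hw => [|q []] // _ _ hw.
rewrite -[RHS](ih (q :: t) hu); last by move: hw; rewrite addn1 eqSS.
by apply: eq_ev => x; rewrite cat_rcons.
Qed.

Lemma leib_after_lie a x y b t :
  \S_(z <- coder (-1) psiL (letters a ++ [:: x; y] :: letters b)) phiB (z ++ letters t) =
  ksgn K (wdeg (letters a)) *: phiB (letters a ++ [:: psiL [:: [:: x; y]]] :: letters (b ++ t)).
Proof.
elim/last_ind: b t => [|b q ih] t.
  rewrite cats1 (coder_lie_rcons (G := fun x => phiB (x ++ letters t))); last first.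
    by move=> v i c'; apply: phiB_rcons0.
  rewrite ev_in0 ?add0r; last first.
    by move=> z _; apply: phiB_single; rewrite single_letters_cat single_letters_rcons andbF.
  congr (_ *: _).
  rewrite -[RHS](ev_dsh_nil_r (@sdeg K g) [:: x; y] (fun c =>
     phiB (letters a ++ [:: psiL [:: c]] :: letters ([::] ++ t)))).
  apply: eq_ev => z; case: eqP => [->|/eqP hz]; first by rewrite cat_rcons.
  apply: phiB_single; rewrite single_letters_cat single_letters_rcons /=.
  by rewrite eqSS size_eq0 (negbTE hz) andbF.
rewrite letters_rcons -rcons_cons -rcons_cat.
rewrite (coder_lie_rcons (G := fun x => phiB (x ++ letters t))); last first.
  by move=> v i c'; apply: phiB_rcons0.
rewrite [X in _ *: X]ev_in0 ?scaler0 ?addr0; last first.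
  move=> z _; apply: phiB_single.
  by rewrite single_letters_cat single_letters_rcons single_letters_cat /= andbF.
rewrite cat_rcons -(ih (q :: t)).
by apply: eq_ev => z; rewrite cat_rcons.
Qed.

(** The functional sees only words of letters of size one, so [[:: x; y]] must be split into its two
    entries, in either order. *)
Lemma cobar_double (E : lmodType K) (H : word g -> E) a x y b :
  (forall w, single_letters w = false -> H w = 0) ->
  ev (cobar (letters a ++ [:: x; y] :: letters b)) H =
  ksgn K (wdeg (letters a)) *:
    (ksgn K (sdeg x) *: H (letters a ++ [:: [:: x], [:: y] & letters b]) +
     ksgn K (sdeg x * sdeg y + sdeg y) *: H (letters a ++ [:: [:: y], [:: x] & letters b])).
Proof.
move=> hH.
have h1 : \S_(z <- cobar (letters a)) H (z ++ [:: x; y] :: letters b) = 0.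
  by apply: ev_in0 => z _; rewrite hH // single_letters_cat /= andbF.
have h2 : \S_(z <- cobar (letters b)) H (letters a ++ [:: x; y] :: z) = 0.
  by apply: ev_in0 => z _; rewrite hH // single_letters_cat /= andbF.
rewrite ev_cobar_cat ev_cobar_cons h1 h2 add0r scaler0 addr0.
congr (_ *: _); rewrite ev_sp !ev_dsh_cons !ev_dsh_nil /=.
rewrite [H (_ ++ [:: [::], _ & _])]hH ?single_letters_cat /= ?andbF //.
rewrite [H (_ ++ [:: [:: x; y], _ & _])]hH ?single_letters_cat /= ?andbF //.
rewrite !scaler0 addr0 add0r !tdeg_sdeg !cdeg_cons !cdeg0 !addr0 !scale_ksgnD.
by congr (_ + _); kcongr.
Qed.

Lemma foldl_brD x y (s : seq g) : foldl br (x + y) s = foldl br x s + foldl br y s.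
Proof. by have := foldl_br_linear br_lie s 1 x y; rewrite !scale1r. Qed.

Lemma foldl_br0 (s : seq g) : foldl br 0 s = 0.
Proof. by elim: s => //= y s; rewrite br0l. Qed.

Lemma foldl_brZ (k : K) x (s : seq g) : foldl br (k *: x) s = k *: foldl br x s.
Proof. by have := foldl_br_linear br_lie s k x 0; rewrite foldl_br0 !addr0. Qed.

Lemma dZ n (k : K) x : d n (k *: x) = k *: d n x.
Proof.
have d0 : d n 0 = 0 by have := d_lin n (-1) 0 0; rewrite scaleN1r addNr scaleN1r addNr.
by have := d_lin n k x 0; rewrite d0 !addr0.
Qed.

Lemma slotZ n (s : seq g) (k : K) z : slot n s (k *: z) = k *: slot n s z.
Proof. by case: s => [|x s] /=; rewrite ?dZ ?brZr. Qed.

Lemma letters_wdeg a : wdeg (letters a) = \sum_(q <- a) q.1 + 2 * (size a)%:Z.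
Proof. by rewrite single_letters_wdeg ?letters_single // flatten_letters size_map. Qed.

Lemma slot_br k a (x y : entry g) : hom_entries a -> ghom x.1 x.2 -> ghom y.1 y.2 ->
  slot k (vals a) (br x.2 y.2) = br (slot k (vals a) x.2) y.2 +
    ksgn K (x.1 * y.1 + 1) *: br (slot k (vals a) y.2) x.2.
Proof.
move=> ha hx hy; rewrite (slot_der _ _ ha hx); congr (_ + _).
by rewrite (br_sym hx (slot_hom k ha hy)); kcongr.
Qed.

Lemma phiB_mid a z b : phiB (letters a ++ [:: z] :: letters b) =
  foldl br (slot (size a + size b) (vals a) z.2) (vals b).
Proof.
have := phiB_letters (a ++ z :: b); rewrite letters_cat /= => ->.
by rewrite map_cat /= derived_bracket_slot size_cat /= addnS.
Qed.

Lemma hom_entries_cat a b : hom_entries (a ++ b) <-> hom_entries a /\ hom_entries b.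
Proof.
split=> [h|[h1 h2] q]; last by rewrite mem_cat => /orP[/h1|/h2].
by split=> q hq; apply: h; rewrite mem_cat hq ?orbT.
Qed.

Lemma lie_leib_square w : hom_word w -> [::] \notin w ->
  ev (coder (-1) psiL w) phiB + ev (coder (-1) psiB w) phiL = 0.
Proof.
move=> hw wn.
have eB : ev (coder (-1) psiL w) phiB = \S_(z <- coder (-1) psiL w) phiB (z ++ letters [::]).
  by apply: eq_ev => z; rewrite cats0.
have e1 p : phiL [:: [:: p]] = 0 by [].
have e2 p q : phiL [:: [:: p; q]] = ksgn K (p.1 + 1) *: br p.2 q.2 by [].
have e3 p q r : phiL [:: [:: p; q; r]] = 0 by [].
have [sw|sw] := eqVneq (weight w) (size w).+1; last first.
  rewrite eB (leib_after_lie_eq0 [::] wn sw) add0r.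
  case/lastP: w hw wn sw {eB} => [|u c] hw wn sw; first by rewrite ev_coder0.
  rewrite weight_rcons size_rcons in sw.
  rewrite (ev_coder_letter _ _ _ _ phiL_size) ev_cogen !ev_in0 ?scaler0 ?addr0 //.
  - move=> x hx; have [s1|s1] := eqVneq (size c) 1%N; last by rewrite phiL_size_letter.
    have [s2|s2] := boolP (single_letters x); last first.
      by rewrite psi0 ?phiL0 // phiB_single //; apply/negbTE.
    move: sw; rewrite -(cobar_weight hx) single_letters_weight // s1 (cobar_size hx) addn1.
    by rewrite eqxx.
  move=> x hx; have [s2|s2] := boolP (single_letters (rcons u x.1)); last first.
    by rewrite psi0 ?phiL0 // phiB_single //; apply/negbTE.
  apply: phiL_size_letter; apply: contra sw; rewrite /= eqSS => /eqP s1.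
  move: s2; rewrite single_letters_rcons => /andP[/single_letters_weight -> /eqP s0].
  by rewrite (dsh_size hx) s0 s1 addn2.
have [a [x [y [b ew]]]] := double_letterP wn sw.
rewrite eB; move: hw; rewrite ew => /hom_word_cat[/hom_letters ha] /(hom_word_cat [:: _])[hxy /hom_letters hb].
have hx : ghom x.1 x.2 by apply: (hom_letter hxy); rewrite !inE eqxx ?orbT.
have hy : ghom y.1 y.2 by apply: (hom_letter hxy); rewrite !inE eqxx ?orbT.
rewrite leib_after_lie cats0 phiB_mid (psiE _ _ hxy) /= e2 slotZ foldl_brZ.
rewrite (slot_br _ ha hx hy) foldl_brD foldl_brZ scalerDr !scale_ksgnD letters_wdeg.
(* If the double letter is last, the inner Leibniz operation takes one of its two entries and the
   outer Lie bracket is with the other one. *)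
case/lastP: b hb {ew eB} => [|b q] hb.
  rewrite cats1 (ev_coder_letter _ _ _ _ phiL_size) ev_cogen.
  have h0 : \S_(z <- cobar (letters a)) phiL [:: psiB z :: [:: x; y]] = 0.
    by apply: ev_in0 => z _; apply: e3.
  rewrite h0 scaler0 addr0 !ev_dsh_cons !ev_dsh_nil /= e1 e3.
  have hq z : ghom z.1 z.2 -> hom_word (rcons (letters a) [:: z]).
    move=> hz; rewrite -cats1; apply/hom_word_cat; split; first exact: letters_hom.
    by apply: (letters_hom (a := [:: z])) => r; rewrite inE => /eqP ->.
  have vq z : phiB (rcons (letters a) [:: z]) = slot (size a) (vals a) z.2.
    by rewrite -cats1 (phiB_mid a z [::]) addn0.
  rewrite !psiE; try exact: hq.
  rewrite !e2 /= !vq addn0 !scaler0 addr0 add0r scalerDr !scale_ksgnD.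
  rewrite !wdeg_rcons !letters_wdeg addrACA -[RHS]addr0; congr (_ + _);
    apply/eqP; rewrite addr_eq0; apply/eqP; rewrite scale_ksgnN /sdeg; degs; rewrite /sdeg; ksgn_congr.
(* Otherwise the double letter is split by q in the correction term of [cogen], and the outer Lie
   bracket is with [q], the last argument: it is the last bracket of the iterated bracket. *)
rewrite letters_rcons -rcons_cons -rcons_cat.
rewrite (ev_coder_letter _ _ _ _ phiL_size) ev_cogen !ev_dsh_cons !ev_dsh_nil /= e1.
rewrite [psiB (rcons _ [::])]psi0 ?phiL0 ?scaler0 ?addr0 ?add0r; last first.
  by apply: (cogen_nil_in phiB_cogen); rewrite mem_rcons mem_head.
rewrite (cobar_double (H := fun z => phiL [:: [:: psiB z; q]])); last first.
  by move=> z hz; rewrite psi0 ?phiL0 ?phiB_single.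
move: hb; rewrite -cats1 => /hom_entries_cat[hb hq].
have hz p r : ghom p.1 p.2 -> ghom r.1 r.2 -> hom_word (letters a ++ [:: [:: p], [:: r] & letters b]).
  move=> hp hr; apply/hom_word_cat; split; first exact: letters_hom.
  by apply: (letters_hom (a := [:: p, r & b])) => s; rewrite !inE => /or3P[/eqP->|/eqP->|/hb].
have vz p r : phiB (letters a ++ [:: [:: p], [:: r] & letters b]) =
    foldl br (br (slot (size a + (size b).+1) (vals a) p.2) r.2) (vals b).
  exact: (phiB_mid a p (r :: b)).
rewrite !psiE; try exact: hz.
rewrite !e2 /= !vz cats1 size_rcons !map_rcons !foldl_rcons scalerDr !scale_ksgnD.
rewrite !scalerDr !scale_ksgnD addrACA -[RHS]addr0; congr (_ + _);
  apply/eqP; rewrite addr_eq0; apply/eqP; rewrite scale_ksgnN; degs;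
  rewrite !letters_wdeg /sdeg; ksgn_congr.
Qed.
Lemma leib_square_eq0 w t : [::] \notin w -> weight w != size w ->
  \S_(z <- coder (-1) psiB w) phiB (z ++ letters t) = 0.
Proof.
elim/last_ind: w t => [|u c ih] t; first by rewrite ev_coder0.
rewrite mem_rcons inE negb_or eq_sym weight_rcons size_rcons => /andP[hc hu] hw.
rewrite ev_coder_rcons [X in _ + X]ev_in0 ?addr0; last first.
  move=> y hy.
  have h0 : \S_(x <- cobar y.2) phiB (rcons y.1 (psiB x :: c) ++ letters t) = 0.
    apply: ev_in0 => x _; apply: phiB_single; rewrite single_letters_cat single_letters_rcons /=.
    by rewrite eqSS size_eq0 (negbTE hc) andbF.
  rewrite ev_cogen h0 scaler0 addr0 ev_in0 ?scaler0 // => x hx.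
  have [s2|s2] := boolP (single_letters (rcons y.2 x.1)); last first.
    by rewrite psi0 ?phiB_rcons0 // phiB_single //; apply/negbTE.
  apply: phiB_single; apply: contraNF hw; rewrite single_letters_cat single_letters_rcons /= eqSS.
  case/andP=> /andP[/single_letters_weight e1 /eqP e0] _.
  move: s2; rewrite single_letters_rcons => /andP[/single_letters_weight e2 /eqP e3].
  by rewrite (dsh_weight hy) (dsh_size hy) (dsh_size hx) e1 e2 e3 e0 addn0 addn1.
have [s1|s1] := eqVneq (size c) 1%N; last first.
  by apply: ev_in0 => x _; apply: phiB_single; rewrite single_letters_cat single_letters_rcons (negbTE s1) andbF.
case: c s1 hc hw => [|q []] // _ _ hw.
rewrite -[RHS](ih (q :: t) hu); last by move: hw; rewrite addn1 eqSS.
by apply: eq_ev => x; rewrite cat_rcons.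
Qed.

Local Notation dsh_d := (dsh (fun q : entry g => q.1)).
Local Notation sumd a := (\sum_(q <- a) q.1).

(** The double suspension is even, so unshuffling letters of size one has the same signs as
    unshuffling the entries by their degrees in g. *)
Lemma ev_dsh_letters (E : lmodType K) a (F : word g * word g -> E) :
  ev (dsh_l (letters a)) F = \S_(y <- dsh_d a) F (letters y.1, letters y.2).
Proof.
elim: a F => [|q a ih] F; first by rewrite !ev_dsh_nil.
rewrite [letters _]/= !ev_dsh_cons ih ih; congr (_ + _); apply: eq_ev => y /=.
degs; rewrite letters_wdeg /tdeg /sdeg; ksgn_congr.
Qed.

Definition arr (k : nat) (s : seq g) : g := if s is x :: s' then foldl br (d k x) s' else 0.

Lemma arr_rcons k (s : seq g) x : s != [::] -> arr k (rcons s x) = br (arr k s) x.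
Proof. by case: s => //= y s _; rewrite foldl_rcons. Qed.

Lemma slot_arr k (s : seq g) x : slot k s x = arr k (rcons s x).
Proof. by case: s => [|y s] //=; rewrite foldl_rcons. Qed.

Lemma slotE k (s : seq g) x : s != [::] -> slot k s x = br (arr k s) x.
Proof. by case: s. Qed.

Lemma arr_hom k a : hom_entries a -> ghom (2 * k%:Z - 1 + sumd a) (arr k (vals a)).
Proof.
case: a => [|q a] ha /=; first exact: ghom0.
rewrite big_cons addrA [_ + q.1]addrC; apply: (foldl_br_hom br_lie).
  by apply: d_deg; apply: ha; rewrite mem_head.
by move=> r hr; apply: ha; rewrite inE hr orbT.
Qed.

(** This is the derivation property solved for the bracket with the next argument. Either [q] joins
    the arguments of the inner operation, or, after an exchange by antisymmetry, it joins those
    which precede the inner value. *)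
Lemma slot_arr_rcons k j a b q : hom_entries a -> hom_entries b -> ghom q.1 q.2 -> b != [::] ->
  br (slot k (vals a) (arr j (vals b))) q.2 = slot k (vals a) (arr j (vals (rcons b q))) +
  ksgn K (q.1 * (1 + sumd b)) *: slot k (vals (rcons a q)) (arr j (vals b)).
Proof.
move=> ha hb hq b0; have hA := arr_hom j hb.
have b0' : vals b != [::] by case: b b0 {hb hA}.
have haq : hom_entries (rcons a q).
  by move=> r; rewrite mem_rcons inE => /orP[/eqP->//|/ha].
have hB := arr_hom k haq.
rewrite [in X in _ = X + _]map_rcons arr_rcons // (slot_der _ _ ha hA) -addrA -[LHS]addr0.
congr (_ + _); rewrite slot_arr -map_rcons (br_sym hA hB) slotE; last by rewrite map_rcons; case: (vals a).
apply/esym/eqP; rewrite addr_eq0 scale_ksgnD scale_ksgnN; apply/eqP.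
rewrite -cats1 big_cat big_seq1 /=; ksgn_congr.
Qed.

(** If the inner operation ends before [q], then [q] moves to the tail; otherwise it ends at [q],
    which gives the sum over the unshuffles of [a]. *)
Lemma leib_coder_rcons a q t : hom_entries (rcons a q) ->
  \S_(z <- coder (-1) psiB (letters (rcons a q))) phiB (z ++ letters t) =
  \S_(z <- coder (-1) psiB (letters a)) phiB (z ++ letters (q :: t)) +
  foldl br (\S_(y <- dsh_d a) (ksgn K (sumd y.1) *:
    slot (size y.1 + size t) (vals y.1) (arr (size y.2) (vals (rcons y.2 q))))) (vals t).
Proof.
move=> haq; rewrite letters_rcons ev_coder_rcons; congr (_ + _).
  by apply: eq_ev => z; rewrite cat_rcons.
rewrite (ev_lin _ _ (foldl_br_linear br_lie (vals t))) ev_dsh_letters; apply: eq_ev_in => y hy.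
have hyq : hom_word (rcons (letters y.2) [:: q]).
  rewrite -letters_rcons; apply: letters_hom => r; rewrite mem_rcons inE => hr.
  apply: haq; rewrite mem_rcons inE; case/orP: hr => [->//|hr].
  by rewrite (dsh_mem r hy) hr !orbT.
rewrite /= foldl_brZ.
have h0 : \S_(x <- cobar (letters y.2)) phiB (rcons (letters y.1) (psiB x :: [:: q]) ++ letters t) = 0.
  by apply: ev_in0 => x _; apply: phiB_single; rewrite single_letters_cat single_letters_rcons /= andbF.
rewrite ev_cogen h0 scaler0 addr0 !ev_dsh_cons !ev_dsh_nil /=.
rewrite [X in _ + _ *: X]phiB_single ?scaler0 ?addr0; last first.
  by rewrite single_letters_cat single_letters_rcons /= andbF.
rewrite cat_rcons (psiE _ _ hyq) phiB_mid /= -letters_rcons phiB_letters size_rcons.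
rewrite letters_wdeg.
have -> : derived_bracket br d (size y.2).+1 (vals (rcons y.2 q)) =
    arr (size y.2) (vals (rcons y.2 q)) by case: (vals _).
by congr (_ *: _); apply: ksgn_eq; parity.
Qed.

Hypothesis d_square : forall n x, \sum_(i < n.+1) d i (d (n - i)%N x) = 0.

(* What remains, before the last size t brackets are taken, of the part of
   the sh Leibniz identity in which the inner operation ends in x :: a. The sum
   is over the unshuffles of x :: a which send x to the right. *)
Definition leib_defect x a r : g :=
  \sum_(i < r) \S_(y <- dsh_d a) (ksgn K (x.1 * sumd y.1 + sumd y.1) *:
    slot (size y.1 + i) (vals y.1) (arr (size y.2 + (r - i)) (vals (x :: y.2)))).

Lemma leib_defect_rcons (x q : entry g) a r : hom_entries (x :: rcons a q) ->
  br (leib_defect x a r.+1) q.2 =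
  \S_(y <- dsh_d (x :: a)) (ksgn K (sumd y.1) *:
    slot (size y.1 + r) (vals y.1) (arr (size y.2) (vals (rcons y.2 q)))) +
  leib_defect x (rcons a q) r.
Proof.
move=> hxaq.
have hx : ghom x.1 x.2 by apply: hxaq; rewrite mem_head.
have hq : ghom q.1 q.2 by apply: hxaq; rewrite inE mem_rcons mem_head orbT.
have ha : hom_entries a by move=> s hs; apply: hxaq; rewrite !inE mem_rcons inE hs !orbT.
(* In [P] the argument [q] goes to the inner operation, in [Q] to the arguments before it. The left
   side has both for i from 0 to r, and the new defect has [P] for i < r and [Q] for i > 0. What is
   left, [P] at r and [Q] at 0, is the sum over the unshuffles of [x :: a] with [x] on the right and
   on the left. *)
pose P i y := ksgn K (x.1 * sumd y.1 + sumd y.1) *: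
  slot (size y.1 + i) (vals y.1) (arr (size y.2 + (r.+1 - i)) (vals (x :: rcons y.2 q))).
pose Q i y := ksgn K (x.1 * sumd y.1 + sumd y.1 + q.1 * (1 + (x.1 + sumd y.2))) *:
  slot (size y.1 + i) (vals (rcons y.1 q)) (arr (size y.2 + (r.+1 - i)) (vals (x :: y.2))).
have -> : br (leib_defect x a r.+1) q.2 =
    \sum_(i < r.+1) \S_(y <- dsh_d a) P i y + \sum_(i < r.+1) \S_(y <- dsh_d a) Q i y.
  have brl : linear (br^~ q.2) by have [[h _] _ _ _] := br_lie; apply: h.
  have br_sum (I : Type) (s : seq I) (F : I -> g) :
      br (\sum_(i <- s) F i) q.2 = \sum_(i <- s) br (F i) q.2.
    by elim/big_rec2: _ => [|i z1 z2 _ <-]; rewrite ?br0l ?brDl.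
  rewrite br_sum -big_split; apply: eq_bigr => i _ /=; rewrite (ev_lin _ _ brl) -evD.
  apply: eq_ev_in => y hy; rewrite brZl.
  have h1 : hom_entries y.1 by move=> s hs; apply: ha; rewrite (dsh_mem s hy) hs.
  have h2 : hom_entries (x :: y.2).
    by move=> s; rewrite inE => /orP[/eqP->//|hs]; apply: ha; rewrite (dsh_mem s hy) hs orbT.
  by rewrite (slot_arr_rcons _ _ h1 h2 hq) // scalerDr scale_ksgnD big_cons.
have -> : leib_defect x (rcons a q) r =
    \sum_(i < r) \S_(y <- dsh_d a) P i y + \sum_(i < r) \S_(y <- dsh_d a) Q i.+1 y.
  rewrite -big_split; apply: eq_bigr => i _ /=; rewrite ev_dsh_rcons addrC /=.
  congr (_ + _); apply: eq_ev => y.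
    rewrite scale_ksgnD /Q size_rcons addSnnS subSS -cats1 big_cat big_seq1 /tdeg /=.
    by congr (_ *: _); apply: ksgn_eq; parity.
  rewrite /P size_rcons (_ : size y.2 + (r.+1 - i) = (size y.2).+1 + (r - i))%N //.
  by rewrite subSn ?addSnnS // ltnW.
have -> : \S_(y <- dsh_d (x :: a)) (ksgn K (sumd y.1) *:
    slot (size y.1 + r) (vals y.1) (arr (size y.2) (vals (rcons y.2 q)))) =
    \S_(y <- dsh_d a) P r y + \S_(y <- dsh_d a) Q 0%N y.
  rewrite ev_dsh_cons addrC; congr (_ + _).
    apply: eq_ev => y /=; rewrite scale_ksgnD /P subSnn addn1 /tdeg.
    by congr (_ *: _); apply: ksgn_eq; parity.
  (* With [x] in the left word, antisymmetry of the outermost bracket and cocommutativity exchange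
     the two operations, so that [x] becomes an argument of the inner one, as in [Q]. *)
  pose F s s' := ksgn K (sumd (x :: s)) *:
    slot (size (x :: s) + r) (vals (x :: s)) (arr (size s') (vals (rcons s' q))).
  rewrite (dsh_cocomm _ a F); apply: eq_ev_in => y hy.
  have h1 : hom_entries (rcons y.1 q).
    move=> s; rewrite mem_rcons inE => /orP[/eqP->//|hs].
    by apply: ha; rewrite (dsh_mem s hy) hs.
  have h2 : hom_entries (x :: y.2).
    by move=> s; rewrite inE => /orP[/eqP->//|hs]; apply: ha; rewrite (dsh_mem s hy) hs orbT.
  rewrite /F /Q slotE // [in RHS]slotE; last by rewrite map_rcons; case: (vals y.1).
  rewrite (br_sym (arr_hom _ h2) (arr_hom _ h1)) !scale_ksgnD addn0 subn0 [size (x :: _)]/= addSnnS.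
  rewrite [(size y.2 + _)%N]addnC.
  congr (_ *: _); apply: ksgn_eq; rewrite -cats1 !big_cat !big_cons /tdeg big_nil /=; parity.
by rewrite big_ord_recr big_ord_recl /= !addrA [LHS](ACl (2*3*1*4))/=.
Qed.

Lemma leib_square_letters x a t : hom_entries (x :: a ++ t) ->
  \S_(z <- coder (-1) psiB (letters (x :: a))) phiB (z ++ letters t) =
  - foldl br (leib_defect x a (size t)) (vals t).
Proof.
elim/last_ind: a t => [|a q ih] t hxat.
  rewrite (@leib_coder_rcons [::] x t); last first.
    by move=> r; rewrite inE => /eqP->; apply: hxat; rewrite mem_head.
  rewrite ev_coder0 add0r ev_dsh_nil /= big_nil scale1r.
  (* The only inner operation is d_0 on [x]. The remaining summands of the relation for n = [size t]
     are those of the defect. *)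
  have h := d_square (size t) x.2; rewrite big_ord_recr /= subnn in h.
  have {h} -> : d (size t) (d 0%N x.2) = - leib_defect x [::] (size t).
    apply/eqP; rewrite -addr_eq0 addrC -h; apply/eqP; congr (_ + _).
    apply: eq_bigr => i _; rewrite ev_dsh_nil /= big_nil mulr0 addr0 scale1r add0n.
    by [].
  by rewrite -scaleN1r foldl_brZ scaleN1r.
have h1 : hom_entries (x :: rcons a q).
  by move=> r hr; apply: hxat; rewrite -cat_cons mem_cat hr.
rewrite -rcons_cons leib_coder_rcons // ih; last first.
  by move=> r hr; apply: hxat; move: hr; rewrite cat_rcons.
rewrite [vals (q :: t)]/= [size (q :: t)]/= [foldl _ _ (_ :: _)]/=.
rewrite leib_defect_rcons // foldl_brD opprD addrAC addNr add0r.
by [].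
Qed.

Lemma leib_square w : hom_word w -> [::] \notin w ->
  ev (coder (-1) psiB w) phiB = 0.
Proof.
move=> hw wn; have -> : ev (coder (-1) psiB w) phiB =
    \S_(z <- coder (-1) psiB w) phiB (z ++ letters [::]).
  by apply: eq_ev => z; rewrite cats0.
have [sw|sw] := eqVneq (weight w) (size w); last exact: leib_square_eq0.
have [[|x a] ew] := single_lettersP (weight_size_single wn sw); first by rewrite ew ev_coder0.
rewrite ew leib_square_letters; first by rewrite /leib_defect big_ord0 oppr0.
by rewrite cats0; apply: hom_letters; rewrite -ew.
Qed.

End Squares.

(** * Composites and sums of induced coderivations *)

Section CogeneratorMaps.
Variables (K : fieldType) (charK0 : [pchar K] =i pred0) (g : gradedSpace K).
Implicit Types (c : letter g) (u v w : word g).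

(** Needed to replace [psi_of] by [phi] in composites, as the two agree only on homogeneous
    words. *)
Lemma coder_hom p (phi : word g -> g) (h : cogenerator p phi) w x :
  hom_word w -> x \in supp (coder p (psi_of p phi) w) -> hom_word x.
Proof.
elim/last_ind: w x => [//|u c ih] x; rewrite -cats1 => /hom_word_cat[hu hc].
rewrite cats1 /coder rev_rcons /= revK supp_cat supp_twist supp_bind mem_cat.
case/orP=> [/mapP[y hy ->]|/flattenP[s /mapP[y hy ->]]].
  by rewrite -cats1; apply/hom_word_cat; split=> //; apply: ih.
rewrite supp_twist => /mapP[l hl ->]; rewrite -cats1; apply/hom_word_cat; split.
  by move=> e q he; apply: hu; rewrite (dsh_mem e hy) he.
move=> e q; rewrite inE => /eqP ->; move: hl.
rewrite /cogen supp_cat !supp_twist mem_cat => /orP[]/mapP[z hz ->]; rewrite inE;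
  case/orP=> [/eqP->|hq]; try exact: psi_of_hom.
  by apply: (hom_letter hc); rewrite (dsh_mem q hz) hq orbT.
exact: (hom_letter hc).
Qed.

Lemma cogen_map_comp_corestr p (phi phi' : word g -> g)
    (h : cogenerator p phi) (h' : cogenerator p phi') w : hom_word w -> [::] \notin w ->
  corestr g (cogen_map h' (cogen_map h (barword w))) = ev (coder p (psi_of p phi) w) phi'.
Proof.
move=> hw wn; rewrite cogen_mapE // !ev_linear; apply: eq_ev_in => x hx.
by rewrite cogen_map_corestr psiE //; apply: coder_hom hw hx.
Qed.

Lemma coderivation_square_eq0 (f : {linear bar g -> bar g}) : coderivation (-1) f ->
  (forall w, valid_word w -> corestr g (f (f (barword w))) = 0) -> forall x, f (f x) = 0.
Proof.
move=> hf h x; have hff := coderivation_square (p := -1) isT hf.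
have [s ->] := bar_span x.
have h0 w : f (f (barword w)) = 0.
  apply: (coderivation_eq charK0 hff (coderivation0 g (-1 + -1)) (N := weight w)) => // v hv _.
  by rewrite [LHS]h // [RHS]linear0.
by rewrite !linear_sum big1 // => t _; rewrite !linearZ /= h0 scaler0.
Qed.

Lemma coderivation_sum p (f : nat -> {linear bar g -> bar g}) :
  (forall n, (0 < n)%N -> coderivation p (f n)) ->
  forall N, exists2 F : {linear bar g -> bar g}, coderivation p F &
    forall x, F x = \sum_(1 <= n < N) f n x.
Proof.
move=> hf; elim=> [|N [F hF eF]].
  by exists \0; [exact: coderivation0 | move=> x; rewrite big_geq].
(* The sum over 1 <= n < 1 is still empty, and nothing is known about [f 0]. *)
case: N => [|N] in F hF eF *.
  by exists \0; [exact: coderivation0 | move=> x; rewrite big_geq].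
exists (F \+ f N.+1); first by apply: coderivationD => //; apply: hf.
by move=> x; rewrite big_nat_recr //= -eF.
Qed.

Lemma locally_finite_words (f : nat -> {linear bar g -> bar g}) (F : {linear bar g -> bar g}) :
  (forall w N, (weight w < N)%N -> \sum_(1 <= n < N) f n (barword w) = F (barword w)) ->
  is_locally_finite_sum f F.
Proof.
move=> h x; have [s ->] := bar_span x.
exists (\max_(t <- s) weight t.2).+1 => N hN.
rewrite linear_sum; under eq_bigr do rewrite linear_sum.
rewrite exchange_big; apply: eq_big_seq => t ts /=.
rewrite linearZ /= -(h t.2 N); last by apply: leq_trans hN; rewrite ltnS (leq_bigmax_seq t).
by rewrite scaler_sumr; apply: eq_bigr => n _; rewrite linearZ.
Qed.

End CogeneratorMaps.

(** * The tensor coalgebra as a subcoalgebra of the bar coalgebra *)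

Section Embedding.
Variables (K : fieldType) (g : gradedSpace K).
Implicit Types (c : letter g) (u v w : word g) (a b t : seq (entry g)).

Lemma tg_kills (E : lmodType K) (phi : seq (entry g) -> E) : phi [::] = 0 ->
  (forall a b, kills (fun q => phi (a ++ q :: b)) (@entry_rel K g)) -> kills phi (@tg_rel K g).
Proof.
move=> h0 h _ [|a r b hr]; first by rewrite fglift1.
rewrite fglift_comp; apply: (@eq_kills _ _ _ _ _ _ _ (h a b)) => // q.
by rewrite fglift1.
Qed.

Lemma letters_kills : kills (fun a => barword (letters a)) (@tg_rel K g).
Proof.
apply: tg_kills => [|a b]; first exact: barword_nil0.
apply: eq_kills ((barword_sym (letters a) (letters b)).1 [::] [::]) => q.
by rewrite letters_cat.
Qed.

Definition tg_bar : {linear Tg g -> bar g} := plift letters_kills.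

Lemma tg_barE a : tg_bar (tgword a) = barword (letters a).
Proof. exact: plift_gen. Qed.

(** The retraction of [tg_bar]: it projects onto the words of letters of size one. *)
Definition bar_tg_word w : Tg g := if single_letters w then tgword (flatten w) else 0.

Lemma tgword_kills : kills (@tgword K g) (@tg_rel K g).
Proof. exact: gen_kills. Qed.

Lemma tgword_entry_kills a b : kills (fun q => tgword (a ++ q :: b)) (@entry_rel K g).
Proof.
move=> r hr; have := tgword_kills (tg_entry a b hr); rewrite fglift_comp => <-.
by rewrite !fgliftE; apply: eq_bigr => q _; rewrite fglift1.
Qed.

Lemma bar_tg_kills : kills bar_tg_word (@bar_rel K g).
Proof.
have t0 : tgword [::] = 0 :> Tg g by have := tgword_kills (tg_nil g); rewrite fglift1.
apply: word_sym_kills => [u v||w wn].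
- split=> [c c'|c q q' c']; last first.
    by rewrite /bar_tg_word !single_letters_mid scaler0.
  case: c => [|e c]; last first.
    apply: eq_kills (@kills_cst0 K _ (Tg g) (@entry_rel K g)) => q.
    by rewrite /bar_tg_word /single_letters all_cat /= size_cat addnS /= andbF.
  case: c' => [|e c']; last first.
    apply: eq_kills (@kills_cst0 K _ (Tg g) (@entry_rel K g)) => q.
    by rewrite /bar_tg_word /single_letters all_cat /= andbF.
  have hs q : single_letters (u ++ ([::] ++ [:: q]) :: v) = single_letters u && single_letters v.
    by rewrite single_letters_cat.
  case h : (single_letters u && single_letters v); last first.
    by apply: eq_kills (@kills_cst0 K _ (Tg g) (@entry_rel K g)) => q; rewrite /bar_tg_word hs h.
  apply: eq_kills (tgword_entry_kills (flatten u) (flatten v)) => q.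
  by rewrite /bar_tg_word hs h flatten_cat.
- by rewrite /bar_tg_word.
rewrite /bar_tg_word; case: ifP => // /allP h.
by have := h _ wn.
Qed.

Definition bar_tg : {linear bar g -> Tg g} := plift bar_tg_kills.

Lemma bar_tgE w : bar_tg (barword w) = bar_tg_word w.
Proof. exact: plift_gen. Qed.

End Embedding.

Section Singles.
Variables (K : fieldType) (g : gradedSpace K) (p : int) (phi : word g -> g).
Hypothesis phi_cogen : cogenerator p phi.
Hypothesis phi_single : forall w, single_letters w = false -> phi w = 0.
Implicit Types (c : letter g) (u v w : word g) (q : entry g) (a b t : seq (entry g)).
Local Notation psi := (psi_of p phi).
Local Notation dsh_d := (dsh (fun q : entry g => q.1)).
Local Notation sumd a := (\sum_(q <- a) q.1).

(** No correction terms survive: q turns n letters with n entries into n + 1 letters with n entries,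
    which cannot all have size one. *)
Lemma coder_letters_rcons (E : lmodType K) (G : word g -> E) a q :
  (forall w i c, G (rcons w ((i, 0) :: c)) = 0) ->
  ev (coder p psi (letters (rcons a q))) G =
  \S_(x <- coder p psi (letters a)) G (rcons x [:: q]) +
  \S_(y <- dsh_d a) (ksgn K (p * sumd y.1) *:
     G (rcons (letters y.1) [:: psi (letters (rcons y.2 q))])).
Proof.
move=> hG; rewrite letters_rcons ev_coder_rcons; congr (_ + _).
rewrite ev_dsh_letters; apply: eq_ev => y /=.
have h0 : \S_(x <- cobar (letters y.2)) G (rcons (letters y.1) (psi x :: [:: q])) = 0.
  apply: ev_in0 => x hx; rewrite psi0 ?hG // phi_single //.
  apply/negbTE/negP => /single_letters_weight.
  rewrite (cobar_weight hx) (cobar_size hx) single_letters_weight ?letters_single // => /n_Sn.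
  by [].
rewrite ev_cogen h0 scaler0 addr0 !ev_dsh_cons !ev_dsh_nil /=.
have hn : phi (rcons (letters y.2) [::]) = 0.
  by apply: (cogen_nil_in phi_cogen); rewrite mem_rcons mem_head.
rewrite (psi0 p hn) hG scaler0 addr0.
rewrite letters_rcons letters_wdeg; congr (_ *: _); apply: ksgn_eq; parity.
Qed.

(** On words of letters of size one the coderivation gives such words again, up to words with a
    letter that starts with a zero entry. *)
Lemma eq_coder_letters (E : lmodType K) (G G' : word g -> E) a :
  (forall w i c v, G (rcons w ((i, 0) :: c) ++ v) = 0) ->
  (forall w i c v, G' (rcons w ((i, 0) :: c) ++ v) = 0) ->
  (forall b, G (letters b) = G' (letters b)) ->
  ev (coder p psi (letters a)) G = ev (coder p psi (letters a)) G'.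
Proof.
move=> h h' e.
suff H t : \S_(x <- coder p psi (letters a)) G (x ++ letters t) =
    \S_(x <- coder p psi (letters a)) G' (x ++ letters t).
  by have := H [::]; under eq_ev do rewrite cats0; under [in RHS]eq_ev do rewrite cats0.
elim/last_ind: a t => [|a q ih] t; first by rewrite !ev_coder0.
rewrite (coder_letters_rcons (G := fun x => G (x ++ letters t))) //.
rewrite (coder_letters_rcons (G := fun x => G' (x ++ letters t))) //.
congr (_ + _).
  under eq_ev do rewrite cat_rcons.
  under [in RHS]eq_ev do rewrite cat_rcons.
  exact: (ih (q :: t)).
apply: eq_ev => y; congr (_ *: _).
by rewrite -letters_rcons -letters_cat e.
Qed.

End Singles.

Section FixedCount.
Variables (K : fieldType) (L : eqType) (deg : L -> int).

Lemma unshuffE (E : lmodType K) i (F : seq L -> seq L -> E) w :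
  unshuff deg None None i F w =
  \S_(x <- dsh deg w) (if size x.1 == i then F x.1 x.2 else 0).
Proof.
rewrite unshuff_cond_bsum (ev_dsh_bsum deg w (fun a b => if size a == i then F a b else 0)).
apply: eq_bsum => m sm; rewrite andbT size_mask //.
by case: ifP => _ //; rewrite scaler0.
Qed.

End FixedCount.

Section LeibnizExtension.
Variables (K : fieldType) (g : gradedSpace K) (D : nat -> seq g -> g).
Implicit Types (c : letter g) (u v w : word g) (q : entry g) (a b t : seq (entry g)).
Hypothesis D_lin : forall n, (0 < n)%N -> multilinear_op n (D n).
Hypothesis D_deg : forall n, (0 < n)%N -> degree_op n (shdeg n) (D n).
Hypothesis D0 : D 0 [::] = 0.
Local Notation dsh_d := (dsh (fun q : entry g => q.1)).
Local Notation sumd a := (\sum_(q <- a) q.1).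

Lemma leib_corestr_letters n a :
  leib_corestr D n (letters a) = if size a == n then D n [seq q.2 | q <- a] else 0.
Proof.
rewrite /leib_corestr -/(single_letters (letters a)) letters_single flatten_letters size_map.
by rewrite andbT.
Qed.

Lemma leib_corestr_single n w : single_letters w = false -> leib_corestr D n w = 0.
Proof. by rewrite /leib_corestr /single_letters => ->; rewrite andbF. Qed.

Lemma coder_leib_letters n (n0 : (0 < n)%N) (E : lmodType K) (G : word g -> E) a t :
  hom_entries a -> (forall w i c v, G (rcons w ((i, 0) :: c) ++ v) = 0) ->
  \S_(x <- coder (-1) (psi_of (-1) (leib_corestr D n)) (letters a)) G (x ++ letters t) =
  \sum_(1 <= k < (size a).+1) \S_(y <- dsh_d (take k.-1 a))
    (ksgn K (-1 * sumd y.1) *: if size y.2 == n.-1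
      then G (letters (y.1 ++ apply_entry D (rcons y.2 (nth (0, 0) a k.-1)) :: drop k a ++ t))
      else 0).
Proof.
move=> ha hG; elim/last_ind: a t ha => [|a q ih] t ha; first by rewrite ev_coder0 big_geq.
have [hq ha'] : ghom q.1 q.2 /\ hom_entries a.
  by move: ha; rewrite -cats1 => /hom_entries_cat[h1 h2]; split=> //; apply: h2; rewrite mem_head.
rewrite (coder_letters_rcons (leib_cogenerator D_lin D_deg n0) (leib_corestr_single n)
  (G := fun x => G (x ++ letters t))) //.
rewrite size_rcons big_nat_recr //=; congr (_ + _).
  under eq_ev do rewrite cat_rcons.
  rewrite (ih (q :: t) ha'); apply: eq_big_nat => -[//|k] /andP[_ hk] /=.
  rewrite ltnS in hk; rewrite drop_rcons // cat_rcons -cats1 takel_cat ?(ltnW hk) //; apply: eq_ev => y.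
  by rewrite nth_cat hk.
rewrite -cats1 take_size_cat // drop_oversize ?size_cat ?addn1 //= cats1 nth_rcons ltnn eqxx.
apply: eq_ev_in => y hy; congr (_ *: _).
have hl : hom_entries (rcons y.2 q).
  move=> r; rewrite mem_rcons inE => /orP[/eqP -> //|hr]; apply: ha'.
  by rewrite (dsh_mem r hy) hr orbT.
rewrite psiE; last exact: letters_hom.
rewrite leib_corestr_letters size_rcons (_ : (size y.2 == n.-1) = ((size y.2).+1 == n));
  last by rewrite -[in RHS](prednK n0) eqSS.
case: eqP => [<-|_]; last exact: hG.
rewrite letters_wdeg size_rcons letters_cat /= cat_rcons /apply_entry size_rcons.
by rewrite (_ : _ - 2 = sumd (rcons y.2 q) + shdeg (size y.2).+1) // /shdeg; ring.
Qed.

End LeibnizExtension.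

(** * The odd sh Leibniz structure *)

Section LeibnizStructure.
Variables (K : fieldType) (charK0 : [pchar K] =i pred0).
Variables (g : gradedSpace K) (D : nat -> seq g -> g).
Implicit Types (c : letter g) (u v w : word g) (q : entry g) (a b t : seq (entry g)).
Hypothesis D_lin : forall n, (0 < n)%N -> multilinear_op n (D n).
Hypothesis D_deg : forall n, (0 < n)%N -> degree_op n (shdeg n) (D n).
Hypothesis D0 : D 0 [::] = 0.
Local Notation dsh_d := (dsh (fun q : entry g => q.1)).
Local Notation phiB := (leib_total D).
Local Notation psiB := (psi_of (-1) phiB).

Definition leib_map n : {linear bar g -> bar g} :=
  if n is n'.+1 then cogen_map (leib_cogenerator D_lin D_deg (ltn0Sn n')) else \0.

Definition leib_total_map : {linear bar g -> bar g} :=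
  cogen_map (leib_total_cogenerator D_lin D_deg D0).

Lemma leib_map_induced n : (0 < n)%N ->
  induced_coderivation (-1) (leib_corestr D n) (leib_map n).
Proof. by case: n => // n _; exact: (cogen_map_induced charK0). Qed.

Lemma leib_total_map_coderivation : coderivation (-1) leib_total_map.
Proof. exact: cogen_map_coderivation. Qed.

(** A word of weight below [N] has fewer than [N] letters, so the partial sum contains the one arity
    that matters. The corestrictions agree up to this weight, hence so do the coderivations. *)
Lemma leib_map_sum w N : (weight w < N)%N ->
  \sum_(1 <= n < N) leib_map n (barword w) = leib_total_map (barword w).
Proof.
move=> hN; have [F hF eF] : exists2 F : {linear bar g -> bar g}, coderivation (-1) F &
    forall x, F x = \sum_(1 <= n < N) leib_map n x.
  by apply: coderivation_sum => n /leib_map_induced[].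
rewrite -eF; apply: (coderivation_eq charK0 hF leib_total_map_coderivation _ (leqnn _)).
move=> {}w' hw lew; have [w0 wn hh] := hw.
rewrite eF linear_sum cogen_map_corestr /= asboolT //.
have lt0 : (0 < size w')%N by rewrite lt0n size_eq0.
have ltN : (size w' < N)%N by apply: leq_ltn_trans hN; apply: leq_trans (weight_size wn) lew.
rewrite (bigD1_seq (size w')) ?mem_index_iota ?lt0 ?iota_uniq //=.
have [_ -> // _] := leib_map_induced lt0.
rewrite big_nat_cond big1 ?addr0 // => n /andP[/andP[n0 _] hn].
have [_ -> // _] := leib_map_induced n0.
by rewrite /leib_corestr eq_sym (negbTE hn).
Qed.

Lemma leib_map_locally_finite : is_locally_finite_sum leib_map leib_total_map.
Proof. exact: locally_finite_words leib_map_sum. Qed.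

Hypothesis leib_square0 : forall w, hom_word w -> [::] \notin w ->
  ev (coder (-1) psiB w) phiB = 0.

Lemma leib_total_map_square x : leib_total_map (leib_total_map x) = 0.
Proof.
apply: (coderivation_square_eq0 charK0 leib_total_map_coderivation) => w [_ wn hw].
by rewrite cogen_map_comp_corestr ?leib_square0.
Qed.

Definition leib_tg n : {linear Tg g -> Tg g} := (@bar_tg K g) \o (leib_map n) \o (@tg_bar K g).

Definition leib_total_tg : {linear Tg g -> Tg g} :=
  (@bar_tg K g) \o leib_total_map \o (@tg_bar K g).

Lemma tgword_nonhom a : ~ hom_entries a -> tgword a = 0.
Proof.
move=> h; have [q [qa hq]] : exists q, q \in a /\ ~ ghom q.1 q.2.
  apply: contrapT => hn; apply: h => q qa; apply: contrapT => hq.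
  by apply: hn; exists q.
case/splitPr: qa => u v.
have := tgword_entry_kills u v (entry_nonhom hq).
by rewrite fglift1 -surjective_pairing.
Qed.

Lemma barword_entry0 u v a b i : barword (u ++ (a ++ (i, 0) :: b) :: v) = 0 :> bar g.
Proof. exact: kills_entry0 ((barword_sym u v).1 a b). Qed.

Lemma bar_tg_word_entry0 w i c v : bar_tg_word (rcons w ((i, 0) :: c) ++ v) = 0 :> Tg g.
Proof. by rewrite -bar_tgE cat_rcons (barword_entry0 w v [::] c) linear0. Qed.

Lemma bar_tg_letters a : bar_tg_word (letters a) = tgword a.
Proof. by rewrite /bar_tg_word letters_single flatten_letters. Qed.

Lemma leib_tgE n a : (0 < n)%N -> hom_entries a -> leib_tg n (tgword a) = tg_extension D n a.
Proof.
case: n => // n _ ha.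
rewrite /= tg_barE cogen_mapE ?letters_nil // ev_linear.
under eq_ev do rewrite bar_tgE -[X in bar_tg_word X](cats0 _) -[[::]]/(letters [::]).
rewrite (coder_leib_letters D_lin D_deg (ltn0Sn n)) //; last exact: bar_tg_word_entry0.
(* [k] is the position, counted from one, of the last argument of the inner operation. For [k] at
   most n there are too few letters before it for n + 1 arguments, so starting the sum at 1 adds
   only zeros. *)
have hs k y : (0 < k < (size a).+1)%N -> y \in supp (dsh_d (take k.-1 a)) ->
    (size y.2 == n) = (n < k)%N && (size y.1 == k - n.+1)%N.
  move=> /andP[k0 hk] /dsh_size; rewrite size_takel ?(leq_trans (leq_pred _)) //.
  by move: (size y.1) (size y.2) => i j; lia.
rewrite /tg_extension (big_nat_widenl n.+1 1) // [RHS]big_mkcond.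
apply: eq_big_nat => k hk /=; case: ltnP => hn; last first.
  by apply: ev_in0 => y /(hs k y hk) ->; rewrite ltnNge hn scaler0.
rewrite unshuffE; apply: eq_ev_in => y /(hs k y hk) ->; rewrite hn /=.
case: ifP => _; last by rewrite scaler0.
by rewrite bar_tg_letters cats0; congr (_ *: _); apply: ksgn_eq; rewrite /shdeg; parity.
Qed.

(** The projection between the two applications may be dropped: the intermediate words have letters
    of size one, where [tg_bar] after [bar_tg] is the identity, or are killed by both
    functionals. *)
Lemma leib_total_tg_square x : leib_total_tg (leib_total_tg x) = 0.
Proof.
move: x; apply: presented_ext => [k x y|k x y|a]; rewrite ?scaler0 ?addr0 ?linearP //.
rewrite -/(tgword a).
have [ha|/tgword_nonhom ->] := pselect (hom_entries a); last by rewrite !linear0.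
rewrite /leib_total_tg /= tg_barE.
rewrite [leib_total_map (barword _)]cogen_mapE ?letters_nil // !ev_linear.
transitivity (ev (coder (-1) psiB (letters a)) (fun x => bar_tg g (leib_total_map (barword x)))).
  apply: (eq_coder_letters (leib_total_cogenerator D_lin D_deg D0)).
  - by move=> w; rewrite /leib_total; exact: leib_corestr_single.
  - by move=> w i c v; rewrite bar_tgE bar_tg_word_entry0 !linear0.
  - by move=> w i c v; rewrite cat_rcons (barword_entry0 w v [::] c) !linear0.
  by move=> b; rewrite bar_tgE bar_tg_letters tg_barE.
have := leib_total_map_square (barword (letters a)).
rewrite [leib_total_map (barword _)]cogen_mapE ?letters_nil // ev_linear => e.
by rewrite -[RHS](linear0 (bar_tg g)) -e ev_linear.
Qed.

Lemma odd_sh_leibniz_of_square : odd_sh_leibniz D.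
Proof.
split=> [n n0|]; first by split; [exact: D_lin | exact: D_deg].
exists leib_tg, leib_total_tg; split=> [n a n0 ha|x|]; last exact: leib_total_tg_square.
  exact: leib_tgE.
have [N0 h] := leib_map_locally_finite (tg_bar g x); exists N0 => N /h.
by rewrite /leib_total_tg /= => <-; rewrite linear_sum.
Qed.

End LeibnizStructure.

Theorem theorem6p6 (K : fieldType) (charK0 : [pchar K] =i pred0)
    (g : gradedSpace K) (br : g -> g -> g) (d : nat -> g -> g)
    (g_dg_lie : dg_lie br (d 0%N))
    (d_deformation : deformation br (fun n : nat => 2 * n%:Z - 1) d) :
  invariant_sh_leibniz br (derived_bracket br d).
Proof.
have [br_lie _ _ _ _] := g_dg_lie.
have d_lin n : linear (d n) by have [] := d_deformation n.
have d_deg n : has_degree (2 * n%:Z - 1) (d n) by have [] := d_deformation n.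
have d_der n : derivation br (2 * n%:Z - 1) (d n) by have [] := d_deformation n.
have d_square n x : \sum_(i < n.+1) d i (d (n - i)%N x) = 0 by have [] := d_deformation n.
have D_lin n (_ : (0 < n)%N) := derived_bracket_linear br_lie d_lin (n := n).
have D_deg n := derived_bracket_degree br_lie d_deg (n := n).
have D0 : derived_bracket br d 0 [::] = 0 by [].
have sq := leib_square br_lie d_lin d_deg d_der d_square.
split=> //; first exact: (odd_sh_leibniz_of_square charK0 D_lin D_deg D0 sq).
pose fL := cogen_map (lie_cogenerator br_lie); pose fB := leib_total_map D_lin D_deg D0.
exists fL, (leib_map D_lin D_deg), fB; split.
- exact: (cogen_map_induced charK0).
- by move=> n; exact: leib_map_induced.
- exact: leib_map_locally_finite.
have hf : coderivation (-1) (fL \+ fB : {linear bar g -> bar g}).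
  by apply: coderivationD; exact: cogen_map_coderivation.
split=> //; apply: (coderivation_square_eq0 charK0 hf) => w [_ wn hw] /=.
(* Of the four composites the two pure ones vanish separately, while the two mixed ones cancel only
   together. *)
rewrite !linearD !cogen_map_comp_corestr // lie_square // sq //.
by rewrite add0r addr0 addrC lie_leib_square.
Qed.
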